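(* Let $d\ge 1$, $\alpha>0$, and let $w:[0,\infty)\times\mathbb R^d\to(0,\infty]$ be measurable with $w(t,-x)=w(t,x)$ for all $t>0$ and $x\in\mathbb R^d$. Assume that $Z_{\alpha,T}<\infty$ for all $T\ge 0$ and that $$\limsup_{T\to\infty}\frac{Z_{\alpha,2T}}{Z_{\alpha,T}^2}<\infty .$$ Then there exists a probability measure $\mathbb P_{\alpha,\infty}$ on $(C(\mathbb R,\mathbb R^d),\mathcal A)$ such that $\mathbb P_{\alpha,T}\to\mathbb P_{\alpha,\infty}$ locally in total variation as $T\to\infty$.
   Context: For $s,t\in\mathbb R$ let $X_{s,t}:C(\mathbb R,\mathbb R^d)\to\mathbb R^d$, $X_{s,t}(\mathbf x)=\mathbf x_{s,t}:=\mathbf x_t-\mathbf x_s$. $\mathcal A$ is the $\sigma$-algebra on $C(\mathbb R,\mathbb R^d)$ generated by all $X_{s,t}$, $s,t\in\mathbb R$, and for $a<b$, $\mathcal A_a^b:=\sigma(X_{s,t}: s,t\in[a,b])$. $\mathcal W$ is the distribution of Brownian increments, i.e. the restriction to $\mathcal A$ of the law of a two-sided standard $d$-dimensional Brownian motion. For $T>0$, $$\mathbb P_{\alpha,T}(\mathrm d\mathbf x)=\frac1{Z_{\alpha,2T}}\exp\Big(\frac\alpha2\int_{-T}^T\int_{-T}^T w(|t-s|,\mathbf x_t-\mathbf x_s)\,\mathrm ds\,\mathrm dt\Big)\mathcal W(\mathrm d\mathbf x),$$ where $Z_{\alpha,2T}$ is the normalizing constant; equivalently $Z_{\alpha,T}=\mathbb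 E_{\mathcal W}\big[\exp\big(\frac\alpha2\int_0^T\int_0^T w(|t-s|,X_{s,t})\,\mathrm ds\,\mathrm dt\big)\big]$ for $T\ge0$. A family $(\mathcal P_t)_{t>0}$ of probability measures on $(C(\mathbb R,\mathbb R^d),\mathcal A)$ converges to a probability measure $\mathcal P$ locally in total variation if for all $a<b$ the restriction of $\mathcal P_t$ to $\mathcal A_a^b$ converges in total variation to the restriction of $\mathcal P$ to $\mathcal A_a^b$ as $t\to\infty$. *)

(* Defs.v *)
From HB Require Import structures.
From mathcomp Require Import all_boot all_order all_algebra.
From mathcomp Require Import all_classical all_reals all_analysis.
From mathcomp Require Import measurable_realfun.

Set Implicit Arguments.
Unset Strict Implicit.
Unset Printing Implicit Defensive.

Import Order.TTheory GRing.Theory Num.Theory.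
Import numFieldNormedType.Exports.

Local Open Scope classical_set_scope.
Local Open Scope ring_scope.

HB.instance Definition _ (R : realType) (d : nat) :=
  let G := @open 'rV[R]_d in
  isMeasurable.Build (sigma_display G) 'rV[R]_d
    (@sigma_algebra0 _ setT G) (@sigma_algebraC _ G)
    (@sigma_algebra_bigcup _ setT G).

Definition cpath (R : realType) (d : nat) : Type := continuousType R 'rV[R]_d.

Section path_space.
Variables (R : realType) (d : nat).

HB.instance Definition _ := Choice.on (cpath R d).
HB.instance Definition _ :=
  isPointed.Build (cpath R d) (cst (0 : 'rV[R]_d) : continuousType R 'rV[R]_d).

Definition incr (s t : R) (x : cpath R d) : 'rV[R]_d := x t - x s.

Definition incr_events (J : set R) : set (set (cpath R d)) :=
  \bigcup_(st in J `*` J)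
    preimage_set_system setT (incr st.1 st.2) measurable.

Definition incr_sigma (J : set R) : set (set (cpath R d)) :=
  <<s incr_events J >>.

(* Not the Borel sigma-algebra of the path space: increments are measurable
   but evaluations [x t] are not. *)
HB.instance Definition _ :=
  let G := incr_events setT in
  isMeasurable.Build (sigma_display G) (cpath R d)
    (@sigma_algebra0 _ setT G) (@sigma_algebraC _ G)
    (@sigma_algebra_bigcup _ setT G).

End path_space.

Section brownian.
Variables (R : realType) (d : nat).

Definition independent_increments (disp : measure_display)
    (Omega : measurableType disp) (P : probability Omega R)
    (B : Omega -> cpath R d) : Prop :=
  forall (n : nat) (t : nat -> R) (E : nat -> set 'rV[R]_d),
    (forall k, (k < n)%N -> t k < t k.+1) ->
    (forall k, (k < n)%N -> measurable (E k)) ->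
    P [set omega | forall k, (k < n)%N -> E k (incr (t k) (t k.+1) (B omega))]
    = (\prod_(k < n)
        P [set omega | E k (incr (t k) (t k.+1) (B omega))])%E.

(* [B t - B s] has law N(0, (t - s) I_d), the product of d copies of
   N(0, t - s); [normal_prob] takes the standard deviation. *)
Definition gaussian_increments (disp : measure_display)
    (Omega : measurableType disp) (P : probability Omega R)
    (B : Omega -> cpath R d) : Prop :=
  forall (s t : R) (A : 'I_d -> set R),
    s < t -> (forall i, measurable (A i)) ->
    P [set omega | forall i, A i (incr s t (B omega) ord0 i)]
    = (\prod_(i < d) normal_prob 0 (Num.sqrt (t - s)) (A i))%E.

Record two_sided_brownian_motion (disp : measure_display)
    (Omega : measurableType disp) (P : probability Omega R)
    (B : Omega -> cpath R d) : Prop := TwoSidedBrownianMotion {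
  bm_measurable : forall t : R, measurable_fun setT (fun omega => B omega t);
  bm_start : {ae P, forall omega, B omega 0 = 0};
  bm_gaussian : gaussian_increments P B;
  bm_independent : independent_increments P B }.

(* The sigma-algebra is generated by increments, so this determines [W]. *)
Definition brownian_increments_law (W : probability (cpath R d) R) : Prop :=
  exists (disp : measure_display) (Omega : measurableType disp)
         (P : probability Omega R) (B : Omega -> cpath R d),
    two_sided_brownian_motion P B /\
    forall A, measurable A -> W A = pushforward P B A.

End brownian.

Section gibbs.
Variables (R : realType) (d : nat).
Variables (W : probability (cpath R d) R) (w : R -> 'rV[R]_d -> \bar R).
Variable alpha : R.
Local Open Scope ereal_scope.

Definition gibbs_weight (a b : R) (x : cpath R d) : \bar R :=
  expeR ((alpha / 2)%:E *
    \int[lebesgue_measure]_(t in `[a, b]) \int[lebesgue_measure]_(s in `[a, b])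
      w `|t - s|%R (incr s t x)).

(* Z_{alpha,T}. *)
Definition partition_function (T : R) : \bar R :=
  \int[W]_x gibbs_weight 0 T x.

(* The weight is integrated over [-T, T] but normalized by Z_{alpha,2T}, as the
   increments are stationary under [W]. *)
Definition gibbs_measure (T : R) (A : set (cpath R d)) : \bar R :=
  (fine (partition_function (2 * T)))^-1%:E *
  \int[W]_(x in A) gibbs_weight (- T) T x.

End gibbs.

Section local_total_variation.
Variables (R : realType) (d : nat).
Local Open Scope ereal_scope.

(* Up to the conventional factor 2, the total variation distance of the
   restrictions of [mu] and [nu] to the sigma-algebra [G]. *)
Definition total_variation_on (G : set (set (cpath R d)))
    (mu nu : set (cpath R d) -> \bar R) : \bar R :=
  ereal_sup [set `|mu A - nu A| | A in G].

Definition cvg_locally_total_variation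
    (P : R -> set (cpath R d) -> \bar R) (Q : set (cpath R d) -> \bar R) : Prop :=
  forall a b : R, (a < b)%R ->
    total_variation_on (incr_sigma `[a, b]) (P T) Q @[T --> (+oo_R)%R] --> 0.

End local_total_variation.

(* Main.v *)
(** The weight of a path on an interval is supermultiplicative under
    concatenation, because [w] is positive.  Cutting the time axis at the points
    of a grid [hZ] and expanding each weight according to the grid points at
    which it factorizes exactly turns [Z] into a renewal sequence: Kaluza's
    inequality makes the no-cut kernels nonnegative, and the doubling assumption
    with Fekete's argument gives [Z_t exp(- lam t)] in [[delta, 1]].  The renewal
    equation then forces the increments of this normalized sequence over a step
    [h] to vanish.  With [h = 2n] the window [[-n, n]] is a single cell of the
    centred grid, the law of the path in it is a double sum over the no-cut
    blocks straddling it, and each coefficient of that sum converges; dominated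
    tails give convergence in total variation.  The limiting densities on the
    windows are consistent and extend to a probability measure. *)

From HB Require Import structures.
Require Import Defs.
From mathcomp Require Import all_boot all_order all_algebra.
From mathcomp Require Import all_classical all_reals all_analysis.
From mathcomp Require Import measurable_realfun.
From mathcomp Require Import ring lra zify.

Set Implicit Arguments.
Unset Strict Implicit.
Unset Printing Implicit Defensive.

Import Order.TTheory GRing.Theory Num.Theory.
Import numFieldNormedType.Exports.

Local Open Scope classical_set_scope.
Local Open Scope ring_scope.

(** * Path space: measurability, splicing and shifting *)

(** Four obstacles shape the proof. (1) [w] may be infinite, so the weight is [+oo] on a null set.
    The inequalities between kernels hold on finite-energy paths only, and cut weights are truncated
    at [0] and compared almost everywhere. (2) Writing [U] for the normalized [Z] and [F] for the
    no-cut masses, nothing shows directly that [U] converges. Only the coefficients [U (T - a h -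
    h/2) * U (T - b h - h/2) / U (2 T)] matter. Slow variation makes them nearly independent of [a]
    and [b], and total mass one identifies their limit as the inverse of the sum of [m * F m]. That
    sum is finite because [U >= delta]. A lower bound for every event is enough, since the
    complement gives the upper bound. (3) A time interval is rarely a whole number of cells. The
    clipped cells at its ends are controlled by monotonicity of the no-cut kernel under outward
    extension of its endpoints. (4) For the extension, countable additivity needs an actual path in
    every decreasing intersection of non-negligible cylinders. Splicing independent paths gives
    explicit conditional expectations under [W], and such a path is then selected window by
    window. *)

Lemma measurable_fun_rV_coord (R : realType) (d : nat) (i : 'I_d) :
  measurable_fun setT (fun v : 'rV[R]_d => v ord0 i).
Proof.
apply: (measurability (RGenOInfty.G (R:=R))); first exact: RGenOInfty.measurableE.
move=> _ [_ [a ->] <-]; rewrite setTI.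
apply: sub_sigma_algebra.
apply: open_comp; last exact: interval_open.
by move=> v _; exact: coord_continuous.
Qed.

(** An open set is the countable union of the cubes contained in it that have rational centre and
    radius [1/(n+1)], and the preimage of a cube is a finite intersection of coordinate events. *)
Lemma measurable_fun_rV (disp : measure_display) (T : measurableType disp)
    (R : realType) (d : nat) (f : T -> 'rV[R]_d) :
  (forall i, measurable_fun setT (fun t => f t ord0 i)) -> measurable_fun setT f.
Proof.
move=> mf; apply: (measurability (@open 'rV[R]_d)) => //.
move=> _ [U oU <-]; rewrite setTI.
pose B (p : 'rV[rat]_d * nat) : set 'rV[R]_d :=
  [set v | forall i, `|v ord0 i - ratr (p.1 ord0 i)| < p.2.+1%:R^-1].
have -> : f @^-1` U = \bigcup_(p in [set: 'rV[rat]_d * nat])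
    (if pselect (B p `<=` U) then f @^-1` (B p) else set0).
  apply/seteqP; split => [t /= Uft|t [p _]]; last first.
    by case: pselect => //= BU Bft; exact: BU.
  have /nbhs_ballP[e /= e0 eU] : nbhs (f t) U by exact: open_nbhs_nbhs.
  have [n ne] : exists n : nat, n.+1%:R^-1 < e / 2.
    have e20 : 0 < e / 2 by rewrite divr_gt0.
    have [N _ NP] := near_infty_natSinv_lt (PosNum e20).
    by exists N; exact: (NP N (leqnn N)).
  have /choice[q qP] : forall i, exists q : rat,
      `|f t ord0 i - ratr q| < n.+1%:R^-1.
    move=> i; have : f t ord0 i < f t ord0 i + n.+1%:R^-1.
      by rewrite ltrDl invr_gt0.
    move=> /rat_in_itvoo[q]; rewrite in_itv/= => /andP[q1 q2].
    by exists q; rewrite distrC ger0_norm ?subr_ge0 ?ltrBlDl// ltW.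
  exists (\row_i q i, n) => //; case: pselect => /= [_ i|].
    by rewrite mxE.
  case=> v vB; apply: eU; split=> // k i; rewrite (ord1 k).
  have := vB i; rewrite /= mxE => vq; have fq := qP i.
  rewrite /ball/= -(subrK (ratr (q i)) (f t ord0 i)) -addrA.
  apply: (le_lt_trans (ler_normD _ _)).
  have := ltrD fq vq; rewrite (distrC (v _ _)) => /lt_le_trans; apply.
  by rewrite (splitr e) lerD// ltW.
apply: countable_bigcupT_measurable; first exact: countableP.
move=> p; case: pselect => //= _.
have -> : f @^-1` B p = \bigcap_(i in [set: 'I_d])
   ((fun t => f t ord0 i) @^-1` [set z | `|z - ratr (p.1 ord0 i)| < p.2.+1%:R^-1]).
  by apply/seteqP; split => [t Bt i _|t Bt i]; [exact: Bt|exact: (Bt i)].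
apply: fin_bigcap_measurable => // i _.
rewrite -[X in measurable X]setTI; apply: mf => //.
have -> : [set z : R | `|z - ratr (p.1 ord0 i)| < p.2.+1%:R^-1] =
   ball (ratr (p.1 ord0 i) : R) p.2.+1%:R^-1.
  by apply/seteqP; split => z /=; rewrite /ball/= distrC.
apply: open_measurable; exact: ball_open.
Qed.

Section cpath_measurability.
Variables (R : realType) (d : nat).

Lemma measurable_incr (s t : R) : measurable_fun setT (@incr R d s t).
Proof.
move=> _ Y mY; apply: sub_sigma_algebra; exists (s, t) => //.
by exists Y.
Qed.

Lemma measurable_fun_cpath (disp : measure_display) (T : measurableType disp)
    (f : T -> cpath R d) :
  (forall s t, measurable_fun setT (fun w => incr s t (f w))) ->
  measurable_fun setT f.
Proof.
move=> mf; apply: (measurability (@incr_events R d setT)) => //.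
move=> _ [_ [[s t] _ [Y mY <-]] <-]; rewrite !setTI.
by have := mf s t measurableT Y mY; rewrite setTI.
Qed.
End cpath_measurability.
(** Packs the pushforward as a measure from an explicit measurability proof, so that uniqueness
    theorems for measures can be applied to it. *)
Definition image_measure (d d' : measure_display) (T : measurableType d)
    (T' : measurableType d') (R : realType) (m : {measure set T -> \bar R})
    (f : T -> T') (mf : measurable_fun setT f) : {measure set T' -> \bar R} :=
  measure_function_pushforward__canonical__measure_function_Measure m mf.

(** * Measures on the path space are determined by increments along finite grids *)

Section finite_dimensional.
Variables (R : realType) (d : nat).
Implicit Types (r s : seq R) (E : nat -> set 'rV[R]_d) (u v : R).

(** Only consecutive increments are constrained, because independence of increments gives product
    formulas for exactly these events. They form a pi-system for a fixed grid [s], but not visibly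
    across grids. *)
Definition incr_rect s E : set (cpath R d) :=
  [set x | forall k, (k < (size s).-1)%N -> E k (incr (nth 0 s k) (nth 0 s k.+1) x)].

Definition incr_rects s : set (set (cpath R d)) :=
  [set incr_rect s E | E in [set E | forall k, measurable (E k)]].

Lemma incr_rects_setI s : setI_closed (incr_rects s).
Proof.
move=> _ _ [E mE <-] [F mF <-]; exists (fun k => E k `&` F k).
  by move=> k; exact: measurableI.
apply/seteqP; split => [x EF|x [xE xF] k ks]; last by split; [exact: xE|exact: xF].
by split => k ks; have [] := EF k ks.
Qed.

Lemma incr_rects_setT s : incr_rects s setT.
Proof. by exists (fun=> setT) => //; apply/seteqP; split. Qed.

Lemma measurable_incr_rect s E : (forall k, measurable (E k)) ->
  measurable (incr_rect s E).
Proof.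
move=> mE.
have -> : incr_rect s E = \bigcap_(k in [set k | (k < (size s).-1)%N])
    incr (nth 0 s k) (nth 0 s k.+1) @^-1` E k.
  by apply/seteqP; split => x.
apply: bigcap_measurableType => k _; rewrite -[X in measurable X]setTI.
exact: measurable_incr.
Qed.

Definition grid_type s := g_sigma_algebraType (incr_rects s).

Lemma measurable_grid_incr1 s k : (k < (size s).-1)%N ->
  measurable_fun setT (incr (nth 0 s k) (nth 0 s k.+1) : grid_type s -> 'rV[R]_d).
Proof.
move=> ks _ Y mY; rewrite setTI; apply: sub_sigma_algebra.
exists (fun j => if j == k then Y else setT) => [j|].
  by case: ifP => // _; exact: measurableT.
apply/seteqP; split => x /=; first by move/(_ k ks); rewrite eqxx.
by move=> Yx j _; case: eqP => // ->.
Qed.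

Lemma measurable_grid_incr0 s k : (k < size s)%N ->
  measurable_fun setT (incr (nth 0 s 0) (nth 0 s k) : grid_type s -> 'rV[R]_d).
Proof.
elim: k => [|k IH] ks; apply: measurable_fun_rV => i.
  by under eq_fun do rewrite /incr subrr mxE; exact: measurable_cst.
have := measurable_funD (measurableT_comp (measurable_fun_rV_coord i) (IH (ltnW ks)))
  (measurableT_comp (measurable_fun_rV_coord i)
    (@measurable_grid_incr1 s k (ltac:(by rewrite -ltnS (ltn_predK ks))))).
by apply: eq_measurable_fun => x _ /=; rewrite /incr !mxE; ring.
Qed.

Lemma measurable_grid_incr s u v : u \in s -> v \in s ->
  measurable_fun setT (incr u v : grid_type s -> 'rV[R]_d).
Proof.
move=> us vs; apply: measurable_fun_rV => i.
have mu := measurable_grid_incr0 (ltac:(by rewrite index_mem) : (index u s < size s)%N).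
have mv := measurable_grid_incr0 (ltac:(by rewrite index_mem) : (index v s < size s)%N).
have := measurable_funB (measurableT_comp (measurable_fun_rV_coord i) mv)
  (measurableT_comp (measurable_fun_rV_coord i) mu).
by apply: eq_measurable_fun => x _ /=; rewrite !nth_index// /incr !mxE; ring.
Qed.

Lemma grid_sigma_mono s r : {subset s <= r} ->
  <<s incr_rects s >> `<=` <<s incr_rects r >>.
Proof.
move=> sr; apply: smallest_sub; first exact: smallest_sigma_algebra.
move=> _ [E mE <-].
have -> : incr_rect s E = \bigcap_(k in [set k | (k < (size s).-1)%N])
    incr (nth 0 s k) (nth 0 s k.+1) @^-1` E k by apply/seteqP; split => x.
apply: (@bigcap_measurableType _ (grid_type r)) => k ks.
rewrite -[X in measurable X]setTI.
have k1s : (k.+1 < size s)%N by move: ks; rewrite /=; case: (size s).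
by apply: measurable_grid_incr => //; apply: sr; rewrite mem_nth// ltnW.
Qed.

Lemma sub_grid_measurable s : <<s incr_rects s >> `<=` measurable.
Proof.
apply: smallest_sub; first exact: (@sigma_algebra_measurable _ (cpath R d)).
by move=> _ [E mE <-]; exact: measurable_incr_rect.
Qed.

(** Two pi-system arguments. On one grid the rectangles are stable under intersection. The union
    over grids of the generated sigma-algebras is stable too, because two grids have a common
    refinement. The points [s0] may be required in every test grid; [law_glue] uses this to place
    the splicing times on the grid. *)
Lemma measure_eq_rects (m1 m2 : {measure set (cpath R d) -> \bar R}) s0 :
  (m1 setT < +oo)%E ->
  (forall s E, sorted <%R s -> {subset s0 <= s} -> (forall k, measurable (E k)) ->
    m1 (incr_rect s E) = m2 (incr_rect s E)) ->
  forall A, measurable A -> m1 A = m2 A.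
Proof.
move=> fin eq12.
pose ok s := sorted <%R s /\ {subset s0 <= s}.
have eq_grid s A : ok s -> <<s incr_rects s >> A -> m1 A = m2 A.
  move=> [ss s0s]; apply: (@g_sigma_algebra_measure_unique _ _ _ (incr_rects s) _ (fun=> setT)) => //.
  - by move=> _ [E mE <-]; exact: measurable_incr_rect.
  - by move=> _; exact: incr_rects_setT.
  - by rewrite bigcup_const.
  - exact: incr_rects_setI.
  - by move=> _ [E mE <-]; exact: eq12.
pose H := [set A | exists2 s, ok s & <<s incr_rects s >> A].
have okU s s' : exists2 r, sorted <%R r & {subset s ++ s' <= r}.
  exists (sort <=%R (undup (s ++ s'))).
    by rewrite sort_lt_sorted undup_uniq.
  by move=> z; rewrite mem_sort mem_undup.
have HT : H setT.
  have [r rs sub] := okU s0 [::]; exists r; last first.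
    by apply: sub_sigma_algebra; exact: incr_rects_setT.
  by split=> // z zs; apply: sub; rewrite cats0.
move=> A mA; apply: (@g_sigma_algebra_measure_unique _ _ _ H _ (fun=> setT)) => //.
- by move=> B [s _ sB]; exact: sub_grid_measurable sB.
- by rewrite bigcup_const.
- move=> B C [s [_ s0s] sB] [s' _ sC].
  have [r rs sub] := okU s s'; exists r.
    by split=> // z zs0; apply: sub; rewrite mem_cat s0s.
  apply: (@measurableI _ (grid_type r)).
  + by apply: grid_sigma_mono sB => z zs; apply: sub; rewrite mem_cat zs.
  + by apply: grid_sigma_mono sC => z zs; apply: sub; rewrite mem_cat zs orbT.
- by move=> B [s oks sB]; exact: eq_grid sB.
- move: A mA; apply: sub_sigma_algebra2 => _ [[u v] _ [Y mY <-]].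
  have [r rs sub] := okU s0 [:: u; v]; exists r.
    by split=> // z zs0; apply: sub; rewrite mem_cat zs0.
  by apply: (@measurable_grid_incr r u v) => //; apply: sub;
    rewrite mem_cat !inE eqxx ?orbT.
Qed.

End finite_dimensional.
Section boxes.
Variables (R : realType) (d : nat).

(** Needed because the Gaussian law of an increment is prescribed on products of coordinate sets
    only. *)
Lemma measure_eq_boxes (m1 m2 : {measure set 'rV[R]_d -> \bar R}) :
  (m1 setT < +oo)%E ->
  (forall A : 'I_d -> set R, (forall i, measurable (A i)) ->
     m1 [set v | forall i, A i (v ord0 i)] = m2 [set v | forall i, A i (v ord0 i)]) ->
  forall B, measurable B -> m1 B = m2 B.
Proof.
move=> fin eq12 B mB.
pose G := [set [set v : 'rV[R]_d | forall i, A i (v ord0 i)] |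
  A in [set A : 'I_d -> set R | forall i, measurable (A i)]].
apply: (@g_sigma_algebra_measure_unique _ _ _ G _ (fun=> setT)) => //.
- move=> _ [A mA <-].
  have -> : [set v : 'rV[R]_d | forall i, A i (v ord0 i)] =
     \bigcap_(i in [set: 'I_d]) ((fun v : 'rV[R]_d => v ord0 i) @^-1` A i).
    by apply/seteqP; split => [v vA i _|v vA i]; [exact: vA|exact: vA i I].
  apply: fin_bigcap_measurable => // i _.
  by rewrite -[X in measurable X]setTI; exact: measurable_fun_rV_coord.
- by move=> _; exists (fun=> setT) => //; apply/seteqP; split.
- by rewrite bigcup_const.
- move=> _ _ [A mA <-] [A' mA' <-]; exists (fun i => A i `&` A' i).
    by move=> i; exact: measurableI.
  apply/seteqP; split => [x AA|x [xA xA'] i]; last by split; [exact: xA|exact: xA'].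
  by split => i; have [] := AA i.
- by move=> _ [A mA <-]; exact: eq12.
- suff : measurable_fun setT (idfun : g_sigma_algebraType G -> 'rV[R]_d).
    by move=> /(_ measurableT B mB); rewrite setTI.
  apply: measurable_fun_rV => i _ Y mY; rewrite setTI.
  apply: sub_sigma_algebra; exists (fun j => if j == i then Y else setT).
    by move=> j; case: ifP => // _; exact: measurableT.
  apply/seteqP; split => x /=; first by move/(_ i); rewrite eqxx.
  by move=> Yx j; case: eqP => // ->.
Qed.

End boxes.

(** * Splicing, shifting and locality of paths *)

Section paths.
Variables (R : realType) (d : nat).
Implicit Types (a b c s t : R) (x y : cpath R d).

Definition clamp a b s := Num.max a (Num.min s b).

Lemma clamp_continuous a b : continuous (clamp a b).
Proof.
move=> s; apply: (@continuous_max R R (fun=> a) (fun s => Num.min s b)).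
  exact: cvg_cst.
by apply: (@continuous_min R R id (fun=> b)); [exact: cvg_id|exact: cvg_cst].
Qed.

Lemma clamp_id a b s : a <= s <= b -> clamp a b s = s.
Proof. by rewrite /clamp => /andP[as_ sb]; rewrite min_l// max_r. Qed.

Lemma clamp_left a b s : a <= b -> s <= a -> clamp a b s = a.
Proof.
by rewrite /clamp => ab sa; rewrite min_l ?max_l// (le_trans sa).
Qed.

Lemma clamp_right a b s : a <= b -> b <= s -> clamp a b s = b.
Proof. by rewrite /clamp => ab bs; rewrite min_r ?max_r. Qed.

Lemma clamp_clamp a b a' b' s : a' <= a -> b <= b' -> a <= b ->
  clamp a b (clamp a' b' s) = clamp a b s.
Proof.
move=> a'a bb' ab; have a'b' : a' <= b' by rewrite (le_trans a'a)// (le_trans ab).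
have [sa|as_] := leP s a'.
  by rewrite (clamp_left a'b')// !clamp_left// (le_trans sa).
have [b's|sb'] := leP b' s.
  by rewrite (clamp_right a'b')// !clamp_right// (le_trans bb').
by rewrite (@clamp_id a' b')// (ltW as_) ltW.
Qed.

Lemma clamp_itv a b s : a <= b -> a <= clamp a b s <= b.
Proof. by move=> ab; rewrite /clamp le_max lexx/= ge_max ab ge_min lexx orbT. Qed.

Lemma glue_continuous a b x y :
  continuous (fun s => x (clamp a b s) + y s - y (clamp a b s)).
Proof.
move=> s; apply: cvgB; [apply: cvgD|].
- apply: (@continuous_comp _ _ _ (clamp a b) x); [exact: clamp_continuous|exact: cts_fun].
- exact: cts_fun.
- apply: (@continuous_comp _ _ _ (clamp a b) y); [exact: clamp_continuous|exact: cts_fun].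
Qed.

(* The path with the increments of [x] inside [a, b] and those of [y] outside. *)
Definition glue a b x y : cpath R d := mkcts (@glue_continuous a b x y).

Lemma shift_continuous c x : continuous (fun s => x (s + c)).
Proof.
move=> s; apply: (@continuous_comp _ _ _ (fun s => s + c) x); last exact: cts_fun.
by apply: cvgD; [exact: cvg_id|exact: cvg_cst].
Qed.

Definition path_shift c x : cpath R d := mkcts (@shift_continuous c x).

Lemma incr_shift c x s t : incr s t (path_shift c x) = incr (s + c) (t + c) x.
Proof. by []. Qed.

Lemma incr_glue a b x y s t : incr s t (glue a b x y) =
  incr (clamp a b s) (clamp a b t) x + incr s t y -
  incr (clamp a b s) (clamp a b t) y.
Proof. by rewrite /incr /= /mkcts; apply/matrixP => i j; rewrite !mxE; ring. Qed.

Lemma incr_glue_in a b x y s t : a <= s <= b -> a <= t <= b ->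
  incr s t (glue a b x y) = incr s t x.
Proof. by move=> sab tab; rewrite incr_glue !clamp_id// addrK. Qed.

Lemma incr_glue_left a b x y s t : a <= b -> s <= a -> t <= a ->
  incr s t (glue a b x y) = incr s t y.
Proof.
move=> ab sa ta; rewrite incr_glue !clamp_left//.
by rewrite /incr !subrr add0r subr0.
Qed.

Lemma incr_glue_right a b x y s t : a <= b -> b <= s -> b <= t ->
  incr s t (glue a b x y) = incr s t y.
Proof.
move=> ab sa ta; rewrite incr_glue !clamp_right//.
by rewrite /incr !subrr add0r subr0.
Qed.

(** Associativity of splicing over nested windows; it is what turns iterated integrals of spliced
    paths into a tower property. *)
Lemma glue_glue a b a' b' x y z : a' <= a -> b <= b' -> a <= b ->
  glue a' b' (glue a b x y) z = glue a b x (glue a' b' y z).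
Proof.
move=> a'a bb' ab; apply/continuousEP => s /=; rewrite /mkcts.
rewrite clamp_clamp// (@clamp_id a' b' (clamp a b s)).
  by apply/matrixP => i j; rewrite !mxE; ring.
by have /andP[h1 h2] := clamp_itv s ab; rewrite (le_trans a'a)// (le_trans h2).
Qed.

Lemma measurable_incr_coord s t i :
  measurable_fun setT (fun x : cpath R d => incr s t x ord0 i).
Proof. exact: measurableT_comp (measurable_fun_rV_coord i) (measurable_incr _ _). Qed.

Lemma measurable_glue a b :
  measurable_fun setT (fun p : cpath R d * cpath R d => glue a b p.1 p.2).
Proof.
apply: measurable_fun_cpath => s t; apply: measurable_fun_rV => i.
have m1 u v : measurable_fun setT (fun p : cpath R d * cpath R d => incr u v p.1 ord0 i).
  exact: measurableT_comp (measurable_incr_coord u v i) measurable_fst.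
have m2 u v : measurable_fun setT (fun p : cpath R d * cpath R d => incr u v p.2 ord0 i).
  exact: measurableT_comp (measurable_incr_coord u v i) measurable_snd.
have := measurable_funB (measurable_funD (m1 (clamp a b s) (clamp a b t)) (m2 s t))
  (m2 (clamp a b s) (clamp a b t)).
by apply: eq_measurable_fun => p _; rewrite incr_glue /= /incr !mxE.
Qed.

Lemma measurable_path_shift c : measurable_fun setT (@path_shift c).
Proof.
apply: measurable_fun_cpath => s t; exact: measurable_incr.
Qed.

Definition agree_on (J : set R) x y :=
  forall s t, J s -> J t -> incr s t x = incr s t y.

(** Together with measurability for the full sigma-algebra, this stands in for measurability with
    respect to [incr_sigma J]. It is preserved by pointwise constructions and interacts directly
    with [glue]. *)
Definition local (J : set R) (U : Type) (f : cpath R d -> U) :=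
  forall x y, agree_on J x y -> f x = f y.

Lemma local_sub (J J' : set R) (U : Type) (f : cpath R d -> U) :
  J `<=` J' -> local J f -> local J' f.
Proof. by move=> JJ' lf x y xy; apply: lf => s t Js Jt; apply: xy; exact: JJ'. Qed.

(** The sets that cannot separate two paths with the same increments on [J] form a sigma-algebra
    containing the generators. *)
Lemma local_incr_sigma (J : set R) A : incr_sigma J A -> local J A.
Proof.
move=> /(_ [set B | local J B]); apply; split; first split => /=.
- by [].
- by move=> B lB x y xy; rewrite /setD/= /mkset (lB x y).
- by move=> F lF x y xy; apply/propext; split => -[k _ Fk]; exists k => //;
    [rewrite -(lF k x y)|rewrite (lF k x y)].
- move=> _ [[s t] [/= Js Jt] [Y mY <-]] x y xy /=.
  by rewrite /preimage/setI/mkset/= (xy s t).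
Qed.

Lemma incr_sigma_measurable (J : set R) : @incr_sigma R d J `<=` measurable.
Proof.
apply: smallest_sub; first exact: (@sigma_algebra_measurable _ (cpath R d)).
move=> _ [[s t] _ [Y mY <-]]; exact: measurable_incr.
Qed.

End paths.
Lemma ltn_predRL_nat (k n : nat) : (k < n.-1)%N -> (k.+1 < n)%N.
Proof. by case: n. Qed.

(** * Stationarity and independence of increments under [W] *)

Section wiener.
Variables (R : realType) (d : nat) (W : probability (cpath R d) R).
Hypothesis hW : brownian_increments_law W.
Local Open Scope ereal_scope.

Lemma measurable_incr_pre s t (Y : set 'rV[R]_d) : measurable Y ->
  measurable [set x : cpath R d | Y (incr s t x)].
Proof.
by move=> mY; rewrite -[X in measurable X]setTI; exact: measurable_incr.
Qed.

Lemma law_incr_rect (s : seq R) (E : nat -> set 'rV[R]_d) : sorted <%R s ->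
  (forall k, measurable (E k)) ->
  W (incr_rect s E) =
  \prod_(k < (size s).-1) W [set x | E k (incr (nth 0%R s k) (nth 0%R s k.+1) x)].
Proof.
move=> ss mE; have [disp [Om [P [B [[_ _ _ BI] WE]]]]] := hW.
rewrite WE; last exact: measurable_incr_rect.
have := BI (size s).-1 (nth 0%R s) E _ (fun k _ => mE k).
rewrite /pushforward/= => ->.
  by apply: eq_bigr => k _; rewrite WE//; exact: measurable_incr_pre.
move=> k /ltn_predRL_nat ks.
by apply/(sorted_ltn_nth lt_trans) => //; rewrite inE// ltnW.
Qed.

Lemma law_incr_shift (s t c : R) (Y : set 'rV[R]_d) : (s < t)%R -> measurable Y ->
  W [set x | Y (incr s t x)] = W [set x | Y (incr (s + c)%R (t + c)%R x)].
Proof.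
move=> st mY; have [disp [Om [P [B [[_ _ BG _] WE]]]]] := hW.
pose m1 := image_measure W (measurable_incr s t).
pose m2 := image_measure W (measurable_incr (s + c) (t + c)).
apply: (@measure_eq_boxes _ _ m1 m2) => //.
  by rewrite /m1/= /pushforward preimage_setT probability_setT ltry.
move=> A mA; rewrite /m1 /m2 /= /pushforward.
have mbox u v : measurable (@incr R d u v @^-1` [set v | forall i, A i (v ord0 i)]).
  have -> : @incr R d u v @^-1` [set v | forall i, A i (v ord0 i)] =
     \bigcap_(i in [set: 'I_d]) ((fun x => incr u v x ord0 i) @^-1` A i).
    by apply/seteqP; split => [x xA i _|x xA i]; [exact: xA|exact: xA i I].
  apply: fin_bigcap_measurable => // i _.
  by rewrite -[X in measurable X]setTI; exact: measurable_incr_coord.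
rewrite (WE _ (mbox _ _)) (WE _ (mbox _ _)).
have st' : (s + c < t + c)%R by rewrite ltrD2r.
transitivity (\prod_(i < d) normal_prob 0 (Num.sqrt (t - s)) (A i)); first exact: BG.
have -> : (t - s = t + c - (s + c))%R by ring.
by apply/esym; exact: BG.
Qed.

Lemma law_path_shift (c : R) (A : set (cpath R d)) : measurable A ->
  W (path_shift c @^-1` A) = W A.
Proof.
move=> mA; pose m := image_measure W (@measurable_path_shift R d c).
apply: (@measure_eq_rects _ _ m W [::]) => //.
  by rewrite /m/= /pushforward preimage_setT probability_setT ltry.
move=> s E ss _ mE; rewrite /m/= /pushforward.
have sc : (size s = size [seq u + c | u <- s])%R by rewrite size_map.
have -> : path_shift c @^-1` incr_rect s E = incr_rect [seq (u + c)%R | u <- s] E.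
  apply/seteqP; split => x xE k ks; have := xE k; rewrite -?sc in ks *;
    move=> /(_ ks); rewrite (nth_map 0%R) ?(nth_map 0%R (0%R) (fun u => u + c)%R)//;
    by move: ks; case: (size s) => //= n; rewrite ?ltnS => // /ltnW.
rewrite !law_incr_rect//; last first.
  by rewrite sorted_map; apply: sub_sorted ss => u v /=; rewrite ltrD2r.
rewrite -sc; apply: eq_bigr => k _; rewrite !(nth_map 0%R); last 2 first.
- exact: ltn_predRL_nat.
- by rewrite ltnW// ltn_predRL_nat.
rewrite -law_incr_shift//; have /ltn_predRL_nat ks := ltn_ord k.
by apply/(sorted_ltn_nth lt_trans) => //; rewrite inE// ltnW.
Qed.

(** Replacing the increments inside [[a, b]] by those of an independent Brownian path does not
    change the law. On a grid containing [a] and [b] every cell lies inside or outside [[a, b]], so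
    a rectangle pulls back to a product of two rectangles whose probabilities multiply back to the
    original one. *)
Lemma law_glue (a b : R) (A : set (cpath R d)) : (a <= b)%R -> measurable A ->
  (W \x W) ((fun p => glue a b p.1 p.2) @^-1` A) = W A.
Proof.
move=> ab mA; pose m := image_measure (W \x W) (@measurable_glue R d a b).
apply: (@measure_eq_rects _ _ m W [:: a; b]) => //.
  by rewrite /m/= /pushforward preimage_setT probability_setT ltry.
move=> s E ss abs mE; rewrite /m/= /pushforward.
pose ins k := (a <= nth 0%R s k)%R && (nth 0%R s k.+1 <= b)%R.
pose Ei k := if ins k then E k else setT.
pose Eo k := if ins k then setT else E k.
have mEi k : measurable (Ei k) by rewrite /Ei; case: ifP => // _; exact: measurableT.
have mEo k : measurable (Eo k) by rewrite /Eo; case: ifP => // _; exact: measurableT.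
have ssl : sorted <=%R s by apply: (sub_sorted _ ss) => u v /ltW.
have glueE k x y : (k < (size s).-1)%N ->
    incr (nth 0%R s k) (nth 0%R s k.+1) (glue a b x y) =
    if ins k then incr (nth 0%R s k) (nth 0%R s k.+1) x
    else incr (nth 0%R s k) (nth 0%R s k.+1) y.
  move=> ks.
  have k1s : (k.+1 < size s)%N by move: ks; case: (size s).
  have kk1 : (nth 0%R s k < nth 0%R s k.+1)%R.
    by apply/(sorted_ltn_nth lt_trans) => //; rewrite inE// ltnW.
  (* No grid point lies strictly between two consecutive ones; applied to [a] and [b], this decides
     on which side of each splicing time the cell lies. *)
  have cell u : u \in s -> (u <= nth 0%R s k)%R || (nth 0%R s k.+1 <= u)%R.
    move=> us; have [//|] := leP u (nth 0%R s k); rewrite /= -{1}(nth_index 0%R us).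
    rewrite -[X in (_ <= X)%R](nth_index 0%R us) => ku.
    have ui : (index u s < size s)%N by rewrite index_mem.
    have {}ku : (k < index u s)%N.
      rewrite ltnNge; apply/negP => uk; move: ku; rewrite ltNge => /negP; apply.
      by apply: (sorted_leq_nth le_trans le_refl) => //; rewrite inE ltnW.
    by apply: (sorted_leq_nth le_trans le_refl).
  rewrite /ins; have /orP[ak|ka] := cell a (abs _ (mem_head _ _)); last first.
    rewrite leNgt (lt_le_trans kk1 ka)/= incr_glue_left//.
    by rewrite (le_trans (ltW kk1)).
  have /orP[bk|kb] : (b <= nth 0%R s k)%R || (nth 0%R s k.+1 <= b)%R.
  - by apply: cell; apply: abs; rewrite !inE eqxx orbT.
  - by rewrite ak/= leNgt (le_lt_trans bk kk1)/= incr_glue_right// (le_trans bk (ltW kk1)).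
  - by rewrite ak kb/= incr_glue_in// ?ak ?kb ?(le_trans (ltW kk1) kb)// (le_trans ak (ltW kk1)).
have -> : (fun p => glue a b p.1 p.2) @^-1` incr_rect s E =
    incr_rect s Ei `*` incr_rect s Eo.
  apply/seteqP; split => -[x y] /=.
    by move=> xyE; split=> k ks; have := xyE k ks; rewrite /= glueE// /Ei /Eo;
      case: ifP.
  by move=> [/= xE yE] k ks /=; rewrite glueE//; have := xE k ks; have := yE k ks;
    rewrite /Ei /Eo; case: ifP.
rewrite product_measure1E; [|exact: measurable_incr_rect|exact: measurable_incr_rect].
transitivity (W (incr_rect s Ei) * W (incr_rect s Eo)) => //.
rewrite (law_incr_rect ss mEi) (law_incr_rect ss mEo) (law_incr_rect ss mE).
rewrite -big_split/=; apply: eq_bigr => k _.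
rewrite /Ei /Eo; case: ifP => _.
- have -> : [set x : cpath R d | setT (incr s`_k s`_k.+1 x)] = setT by apply/seteqP.
  by rewrite probability_setT mule1.
- have -> : [set x : cpath R d | setT (incr s`_k s`_k.+1 x)] = setT by apply/seteqP.
  by rewrite probability_setT mul1e.
Qed.

Lemma integral_path_shift (c : R) (f : cpath R d -> \bar R) :
  measurable_fun setT f -> (forall x, 0 <= f x) ->
  \int[W]_x f (path_shift c x) = \int[W]_x f x.
Proof.
move=> mf f0.
have := ge0_integral_pushforward (@measurable_path_shift R d c) W measurableT mf
  (fun y _ => f0 y).
rewrite preimage_setT => <-.
apply: eq_measure_integral => [|mp A mA _]; first exact: measurable_path_shift.
exact: law_path_shift.
Qed.

Lemma integral_glue (a b : R) (f : cpath R d -> \bar R) : (a <= b)%R ->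
  measurable_fun setT f -> (forall x, 0 <= f x) ->
  \int[W]_x \int[W]_y f (glue a b x y) = \int[W]_x f x.
Proof.
move=> ab mf f0.
rewrite -(fubini_tonelli1 (fun p => f (glue a b p.1 p.2)))//; last first.
  exact: measurableT_comp mf (measurable_glue a b).
have := ge0_integral_pushforward (@measurable_glue R d a b) (W \x W) measurableT mf
  (fun y _ => f0 y).
rewrite preimage_setT => <-.
apply: eq_measure_integral => [|mg A mA _]; first exact: measurable_glue.
exact: law_glue.
Qed.

(** The invariances under [glue] say that [f] sees only increments inside [[a, b]] and [g] only
    those outside; after splicing in an independent copy the double integral separates. *)
Lemma integral_indep (a b : R) (f g : cpath R d -> \bar R) : (a <= b)%R ->
  measurable_fun setT f -> (forall x, 0 <= f x) ->
  measurable_fun setT g -> (forall x, 0 <= g x) ->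
  (forall x y, f (glue a b x y) = f x) -> (forall x y, g (glue a b x y) = g y) ->
  \int[W]_x (f x * g x) = \int[W]_x f x * \int[W]_x g x.
Proof.
move=> ab mf f0 mg g0 fE gE.
rewrite -(@integral_glue a b)//; last 2 first.
- exact: emeasurable_funM.
- by move=> x; rewrite mule_ge0.
under eq_integral => x _.
  under eq_integral => y _ do rewrite fE gE.
  rewrite ge0_integralZl//.
  over.
by rewrite ge0_integralZr// integral_ge0.
Qed.

End wiener.
(** Otherwise [F j y] would decrease to [0] for almost every [y], and dominated convergence with
    dominating function [F 0] would send the integrals to [0], against the bound [eta]. *)
Lemma exists_decreasing_lower_bound (disp : measure_display)
    (T : measurableType disp) (R : realType) (mu : {measure set T -> \bar R})
    (F : nat -> T -> \bar R) (good : T -> Prop) (eta : R) :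
  (forall j, measurable_fun setT (F j)) -> (forall j y, 0 <= F j y)%E ->
  {ae mu, forall y, good y} ->
  (forall y j, good y -> F j.+1 y <= F j y)%E ->
  (\int[mu]_y F 0%N y < +oo)%E -> 0 < eta ->
  (forall j, eta%:E <= \int[mu]_y F j y)%E ->
  exists2 y, good y & exists2 e : R, 0 < e & (forall j, e%:E <= F j y)%E.
Proof.
move=> mF F0 aeg Fdec Ffin eta0 etaF.
apply/not_exists2P => /= noy.
have homF y i j : good y -> (i <= j)%N -> (F j y <= F i y)%E.
  move=> gy; elim: j => [|j IH]; first by rewrite leqn0 => /eqP ->.
  by rewrite leq_eqVlt => /predU1P[->//|/IH]; apply: le_trans; exact: Fdec.
have F0cvg y : good y -> F ^~ y @ \oo --> 0%E.
  move=> gy; have [//|] := noy y => noe.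
  have ndF : nonincreasing_seq (F ^~ y) by move=> i j ij; exact: homF.
  have -> : 0%E = ereal_inf (range (F ^~ y)); last exact: ereal_nonincreasing_cvgn.
  apply/eqP; rewrite eq_le; apply/andP; split.
    by apply: le_ereal_inf_tmp => _ [j _ <-].
  rewrite leNgt; apply/negP => infgt0; apply: noe.
  have [e e0 einf] : exists2 e : R, 0 < e & (e%:E <= ereal_inf (range (F ^~ y)))%E.
    case: (ereal_inf _) infgt0 => [r|_|//]; last by exists 1; rewrite ?leey.
    by rewrite lte_fin => r0; exists r.
  exists e => // j; apply: (le_trans einf).
  by apply: ereal_inf_lbound; exists j.
have i0 : mu.-integrable setT (F 0%N).
  apply/integrableP; split=> //.
  by under eq_integral do rewrite gee0_abs//.
have [] := @dominated_convergence _ _ _ mu _ measurableT F (cst 0%E) (F 0%N) mF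
  (measurable_cst _) _ i0 _.
- by apply: filterS aeg => y gy _; exact: F0cvg.
- by apply: filterS aeg => y gy n _; rewrite gee0_abs//; exact: homF.
move=> _ _; rewrite integral0 => cvgF.
have : (eta%:E <= limn (fun n => \int[mu]_y F n y))%E.
  by apply: lime_ge; [apply/cvg_ex; exists 0%E|near=> n; exact: etaF].
by move/cvg_lim : (cvgF) => ->//; rewrite lee_fin leNgt eta0.
Unshelve. all: by end_near.
Qed.
(** On the set where [u >= v + 1/(n+1)] the excess of the integral of [u] is at least the measure of
    that set over [n+1]. Finiteness of the integral of [v] allows cancelling, and these sets exhaust
    the set where [v < u]. *)
Lemma integral_le_measure_lt0 (disp : measure_display) (T : measurableType disp)
    (R : realType) (mu : {measure set T -> \bar R}) (u v : T -> \bar R) :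
  measurable_fun setT u -> measurable_fun setT v ->
  (forall x, 0 <= u x)%E -> (forall x, 0 <= v x)%E ->
  (\int[mu]_(x in [set x | v x < u x]) v x < +oo)%E ->
  (\int[mu]_(x in [set x | v x < u x]) u x <= \int[mu]_(x in [set x | v x < u x]) v x)%E ->
  mu [set x | (v x < u x)%E] = 0%E.
Proof.
move=> mu_ mv u0 v0; set B := [set x | _] => Bfin uv.
have mB : measurable B.
  by rewrite -[B]setTI; exact: emeasurable_fun_lt.
pose C n := B `&` [set x | v x + (n.+1%:R^-1)%:E <= u x]%E.
have mC n : measurable (C n).
  apply: measurableI => //; rewrite -[X in measurable X]setTI.
  apply: emeasurable_fun_le => //; exact: emeasurable_funD.
have BC : B `<=` \bigcup_n C n.
  move=> x Bx; have vfin : v x \is a fin_num.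
    by rewrite ge0_fin_numE// (lt_le_trans Bx)// leey.
  have : (0 < u x - v x)%E by rewrite sube_gt0.
  move=> uv0; have [e e0 eu] : exists2 e : R, 0 < e & (e%:E <= u x - v x)%E.
    case: (u x - v x)%E uv0 => [r|_|//]; last by exists 1; rewrite ?leey.
    by rewrite lte_fin => r0; exists r.
  have [N _ NP] := near_infty_natSinv_lt (PosNum e0).
  exists N => //; split => //=; rewrite addeC -leeBrDr//.
  by apply: le_trans eu; rewrite lee_fin ltW//; exact: (NP N (leqnn N)).
have C0 n : mu (C n) = 0%E.
  apply/eqP; rewrite eq_le measure_ge0 andbT.
  have : (\int[mu]_(x in B) (v x + (n.+1%:R^-1)%:E * (\1_(C n) x)%:E) <= \int[mu]_(x in B) v x)%E.
    apply: le_trans uv; apply: ge0_le_integral => //.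
    - by move=> x _; rewrite adde_ge0// mule_ge0// lee_fin.
    - apply: emeasurable_funD; first exact: measurable_funTS.
      by apply: measurable_funTS; apply: measurable_funeM; apply: measurableT_comp.
    - exact: measurable_funTS.
    - move=> x Bx; rewrite indicE; case: (boolP (x \in C n)).
        by rewrite inE => -[_ /=]; rewrite mule1.
      by rewrite mule0 adde0 => _; exact: ltW.
  rewrite ge0_integralD//; [|exact: measurable_funTS|by  apply: measurable_funTS; apply: measurable_funeM; apply: measurableT_comp].
  rewrite ge0_integralZl//; [|by apply: measurable_funTS; apply: measurableT_comp].
  rewrite integral_indic// -[X in (_ <= X)%E -> _]adde0 leeD2lE; last first.
    by rewrite ge0_fin_numE// integral_ge0.
  rewrite setIC; have -> : B `&` C n = C n by rewrite /C setIA setIid.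
  by rewrite -[X in (_ <= X)%E -> _](mule0 (n.+1%:R^-1)%:E) lee_pmul2l.
apply/eqP; rewrite eq_le measure_ge0 andbT.
apply: (@le_trans _ _ (\sum_(n <oo) mu (C n))%E).
  by apply: measure_sigma_subadditive.
by rewrite eseries0// => n _ _; exact: C0.
Qed.
Section local_paths.
Variables (R : realType) (d : nat).

Lemma measurable_fun_agree (U : Type) (f : cpath R d -> U) :
  (forall v, measurable (f @^-1` [set v])) -> local setT f.
Proof.
move=> mf x y xy.
have /local_incr_sigma/(_ x y xy) : incr_sigma setT (f @^-1` [set f x]) by exact: mf.
by move=> e; have : (f @^-1` [set f x]) x by []; rewrite e /= => ->.
Qed.

Lemma measurable_fun_local (f : cpath R d -> \bar R) :
  measurable_fun setT f -> local setT f.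
Proof.
move=> mf; apply: measurable_fun_agree => v.
rewrite -[X in measurable X]setTI; apply: mf => //.
Qed.

Lemma measurable_glue2 a b x : measurable_fun setT (@glue R d a b x).
Proof. exact: measurableT_comp (measurable_glue a b) (pair1_measurable x). Qed.

Lemma glue_same a b (x y z : cpath R d) : a <= b ->
  glue a b (glue a b x y) z = glue a b x z.
Proof.
move=> ab; apply/continuousEP => s /=; rewrite /mkcts clamp_clamp//.
by apply/matrixP => i j; rewrite !mxE; ring.
Qed.

Lemma agree_glue a b x y : agree_on `[a, b] (@glue R d a b x y) x.
Proof. by move=> s t; rewrite /= !in_itv/= => sab tab; exact: incr_glue_in. Qed.

Lemma agree_on_trans (J : set R) (x y z : cpath R d) :
  agree_on J x y -> agree_on J y z -> agree_on J x z.
Proof. by move=> xy yz s t Js Jt; rewrite xy ?yz. Qed.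

Lemma agree_on_sub (J J' : set R) (x y : cpath R d) : J `<=` J' ->
  agree_on J' x y -> agree_on J x y.
Proof. by move=> JJ' xy s t Js Jt; apply: xy; exact: JJ'. Qed.

Definition sym_itv (r : nat) : set R := `[- r%:R, r%:R].

Lemma sym_itv_le m n : (m <= n)%N -> sym_itv m `<=` sym_itv n.
Proof.
move=> mn s; rewrite /sym_itv /= !in_itv/= => /andP[h1 h2].
by rewrite (le_trans _ h1) ?(le_trans h2)// ?lerN2 ler_nat.
Qed.

(** The increments stabilize on every bounded interval. The limit is anchored at [0] because the
    paths agree in increments, not in values. *)
Lemma path_limit (r : nat -> nat) (x : nat -> cpath R d) :
  (forall n, (n <= r n)%N) -> {homo r : m n / (m <= n)%N} ->
  (forall n, agree_on (sym_itv (r n)) (x n.+1) (x n)) ->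
  exists X, forall n, agree_on (sym_itv (r n)) X (x n).
Proof.
move=> nr rmono xS.
have xmn m n : (m <= n)%N -> agree_on (sym_itv (r m)) (x n) (x m).
  elim: n => [|n IH]; first by rewrite leqn0 => /eqP ->.
  rewrite leq_eqVlt => /predU1P[->//|mn]; apply: agree_on_trans (IH mn).
  by apply: agree_on_sub (xS n); apply: sym_itv_le; exact: rmono.
pose N s := (Num.truncn `|s : R|).+1.
have memN s n : (N s <= n)%N -> sym_itv (r n) s.
  move=> Nn; rewrite /sym_itv/= in_itv/= -ler_norml.
  have /andP[_ /ltW] := truncn_itv (normr_ge0 s); move=> /le_trans; apply.
  by rewrite ler_nat (leq_trans Nn).
have mem0 n : sym_itv (r n) 0.
  by rewrite /sym_itv/= in_itv/= oppr_le0 !ler0n.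
pose X s := incr 0 s (x (N s)).
have XE s n : (N s <= n)%N -> X s = incr 0 s (x n).
  by move=> Nn; rewrite /X -(xmn _ _ Nn)//; exact: memN.
have Xc : continuous X.
  (* The extra [1] makes one index serve a whole unit ball around [s], so [X] coincides near [s]
     with a fixed continuous path. *)
  move=> s; pose n := (N (`|s| + 1)).
  have near_n : \forall t \near s, X t = incr 0 t (x n).
    apply: filterS (nbhsx_ballx s 1 ltr01) => t st; apply: XE; rewrite /N ltnS; apply: le_truncn.
    rewrite (ger0_norm (_ : 0 <= `|s| + 1)) ?addr_ge0//.
    rewrite -(subrK s t) (le_trans (ler_normD _ _))// addrC lerD2l distrC ltW//.
  have : {for s, continuous (fun t => incr 0 t (x n))}.
    by apply: cvgB; [exact: cts_fun|exact: cvg_cst].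
  move=> cs; rewrite /continuous_at (nbhs_singleton near_n).
  by apply: cvg_trans cs; apply: near_eq_cvg; apply: filterS near_n => t ->.
exists (mkcts Xc) => n s t sn tn.
pose M := maxn n (maxn (N s) (N t)).
rewrite -(xmn n M) ?leq_maxl// /incr /= /mkcts (@XE s M) ?(@XE t M).
- by rewrite /incr opprB addrA subrK.
- by rewrite /M !leq_max leqnn !orbT.
- by rewrite /M !leq_max leqnn !orbT.
Qed.
End local_paths.

(** * A path in the intersection of decreasing cylinders that keep their mass *)

Section selection.
Variables (R : realType) (d : nat) (W : probability (cpath R d) R).
Hypothesis hW : brownian_increments_law W.
Local Open Scope ereal_scope.

Definition cylinder (n : nat) : set (set (cpath R d)) :=
  [set A | measurable A /\ local (sym_itv n) A].

Variable r : nat -> nat.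
Hypothesis r0 : r 0 = 0%N.
Hypothesis r_ge : forall n, (n <= r n)%N.
Hypothesis r_mono : {homo r : m n / (m <= n)%N}.
Variable g : nat -> cpath R d -> \bar R.
Hypothesis mg : forall k, measurable_fun setT (g k).
Hypothesis g0 : forall k x, 0 <= g k x.
Hypothesis g1 : forall k, \int[W]_x g k x < +oo.
Hypothesis gcons : forall k B, cylinder (r k) B ->
  \int[W]_(x in B) g k x = \int[W]_(x in B) g k.+1 x.
Variable A : nat -> set (cpath R d).
Hypothesis cA : forall k, cylinder (r k) (A k).
Hypothesis decA : forall k, A k.+1 `<=` A k.
Variable eps : R.
Hypothesis eps0 : (0 < eps)%R.
Hypothesis Aeps : forall k, eps%:E <= \int[W]_(x in A k) g k x.

Let mA k : measurable (A k). Proof. by have [] := cA k. Qed.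

Let G m : cpath R d -> cpath R d -> cpath R d := glue (- (r m)%:R) (r m)%:R.

Let rad m : (- (r m)%:R <= (r m)%:R :> R)%R.
Proof. by rewrite -subr_ge0 opprK addr_ge0. Qed.

Let h k (x : cpath R d) : \bar R := (g k \_ (A k)) x.

Let mh k : measurable_fun setT (h k).
Proof.
by apply/(measurable_restrictT _ (mA k)); exact: measurable_funTS.
Qed.

Let h0 k x : 0 <= h k x.
Proof. by rewrite /h /patch; case: ifP. Qed.

(** A version of the conditional expectation under [W] of [g k] restricted to [A k], given the
    increments in the window of radius [r m]. *)
Let psi m k x := \int[W]_y h k (G m x y).

Let mpsi m k : measurable_fun setT (psi m k).
Proof.
apply: (measurable_fun_fubini_tonelli_F (fun p => h k (G m p.1 p.2))) => //.
exact: measurableT_comp (mh k) (measurable_glue _ _).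
Qed.

Let psi0 m k x : 0 <= psi m k x.
Proof. by apply: integral_ge0. Qed.

Let psi_glue m k x y : psi m k (G m x y) = psi m k x.
Proof. by apply: eq_integral => z _; rewrite /G glue_same. Qed.

Let tower m m' (f : cpath R d -> \bar R) x : (m <= m')%N ->
  measurable_fun setT f -> (forall x, 0 <= f x) ->
  \int[W]_y \int[W]_z f (G m' (G m x y) z) = \int[W]_y f (G m x y).
Proof.
move=> mm' mf f0.
have mfG : measurable_fun setT (fun y => f (G m x y)).
  exact: measurableT_comp mf (measurable_glue2 _ _ _).
transitivity (\int[W]_y \int[W]_z f (G m x (G m' y z))); last first.
  exact: (integral_glue hW (rad m') mfG).
apply: eq_integral => y _; apply: eq_integral => z _.
by rewrite /G glue_glue// ?lerN2 ler_nat r_mono.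
Qed.

Let local_psi m k : local (sym_itv (r m)) (psi m k).
Proof.
move=> x y xy; apply: eq_integral => z _.
apply: (measurable_fun_local (mh k)) => s t _ _.
rewrite !incr_glue xy//= /sym_itv/= in_itv/=; exact: clamp_itv.
Qed.

Let int_psi m k B : cylinder (r m) B ->
  \int[W]_(x in B) psi m k x = \int[W]_(x in B `&` A k) g k x.
Proof.
move=> [mB lB]; transitivity (\int[W]_x ((h k) \_ B) x); last first.
  by rewrite -integral_mkcond integral_mkcondr.
rewrite [LHS]integral_mkcond.
have mhB : measurable_fun setT ((h k) \_ B).
  by apply/(measurable_restrictT _ mB); exact: measurable_funTS.
rewrite -(integral_glue hW (rad m) mhB); last first.
  by move=> x; rewrite /patch; case: ifP.
apply: eq_integral => x _; rewrite [LHS]/patch.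
have BG y : B (G m x y) = B x.
  by apply: lB; exact: agree_glue.
case: ifPn => xB.
  apply: eq_integral => y _; rewrite /patch ifT//.
  by apply/mem_set; rewrite -/(G m x y) BG; exact: set_mem.
rewrite (eq_integral (fun=> 0)) ?integral0// => y _; rewrite /patch ifF//.
apply/negP => /set_mem; rewrite -/(G m x y) BG => Bx.
by move: xB => /negP; apply; exact: mem_set.
Qed.

Let cylinderI n B C : cylinder n B -> cylinder n C -> cylinder n (B `&` C).
Proof.
move=> [mB lB] [mC lC]; split; first exact: measurableI.
by move=> x y xy; rewrite /setI/mkset (lB _ _ xy) (lC _ _ xy).
Qed.

Let cylinder_le m n B : (m <= n)%N -> cylinder m B -> cylinder n B.
Proof.
by move=> mn [mB lB]; split=> //; apply: local_sub lB; exact: sym_itv_le.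
Qed.

Let psi_fin m k B : cylinder (r m) B -> \int[W]_(x in B) psi m k x < +oo.
Proof.
move=> cB; rewrite int_psi//; apply: le_lt_trans (g1 k).
apply: ge0_subset_integral => //; apply: measurableI; [by case: cB|exact: mA].
Qed.

(** The exceptional set [B] is a cylinder of level [m <= k], so consistency replaces [g k] by
    [g k.+1] on the intersection of [B] and [A k], and shrinking [A k] to [A k.+1] only lowers the
    integral. Over [B] the integral of the larger function is thus at most that of the smaller
    one. *)
Let null_incr m k : (m <= k)%N -> W [set x | psi m k x < psi m k.+1 x] = 0.
Proof.
move=> mk.
have cB : cylinder (r m) [set x | psi m k x < psi m k.+1 x].
  split; first by rewrite -[X in measurable X]setTI; exact: emeasurable_fun_lt.
  by move=> x y xy; rewrite /mkset !(local_psi _ xy).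
apply: (integral_le_measure_lt0 (mpsi m k.+1) (mpsi m k) (psi0 _ _) (psi0 _ _)).
  exact: psi_fin.
rewrite !int_psi//; set B := [set x | _] in cB *.
rewrite (@gcons k (B `&` A k)); last first.
  by apply: cylinderI => //; apply: cylinder_le cB; exact: r_mono.
apply: ge0_subset_integral => //.
- by apply: measurableI; [case: cB|exact: mA].
- by apply: measurableI; [case: cB|exact: mA].
- exact: measurable_funTS.
- by apply: setIS; exact: decA.
Qed.

Let good x := forall m k, (m <= k)%N -> psi m k.+1 x <= psi m k x /\ psi m k x < +oo.

Let bad := \bigcup_m \bigcup_k
  ([set x | psi m (m + k)%N x < psi m (m + k).+1 x] `|` [set x | psi m (m + k)%N x = +oo]).

Let mbad : measurable bad.
Proof.
apply: bigcupT_measurable => m; apply: bigcupT_measurable => k.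
apply: measurableU; first by rewrite -[X in measurable X]setTI; exact: emeasurable_fun_lt.
by rewrite -[X in measurable X]setTI; exact: (mpsi m (m + k)%N measurableT (emeasurable_set1 +oo)).
Qed.

Let bad0 : W bad = 0.
Proof.
apply/negligibleP => //; apply: negligible_bigcup => m; apply: negligible_bigcup => k.
apply: negligibleU.
  apply/negligibleP; last by apply: null_incr; exact: leq_addr.
  by rewrite -[X in measurable X]setTI; exact: emeasurable_fun_lt.
have psii : W.-integrable setT (psi m (m + k)).
  apply/integrableP; split=> //.
  under eq_integral do rewrite gee0_abs//.
  by apply: psi_fin; split.
have := integrable_ae measurableT psii.
by move=> [N [mN N0 sub]]; exists N; split=> // x /= xoo; apply: sub => /= /(_ I);
  rewrite xoo.
Qed.

Let goodP x : ~ bad x -> good x.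
Proof.
move=> nb m k mk; split.
  rewrite leNgt; apply/negP => lt; apply: nb; exists m => //; exists (k - m)%N => //.
  by left; rewrite /= subnKC.
rewrite ltey; apply/negP => /eqP oo; apply: nb; exists m => //; exists (k - m)%N => //.
by right; rewrite /= subnKC.
Qed.

(** Nullity of [bad] under [W] says nothing about one chosen path. The selection therefore carries
    the stronger property that almost every continuation of the current window avoids [bad]. *)
Let nul m x := \int[W]_y (\1_bad (G m x y))%:E = 0.

Let m1bad : measurable_fun setT (fun x : cpath R d => (\1_bad x)%:E : \bar R).
Proof. exact/measurable_EFinP/measurable_indic. Qed.

Let keep m x := nul m x /\ exists2 e : R, (0 < e)%R & forall j, e%:E <= psi m (m + j)%N x.

(** By the tower property the level [m.+1] functions of a random continuation integrate to the level
    [m] ones, which are bounded below by [e]. Almost surely they decrease in the cylinder index, so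
    some continuation has a uniform positive lower bound of its own. *)
Let keep_step m x : keep m x -> exists y, keep m.+1 (G m x y).
Proof.
move=> [nx [e e0 ex]].
pose F j y := psi m.+1 (m.+1 + j)%N (G m x y).
pose gd y := nul m.+1 (G m x y) /\ ~ bad (G m x y).
have mF j : measurable_fun setT (F j).
  exact: measurableT_comp (mpsi _ _) (measurable_glue2 _ _ _).
have intF j : \int[W]_y F j y = psi m (m.+1 + j) x.
  by apply: tower => //; exact: mh.
have mbG : measurable_fun setT (fun y => (\1_bad (G m x y))%:E : \bar R).
  exact: measurableT_comp m1bad (measurable_glue2 _ _ _).
have aegd : {ae W, forall y, gd y}.
  have ae1 : {ae W, forall y, ~ bad (G m x y)}.
    have : \int[W]_y `|(\1_bad (G m x y))%:E| = 0.
      by rewrite -nx; apply: eq_integral => y _; rewrite gee0_abs// lee_fin.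
    move/ae_eq_integral_abs => /(_ measurableT mbG); apply: filterS => y /(_ I).
    by move=> bad0y bady; move: bad0y; rewrite indicE mem_set//= => /eqP; rewrite eqe oner_eq0.
  have ae2 : {ae W, forall y, nul m.+1 (G m x y)}.
    pose f2 y := \int[W]_z (\1_bad (G m.+1 (G m x y) z))%:E.
    have mf2 : measurable_fun setT f2.
      apply: (measurable_fun_fubini_tonelli_F (fun p => (\1_bad (G m.+1 (G m x p.1) p.2))%:E)) => //.
        apply: (measurableT_comp m1bad).
        apply: (measurableT_comp (measurable_glue _ _)
          (g := fun p : cpath R d * cpath R d => (G m x p.1, p.2))).
        by apply: measurable_fun_pair => //; exact: measurableT_comp (measurable_glue2 _ _ _) measurable_fst.
    have f20 y : 0 <= f2 y by apply: integral_ge0 => z _; rewrite lee_fin.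
    have : \int[W]_y `|f2 y| = 0.
      rewrite (eq_integral f2); last by move=> y _; rewrite gee0_abs.
      by rewrite /f2 (@tower m m.+1 (fun x => (\1_bad x)%:E)).
    by move/ae_eq_integral_abs => /(_ measurableT mf2); apply: filterS => y /(_ I).
  by apply: filterS2 ae1 ae2 => y ? ?; split.
have [y gdy [e' e'0 eF]] : exists2 y, gd y & exists2 e' : R, (0 < e')%R & forall j, e'%:E <= F j y.
  apply: (@exists_decreasing_lower_bound _ _ _ W F gd e) => //.
  - by move=> j y; exact: psi0.
  - by move=> y j [_ /goodP gy]; rewrite /F addnS; have [] := gy m.+1 (m.+1 + j)%N (leq_addr _ _).
  - rewrite intF addn0.
    (* Domination needs a finite integral. It equals [psi m m.+1 x], which does not change when [x]
       is replaced by a good continuation, where it is finite. *)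
    have [y [_ /goodP gy]] : exists y, gd y.
      apply/not_existsP => no.
      have : {ae W, forall y, False} by apply: filterS aegd => y /no.
      move=> [N [mN N0 sub]].
      have : W setT <= W N by apply: le_measure; rewrite ?inE//; move=> z _; apply: sub.
      by rewrite N0 probability_setT lee_fin ler10.
    by have [_] := gy m m.+1 (leqnSn _); rewrite psi_glue.
  - by move=> j; rewrite intF addSnnS; exact: ex.
by exists y; split; [case: gdy|exists e'].
Qed.

Let agree_center (x y : cpath R d) : agree_on setT (glue 0 0 x y) y.
Proof.
move=> s t _ _; rewrite incr_glue.
have c0 u : clamp 0 0 u = 0%R :> R.
  by apply/eqP; rewrite eq_le; have /andP[-> ->] := @clamp_itv R 0 0 u (lexx _).
by rewrite !c0 /incr !subrr add0r subr0.
Qed.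

(** The initial window has radius [r 0 = 0] and fixes no increment, so the conditional expectations
    there are the full integrals. *)
Let keep0 : keep 0 point.
Proof.
have G0 (f : cpath R d -> \bar R) : measurable_fun setT f ->
    \int[W]_y f (G 0 point y) = \int[W]_y f y.
  move=> mf; apply: eq_integral => y _.
  by apply: (measurable_fun_local mf); rewrite /G r0 oppr0; exact: agree_center.
split; first by rewrite /nul (G0 (fun x => (\1_bad x)%:E))// integral_indic// setIT.
exists eps => // j; rewrite add0n /psi G0//.
by rewrite /h -integral_mkcond.
Qed.

(** The selected paths agree on growing windows and have a limit [X]. At stage [k] the positive
    lower bound makes [psi k k] nonzero, which forces the stage path into [A k]; locality transfers
    membership to [X]. *)
Lemma cylinder_inter_nonempty : exists X, forall k, A k X.
Proof.
have /choice[next nextP] : forall mx : nat * cpath R d, exists y,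
    keep mx.1 mx.2 -> keep mx.1.+1 (G mx.1 mx.2 y).
  move=> [m x]; have [/keep_step[y ky]|nk] := pselect (keep m x); first by exists y.
  by exists point.
pose fix xs n := if n is m.+1 then G m (xs m) (next (m, xs m)) else point.
have kxs n : keep n (xs n).
  by elim: n => [|n IH]; [exact: keep0|exact: (nextP (n, xs n))].
have [X XP] : exists X, forall n, agree_on (sym_itv (r n)) X (xs n).
  by apply: path_limit => // n; exact: agree_glue.
exists X => k.
have [_ lA] := cA k; rewrite (lA _ _ (XP k)).
have [_ [e e0 /(_ 0%N)]] := kxs k; rewrite addn0 => ek.
apply: contrapT => nA; move: ek; rewrite leNgt => /negP; apply.
rewrite /psi (eq_integral (fun=> 0)) ?integral0 ?lte_fin// => y _.
rewrite /h /patch ifF//; apply/negP => /set_mem.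
by rewrite (lA _ (xs k))//; exact: agree_glue.
Qed.

End selection.

(** * Extension of consistent densities *)

Section cylinder_algebra.
Variables (R : realType) (d : nat).

(* The path space carrying the algebra of events that are local to some
   bounded interval, instead of the sigma-algebra it generates. *)
Definition cyl_path : Type := cpath R d.

HB.instance Definition _ := Choice.on cyl_path.
HB.instance Definition _ := Pointed.on cyl_path.

Definition cylinders : set (set cyl_path) := [set A | exists n, @cylinder R d n A].

Lemma cylinder_le m n (B : set (cpath R d)) : (m <= n)%N ->
  cylinder m B -> cylinder n B.
Proof.
by move=> mn [mB lB]; split=> //; apply: local_sub lB; exact: sym_itv_le.
Qed.

Lemma cylinder0 n : cylinder n (set0 : set (cpath R d)).
Proof. by split. Qed.

Lemma cylinderT n : cylinder n (setT : set (cpath R d)).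
Proof. by split. Qed.

Lemma cylinderU n (B C : set (cpath R d)) :
  cylinder n B -> cylinder n C -> cylinder n (B `|` C).
Proof.
move=> [mB lB] [mC lC]; split; first exact: measurableU.
by move=> x y xy; rewrite /setU/mkset (lB _ _ xy) (lC _ _ xy).
Qed.

Lemma cylinderC n (B : set (cpath R d)) : cylinder n B -> cylinder n (~` B).
Proof.
move=> [mB lB]; split; first exact: measurableC.
by move=> x y xy; rewrite /setC/mkset (lB _ _ xy).
Qed.

Let cyl0 : cylinders set0. Proof. by exists 0%N; exact: cylinder0. Qed.

Let cylU : setU_closed cylinders.
Proof.
move=> A B [m cA] [n cB]; exists (maxn m n); apply: cylinderU.
  by apply: cylinder_le cA; exact: leq_maxl.
by apply: cylinder_le cB; exact: leq_maxr.
Qed.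

Let cylC : setC_closed cylinders.
Proof. by move=> A [n cA]; exists n; exact: cylinderC. Qed.

Fact cyl_display : measure_display. Proof. exact. Qed.

HB.instance Definition _ := isAlgebraOfSets.Build cyl_display cyl_path cyl0 cylU cylC.

Lemma sub_sigma_cylinders (A : set (cpath R d)) :
  measurable A -> <<s cylinders >> A.
Proof.
apply: sub_sigma_algebra2 => _ [[s t] _ [Y mY <-]].
have [n [ns nt]] : exists n : nat, `|s| <= n%:R /\ `|t| <= n%:R.
  exists (maxn (Num.truncn `|s|).+1 (Num.truncn `|t|).+1); split.
    have /andP[_ /ltW] := truncn_itv (normr_ge0 s).
    by move=> /le_trans; apply; rewrite ler_nat leq_maxl.
  have /andP[_ /ltW] := truncn_itv (normr_ge0 t).
  by move=> /le_trans; apply; rewrite ler_nat leq_maxr.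
exists n; split; first exact: measurable_incr.
move=> x y xy; rewrite /preimage/setI/mkset/= (xy s t)// /sym_itv/= in_itv/=;
  by rewrite -ler_norml.
Qed.

End cylinder_algebra.

Section extension.
Variables (R : realType) (d : nat) (W : probability (cpath R d) R).
Hypothesis hW : brownian_increments_law W.
Local Open Scope ereal_scope.
Variable f : nat -> cpath R d -> \bar R.
Hypothesis mf : forall k, measurable_fun setT (f k).
Hypothesis f0 : forall k x, 0 <= f k x.
Hypothesis f1 : forall k, \int[W]_x f k x = 1.
Hypothesis fcons : forall n B, cylinder n B ->
  \int[W]_(x in B) f n x = \int[W]_(x in B) f n.+1 x.

Let fconsD m n B : (m <= n)%N -> cylinder m B ->
  \int[W]_(x in B) f m x = \int[W]_(x in B) f n x.
Proof.
move=> mn cB; elim: n mn => [|n IH]; first by rewrite leqn0 => /eqP ->.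
rewrite leq_eqVlt => /predU1P[->//|mn]; rewrite IH//; apply: fcons.
exact: cylinder_le cB.
Qed.

(** The level is picked by [xget]. Consistency makes the value independent of it, and the default
    level [0] only serves sets that are cylinders of no level. *)
Definition cylinder_content (A : set (cyl_path R d)) : \bar R :=
  \int[W]_(x in A) f (xget 0%N [set n | @cylinder R d n A]) x.
Local Notation mu := cylinder_content.

Lemma cylinder_contentE n A : @cylinder R d n A -> mu A = \int[W]_(x in A) f n x.
Proof.
move=> cA; rewrite /mu; have := @xgetI _ 0%N [set n | @cylinder R d n A] n cA.
set m := xget _ _ => cmA.
by have [mn|/ltnW nm] := leqP m n; [exact: fconsD|apply/esym; exact: fconsD].
Qed.

Let mu0 : mu set0 = 0.
Proof. by rewrite /mu integral_set0. Qed.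

Let mu_ge0 A : 0 <= mu A.
Proof. by apply: integral_ge0. Qed.

Let muU A B : measurable A -> measurable B -> A `&` B = set0 ->
  mu (A `|` B) = mu A + mu B.
Proof.
move=> [m cA] [n cB] AB0; pose p := maxn m n.
have cA' : cylinder p (A : set (cpath R d)) by apply: cylinder_le cA; exact: leq_maxl.
have cB' : cylinder p (B : set (cpath R d)) by apply: cylinder_le cB; exact: leq_maxr.
rewrite (cylinder_contentE cA') (cylinder_contentE cB') (cylinder_contentE (cylinderU cA' cB')).
rewrite ge0_integral_setU//.
- by case: cA'.
- by case: cB'.
- exact: measurable_funTS.
- by rewrite disj_set2E; apply/eqP.
Qed.

Let muT : mu setT = 1.
Proof. by rewrite (@cylinder_contentE 0)// ?f1//; exact: cylinderT. Qed.

Let mu_le1 A : measurable A -> mu A <= 1.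
Proof.
move=> mA; rewrite -muT -(setUv A) muU ?setICr//; first by rewrite leeDl.
exact: measurableC.
Qed.

(** Continuity at the empty set. If the partial sums stayed below the mass of the union, the tails
    [A k] would keep a mass at least [eps], hence share a path, which cannot lie in infinitely many
    disjoint [F i]. *)
Let mu_sigma_additive : semi_sigma_additive mu.
Proof.
move=> F mF tF mUF.
pose A k := \bigcup_(i in [set i | (k <= i)%N]) F i.
have AS k : A k = F k `|` A k.+1.
  apply/seteqP; split => [x [i /= ki Fi]|x [Fx|[i /= ki Fi]]].
  - by move: ki; rewrite leq_eqVlt => /predU1P[->|ki]; [left|right; exists i].
  - by exists k => /=.
  - by exists i => //=; exact: ltnW.
have FA k : F k `&` A k.+1 = set0.
  apply/seteqP; split => // x [Fk [i /= ki Fi]].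
  have := tF k i I I (ex_intro _ x (conj Fk Fi)) => ki'.
  by move: ki; rewrite ki' ltnn.
have A0 : A 0%N = \bigcup_i F i by apply: eq_bigcupl; split => i.
have mA k : measurable (A k).
  elim: k => [|k IH]; first by rewrite A0.
  have -> : A k.+1 = A k `\` F k.
    rewrite (AS k); apply/seteqP; split => [x Ax|x [[Fx|//] /(_ Fx)]//].
    by split; [right|move=> Fx; have : set0 x by rewrite -(FA k)].
  exact: measurableD.
pose s k := \sum_(0 <= i < k) mu (F i).
have sA k : mu (A 0%N) = s k + mu (A k).
  elim: k => [|k IH]; first by rewrite /s big_nil add0e.
  by rewrite IH AS muU// /s big_nat_recr//= addeA.
have snd : nondecreasing_seq s.
  by apply/nondecreasing_seqP => k; rewrite /s big_nat_recr//= leeDl.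
rewrite -A0; suff -> : mu (A 0%N) = ereal_sup (range s) by exact: ereal_nondecreasing_cvgn.
apply/eqP; rewrite eq_le; apply/andP; split; last first.
  by apply: ge_ereal_sup => _ [k _ <-]; rewrite (sA k) leeDl.
rewrite leNgt; apply/negP => supA.
have Afin : mu (A 0%N) \is a fin_num.
  by rewrite ge0_fin_numE// (le_lt_trans (mu_le1 _))// ltry.
have [eps eps0 epsA] : exists2 eps : R, (0 < eps)%R & forall k, eps%:E <= mu (A k).
  have sup0 : 0 <= ereal_sup (range s).
    by apply: ereal_sup_ubound; exists 0%N => //; rewrite /s big_nil.
  have supfin : ereal_sup (range s) \is a fin_num.
    by rewrite ge0_fin_numE// (lt_le_trans supA)// leey.
  exists (fine (mu (A 0%N)) - fine (ereal_sup (range s)))%R.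
    by rewrite subr_gt0 -lte_fin !fineK.
  move=> k; have sk : s k <= ereal_sup (range s) by apply: ereal_sup_ubound; exists k.
  rewrite EFinB !fineK// leeBlDr// (sA k) addeC leeD2l//.
have /choice[l lP] : forall k, exists n, @cylinder R d n (A k).
  by move=> k; case: (mA k) => n; exists n.
(* Adding the levels makes the radii increasing with [k <= r k]. Since the selection starts from
   radius [0], the tails are shifted by one index and preceded by the full space in [A']. *)
pose r k := (\sum_(i < k) (l i).+1)%N.
have rS k : r k.+1 = (r k + (l k).+1)%N by rewrite /r big_ord_recr.
pose A' k := if k is k'.+1 then A k' else setT.
have cA' k : cylinder (r k) (A' k).
  case: k => [|k] /=; first exact: cylinderT.
  by apply: cylinder_le (lP k); rewrite rS (leq_trans (leqnSn _))// leq_addl.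
have [X XA] : exists X, forall k, A' k X.
  apply: (@cylinder_inter_nonempty _ _ W hW r _ _ _ (fun k => f (r k)) _ _ _ _ A' cA' _ eps) => //.
  - by rewrite /r big_ord0.
  - by elim => // n IH; rewrite rS -addn1 leq_add.
  - move=> m n /subnK <-; elim: (n - m)%N => // k IH.
    by rewrite addSn rS (leq_trans IH)// leq_addr.
  - by move=> k; rewrite f1 ltry.
  - by move=> k B cB; apply: fconsD => //; rewrite rS leq_addr.
  - by case=> [|k] //=; rewrite [X in _ `<=` X]AS; exact: subsetUr.
  - move=> k; rewrite -(cylinder_contentE (cA' k)); case: k => [|k] /=; last exact: epsA.
    by rewrite (le_trans (epsA 0%N))// muT mu_le1.
have [i _ Fi] := XA 1%N.
have [j /= ij Fj] := XA i.+2.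
have := tF i j I I (ex_intro _ X (conj Fi Fj)) => ij'.
by move: ij; rewrite ij' ltnn.
Qed.

HB.instance Definition _ := isMeasure.Build _ _ _ mu mu0 mu_ge0 mu_sigma_additive.

(** The Caratheodory extension, read on the increment sigma-algebra, which is contained in the one
    generated by the cylinders. *)
Definition extended_law (A : set (cpath R d)) : \bar R := measure_extension mu A.

Let law_cylinder A : (cylinders (R := R) (d := d)) A -> extended_law A = mu A.
Proof. by move=> cA; rewrite /extended_law /measure_extension measurable_mu_extE. Qed.

Let law0 : extended_law set0 = 0.
Proof. exact: (measure0 (measure_extension mu)). Qed.

Let law_ge0 A : 0 <= extended_law A.
Proof. exact: (measure_ge0 (measure_extension mu)). Qed.

Let law_sigma : semi_sigma_additive extended_law.
Proof.
move=> F mF tF mUF.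
apply: (@measure_semi_sigma_additive _ _ _ (measure_extension mu)) => //.
- by move=> i; exact: sub_sigma_cylinders.
- exact: sub_sigma_cylinders.
Qed.

HB.instance Definition _ := isMeasure.Build _ _ _ extended_law law0 law_ge0 law_sigma.

Let lawT : extended_law setT = 1.
Proof. by rewrite law_cylinder ?muT//; exists 0%N; exact: cylinderT. Qed.

HB.instance Definition _ := Measure_isProbability.Build _ _ _ extended_law lawT.

Lemma extension_exists : exists Q : probability (cpath R d) R,
  forall n A, cylinder n A -> Q A = \int[W]_(x in A) f n x.
Proof.
exists extended_law => n A cA; rewrite -(cylinder_contentE cA).
by apply: law_cylinder; exists n.
Qed.

End extension.

(** * The interaction energy *)

Section joint_measurability.
Variables (R : realType) (d : nat).

Let grid (n : nat) (s : R) : R := (Num.floor (s * n.+1%:R))%:~R / n.+1%:R.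

Let grid_le n s : `|s - grid n s| <= n.+1%:R^-1.
Proof.
have n0 : 0 < n.+1%:R :> R by [].
have /andP[h1 h2] := floor_itv (s * n.+1%:R).
rewrite /grid ger0_norm ?subr_ge0 ?ler_pdivrMr//.
rewrite -[X in X - _](mulfK (lt0r_neq0 n0)) -mulrBl ler_pdivrMr// mulVf ?lt0r_neq0//.
by rewrite lerBlDl -intrD1 ltW.
Qed.

Let grid_cvg s : grid ^~ s @ \oo --> s.
Proof.
apply/cvgrPdist_le => e e0.
have := near_infty_natSinv_lt (PosNum e0); apply: filterS => n /= ne.
exact: le_trans (grid_le n s) (ltW ne).
Qed.

Let incr_coord_cvg (x : cpath R d) (i : 'I_d) (u : R^nat) (s : R) :
  u @ \oo --> s -> (fun n => incr 0 (u n) x ord0 i) @ \oo --> incr 0 s x ord0 i.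
Proof.
move=> us.
have c1 : (fun n => incr 0 (u n) x) @ \oo --> incr 0 s x.
  apply: cvgB; last exact: cvg_cst.
  exact: (cvg_comp _ _ us (@cts_fun _ _ x s)).
exact: (cvg_comp _ _ c1 (@coord_continuous _ _ _ _ _ (incr 0 s x))).
Qed.

(** Rounding the time down to a multiple of [1/(n+1)] gives a function that is measurable cell by
    cell. Continuity of paths makes these functions converge pointwise. *)
Lemma measurable_incr0 (i : 'I_d) :
  measurable_fun setT (fun p : R * cpath R d => incr 0 p.1 p.2 ord0 i).
Proof.
apply: (measurable_fun_cvg (h := fun n (p : R * cpath R d) => incr 0 (grid n p.1) p.2 ord0 i)).
  move=> n _ Y mY; rewrite setTI.
  have -> : (fun p : R * cpath R d => incr 0 (grid n p.1) p.2 ord0 i) @^-1` Y =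
     \bigcup_(z in [set: int])
       ([set s | Num.floor (s * n.+1%:R) = z] `*`
        (fun x => incr 0 (z%:~R / n.+1%:R) x ord0 i) @^-1` Y).
    apply/seteqP; split => [[s x] /= Yx|[s x] [z _ [/= <-]]//].
    by exists (Num.floor (s * n.+1%:R)).
  apply: countable_bigcupT_measurable; first exact: countableP.
  move=> z; apply: measurableX.
    have -> : [set s : R | Num.floor (s * n.+1%:R) = z] =
      `[(z%:~R / n.+1%:R), ((z + 1)%:~R / n.+1%:R)[%classic.
      apply/seteqP; split => s /=; rewrite in_itv/= ler_pdivrMr// ltr_pdivlMr//.
        by move=> <-; exact: floor_itv.
      by move=> /floor_def.
    exact: measurable_itv.
  by rewrite -[X in measurable X]setTI; exact: measurable_incr_coord.
by move=> [s x] _; apply: incr_coord_cvg; exact: grid_cvg.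
Qed.

Lemma measurable_incr2 :
  measurable_fun setT (fun p : cpath R d * (R * R) => incr p.2.2 p.2.1 p.1).
Proof.
apply: measurable_fun_rV => i.
have m1 : measurable_fun setT (fun p : cpath R d * (R * R) => incr 0 p.2.1 p.1 ord0 i).
  apply: (measurableT_comp (measurable_incr0 i) (g := fun p : cpath R d * (R * R) => (p.2.1, p.1))).
  by apply: measurable_fun_pair => //; exact: measurableT_comp measurable_fst measurable_snd.
have m2 : measurable_fun setT (fun p : cpath R d * (R * R) => incr 0 p.2.2 p.1 ord0 i).
  apply: (measurableT_comp (measurable_incr0 i) (g := fun p : cpath R d * (R * R) => (p.2.2, p.1))).
  by apply: measurable_fun_pair => //; exact: measurableT_comp measurable_snd measurable_snd.
have := measurable_funB m1 m2.
by apply: eq_measurable_fun => p _ /=; rewrite /incr !mxE; ring.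
Qed.

End joint_measurability.

Lemma lebesgue_measure_translate (R : realType) (c : R) (A : set R) : measurable A ->
  lebesgue_measure ((fun t => t + c) @^-1` A) = lebesgue_measure A.
Proof.
have mc : measurable_fun setT ((fun t => t + c) : measurableTypeR R -> measurableTypeR R).
  exact: measurable_funD.
move=> mA; apply/esym.
apply: (@lebesgue_measure_unique R (image_measure lebesgue_measure mc)) => //= _ [[a b]] _ <-.
rewrite /image_measure/= /pushforward.
have -> : (fun t => t + c) @^-1` `]a, b]%classic = `](a - c), (b - c)]%classic.
  by apply/seteqP; split => t /=; rewrite !in_itv/= ltrBlDr lerBrDr.
rewrite !lebesgue_measure_itv/= !lte_fin ltrD2r; case: ifP => // _.
by rewrite -!EFinD; congr (_%:E); ring.
Qed.

Lemma integral_translate (R : realType) (c a b : R) (f : R -> \bar R) :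
  measurable_fun setT f -> (forall t, 0 <= f t)%E ->
  (\int[lebesgue_measure]_(t in `[a, b]) f (t + c)%R =
   \int[lebesgue_measure]_(t in `[(a + c)%R, (b + c)%R]) f t)%E.
Proof.
move=> mf f0.
have mc : measurable_fun setT ((fun t => t + c) : measurableTypeR R -> measurableTypeR R).
  exact: measurable_funD.
have := @ge0_integral_pushforward _ _ _ _ R _ mc lebesgue_measure `[a + c, b + c]%classic f
  (measurable_itv _) (measurable_funTS mf) (fun y _ => f0 y).
have -> : (fun t => t + c) @^-1` `[a + c, b + c]%classic = `[a, b]%classic.
  by apply/seteqP; split => t /=; rewrite !in_itv/= !lerD2r.
move=> <-.
apply: (@eq_measure_integral _ _ _ _ lebesgue_measure (image_measure lebesgue_measure mc)).
by move=> A mA _; exact: lebesgue_measure_translate.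
Qed.

Section energy.
Variables (R : realType) (d : nat) (w : R -> 'rV[R]_d -> \bar R).
Hypothesis w_meas : measurable_fun [set p : R * 'rV[R]_d | 0 <= p.1]
  (fun p : R * 'rV[R]_d => w p.1 p.2).
Hypothesis w_pos : forall (t : R) (x : 'rV[R]_d), 0 <= t -> (0 < w t x)%E.
Local Open Scope ereal_scope.
Local Notation leb := (@lebesgue_measure R).

Definition interaction (x : cpath R d) (p : R * R) : \bar R :=
  w `|p.1 - p.2|%R (incr p.2 p.1 x).

Lemma interaction_ge0 x p : 0 <= interaction x p.
Proof. by apply/ltW/w_pos. Qed.

Lemma measurable_interaction2 :
  measurable_fun setT (fun q : cpath R d * (R * R) => interaction q.1 q.2).
Proof.
apply: (measurable_comp (F := [set p : R * 'rV[R]_d | 0 <= p.1]%R) _ _ w_meas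
  (g := fun q : cpath R d * (R * R) => (`|q.2.1 - q.2.2|%R, incr q.2.2 q.2.1 q.1))).
- rewrite -[X in measurable X]setTI.
  have := @measurable_fst _ _ (measurableTypeR R) 'rV[R]_d.
  move=> /(_ measurableT `[0%R, +oo[%classic (measurable_itv _)).
  by congr measurable; apply/seteqP; split => p /=; rewrite in_itv/= andbT.
- by move=> _ [q _ <-] /=.
- apply: measurable_fun_pair; last exact: measurable_incr2.
  apply: measurableT_comp => //; apply: measurable_funB.
    exact: measurableT_comp measurable_fst measurable_snd.
  exact: measurableT_comp measurable_snd measurable_snd.
Qed.

Lemma measurable_interaction x : measurable_fun setT (interaction x).
Proof. exact: measurableT_comp measurable_interaction2 (pair1_measurable x). Qed.

Definition energy_on (D : set (R * R)) (x : cpath R d) : \bar R :=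
  \int[leb \x leb]_(p in D) interaction x p.

Lemma energy_onE D x : energy_on D x = \int[leb \x leb]_p (interaction x \_ D) p.
Proof. by rewrite /energy_on [LHS]integral_mkcond. Qed.

Lemma energy_on_ge0 D x : 0 <= energy_on D x.
Proof. by apply: integral_ge0 => p _; exact: interaction_ge0. Qed.

(** The inclusions bound the sum of the indicators of [D1] and [D2] by that of [E] and [F], and the
    interaction is nonnegative. Nothing is subtracted, so infinite energies are allowed. *)
Lemma energy_on_supermodular (D1 D2 E F : set (R * R)) x :
  measurable D1 -> measurable D2 -> measurable E -> measurable F ->
  D1 `|` D2 `<=` E -> D1 `&` D2 `<=` F ->
  energy_on D1 x + energy_on D2 x <= energy_on E x + energy_on F x.
Proof.
move=> m1 m2 mE mF sE sF; rewrite !energy_onE.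
have mr D : measurable D -> measurable_fun setT (interaction x \_ D).
  move=> mD; apply/(measurable_restrictT _ mD).
  exact: measurable_funTS (measurable_interaction x).
have r0 D p : 0 <= (interaction x \_ D) p.
  by rewrite /patch; case: ifP => // _; exact: interaction_ge0.
rewrite -ge0_integralD//; [|exact: mr|exact: mr].
rewrite -ge0_integralD//; [|exact: mr|exact: mr].
apply: ge0_le_integral => //.
- by move=> p _; exact: adde_ge0.
- by apply: emeasurable_funD; exact: mr.
- by apply: emeasurable_funD; exact: mr.
move=> p _; rewrite /patch.
have i0 := interaction_ge0 x p.
case: (boolP (p \in D1)) => p1; case: (boolP (p \in D2)) => p2.
- rewrite !ifT//; first by apply/mem_set/sF; split; exact: set_mem.
  by apply/mem_set/sE; left; exact: set_mem.
- rewrite adde0 (_ : p \in E) ?leeDl//; first by case: ifP.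
  by apply/mem_set/sE; left; exact: set_mem.
- rewrite add0e (_ : p \in E) ?leeDl//; first by case: ifP.
  by apply/mem_set/sE; right; exact: set_mem.
- by rewrite add0e adde_ge0//; case: ifP.
Qed.

Definition energy (a b : R) : cpath R d -> \bar R := energy_on (`[a, b] `*` `[a, b]).

Lemma energyE a b x : energy a b x =
  \int[leb]_(t in `[a, b]) \int[leb]_(s in `[a, b]) w `|t - s|%R (incr s t x).
Proof.
rewrite /energy energy_onE.
have mI : measurable (`[a, b]%classic : set R) by exact: measurable_itv.
have mII : measurable ((`[a, b]%classic : set R) `*` (`[a, b]%classic : set R)).
  exact: measurableX.
have mi : measurable_fun setT (interaction x \_ (`[a, b] `*` `[a, b])).
  apply/(measurable_restrictT _ mII).
  exact: measurable_funTS (measurable_interaction x).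
have i0 p : 0 <= (interaction x \_ (`[a, b] `*` `[a, b])) p.
  by rewrite /patch; case: ifP => // _; exact: interaction_ge0.
transitivity (\int[leb]_t fubini_F leb (interaction x \_ (`[a, b] `*` `[a, b])) t).
  exact: (@fubini_tonelli1 _ _ _ _ R leb leb _ mi i0).
rewrite [RHS]integral_mkcond; apply: eq_integral => t _.
rewrite /fubini_F /patch; case: ifPn => tI.
  rewrite [RHS]integral_mkcond; apply: eq_integral => s _.
  by rewrite /patch in_setX tI.
by rewrite (eq_integral (fun=> 0)) ?integral0// => s _; rewrite in_setX (negPf tI).
Qed.

Lemma energy_ge0 a b x : 0 <= energy a b x.
Proof. exact: energy_on_ge0. Qed.

(** Tonelli with parameters, used twice: first the inner integral as a function of path and outer
    time, then the outer integral as a function of the path. *)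
Lemma measurable_energy a b : measurable_fun setT (energy a b).
Proof.
have mI : measurable (`[a, b]%classic : set R) by exact: measurable_itv.
have -> : energy a b = fun x => \int[leb]_t
    ((fun t => \int[leb]_s ((fun s => interaction x (t, s)) \_ `[a, b]) s) \_ `[a, b]) t.
  apply/funext => x; rewrite energyE [LHS]integral_mkcond; apply: eq_integral => t _.
  by rewrite /patch; case: ifP => // _; rewrite [LHS]integral_mkcond.
have m1 : measurable_fun setT (fun q : (cpath R d * R) =>
    \int[leb]_s ((fun s => interaction q.1 (q.2, s)) \_ `[a, b]) s).
  apply: (measurable_fun_fubini_tonelli_F (m2 := leb)
    (fun q : (cpath R d * R) * R => ((fun s => interaction q.1.1 (q.1.2, s)) \_ `[a, b]) q.2)).
    have -> : (fun q : (cpath R d * R) * R => ((fun s => interaction q.1.1 (q.1.2, s)) \_ `[a, b]) q.2) =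
      (fun q => interaction q.1.1 (q.1.2, q.2)) \_ (setT `*` `[a, b]).
      by apply/funext => q; rewrite /patch in_setX in_setT.
    apply/(measurable_restrictT _ (measurableX measurableT mI)).
    apply: measurable_funTS.
    apply: (measurableT_comp measurable_interaction2 (g := fun q : (cpath R d * R) * R => (q.1.1, (q.1.2, q.2)))).
    apply: measurable_fun_pair; first exact: measurableT_comp measurable_fst measurable_fst.
    by apply: measurable_fun_pair => //; exact: measurableT_comp measurable_snd measurable_fst.
  by move=> q; rewrite /patch; case: ifP => // _; exact: interaction_ge0.
apply: (measurable_fun_fubini_tonelli_F (m2 := leb) (fun q : cpath R d * R =>
  ((fun t => \int[leb]_s ((fun s => interaction q.1 (t, s)) \_ `[a, b]) s) \_ `[a, b]) q.2)).
  have -> : (fun q : cpath R d * R =>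
      ((fun t => \int[leb]_s ((fun s => interaction q.1 (t, s)) \_ `[a, b]) s) \_ `[a, b]) q.2) =
    (fun q : (cpath R d * R) =>
    \int[leb]_s ((fun s => interaction q.1 (q.2, s)) \_ `[a, b]) s) \_ (setT `*` `[a, b]).
    by apply/funext => q; rewrite /patch in_setX in_setT.
  apply/(measurable_restrictT _ (measurableX measurableT mI)).
  exact: measurable_funTS.
move=> q; rewrite /patch; case: ifP => // _; apply: integral_ge0 => s _.
by case: ifP => // _; exact: interaction_ge0.
Qed.

Lemma local_energy a b : local `[a, b] (energy a b).
Proof.
move=> x y xy; rewrite !energyE; apply: eq_integral => t /set_mem tI.
by apply: eq_integral => s /set_mem sI; rewrite (xy s t).
Qed.

Lemma energy_aa a x : energy a a x = 0.
Proof. by rewrite energyE set_itv1 integral_set1. Qed.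

(** The squares over [[a, c]] and [[b, e]] lie in the square over [[a, e]] and meet inside the
    square over [[b, c]]. *)
Lemma energy_supermodular a b c e x : (a <= b)%R -> (b <= c)%R -> (c <= e)%R ->
  energy a c x + energy b e x <= energy a e x + energy b c x.
Proof.
move=> ab bc ce; apply: energy_on_supermodular.
1-4: by apply: measurableX; exact: measurable_itv.
- move=> p [] [] /=; rewrite !in_itv/= => /andP[p1 p2] /andP[p3 p4]; split; apply/andP; split => //.
  + by rewrite (le_trans p2).
  + by rewrite (le_trans p4).
  + by rewrite (le_trans ab).
  + by rewrite (le_trans ab).
- move=> p [[/=]]; rewrite !in_itv/= => /andP[_ p2] /andP[_ p4] [/=].
  by move=> /andP[p1 _] /andP[p3 _]; rewrite p1 p2 p3 p4.
Qed.

Lemma energy_shift a b c x : energy a b (path_shift c x) = energy (a + c)%R (b + c)%R x.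
Proof.
rewrite !energyE.
have mF (t : R) : measurable_fun setT (fun s : R => w `|t - s|%R (incr s t x)).
  exact: measurableT_comp (measurable_interaction x) (pair1_measurable t).
have F0 t s : 0 <= w `|t - s|%R (incr s t x) by exact: (interaction_ge0 x (t, s)).
rewrite -integral_translate; last 2 first.
- have mI : measurable (`[(a + c)%R, (b + c)%R]%classic : set R) by exact: measurable_itv.
  rewrite [X in measurable_fun _ X](_ : _ = fun t => \int[leb]_s
    ((fun p => interaction x p) \_ (setT `*` `[(a + c)%R, (b + c)%R])) (t, s)).
    apply: (measurable_fun_fubini_tonelli_F (m2 := leb)) => //.
      apply/(measurable_restrictT _ (measurableX measurableT mI)).
      exact: measurable_funTS (measurable_interaction x).
    by move=> p; rewrite /patch; case: ifP => // _; exact: interaction_ge0.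
  apply/funext => t; rewrite [LHS]integral_mkcond; apply: eq_integral => s _.
  by rewrite /patch in_setX in_setT.
- by move=> t; apply: integral_ge0 => s _.
apply: eq_integral => t _; rewrite -integral_translate//.
by apply: eq_integral => s _; rewrite incr_shift; congr (w `|_|%R _); ring.
Qed.

End energy.

(** * Cuts and renewal *)

Section renewal_kernel.
Variables (R : realFieldType) (G : R -> R -> R).
Implicit Types (p q : nat -> R) (i j k : nat).

(** Course-of-values recursion on the right endpoint, driven by the fuel [n]: for [i < j] any fuel
    at least [j - i] gives the same value. *)
Fixpoint kernel_rec (n : nat) p i j : R :=
  if n is m.+1 then G (p i) (p j) - \sum_(i.+1 <= k < j) kernel_rec m p i k * G (p k) (p j)
  else 0.

(* The part of the weight [G (p i) (p j)] carried by configurations without a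
   cut at any of the points [p k], [i < k < j]. *)
Definition kernel p i j := kernel_rec (j - i) p i j.

Lemma kernel_recE n p i j : (i < j)%N -> (j - i <= n)%N ->
  kernel_rec n p i j = kernel p i j.
Proof.
rewrite /kernel; move: {2}(j - i)%N (leqnn (j - i)) => m.
elim: m n j => [|m IH] n j; first by rewrite leqn0 subn_eq0 leqNgt => /negP.
case: n => [|n] jim ij; first by rewrite leqn0 subn_eq0 leqNgt ij.
move=> jin /=; have [l jil] : exists l, (j - i = l.+1)%N.
  by exists (j - i).-1; rewrite prednK// subn_gt0.
rewrite jil /=; congr (_ - _); apply: eq_big_nat => k /andP[ik kj].
congr (_ * _).
have kil : (k - i <= l)%N by rewrite -ltnS -jil ltn_sub2r.
rewrite (IH n)//; last 2 first.
- by rewrite (leq_trans kil)// -ltnS -jil.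
- by rewrite (leq_trans kil)// -ltnS -jil.
rewrite [RHS](IH l)//.
by rewrite (leq_trans kil)// -ltnS -jil.
Qed.

Lemma kernelE p i j : (i < j)%N ->
  kernel p i j = G (p i) (p j) - \sum_(i.+1 <= k < j) kernel p i k * G (p k) (p j).
Proof.
move=> ij; rewrite {1}/kernel; have [l jil] : exists l, (j - i = l.+1)%N.
  by exists (j - i).-1; rewrite prednK// subn_gt0.
rewrite jil /=; congr (_ - _); apply: eq_big_nat => k /andP[ik kj].
by rewrite kernel_recE// -ltnS -jil ltn_sub2r.
Qed.

Lemma eq_kernel p q i j : (forall k, (i <= k <= j)%N -> p k = q k) ->
  kernel p i j = kernel q i j.
Proof.
move: {2}(j - i)%N (leqnn (j - i)) => m; elim: m j => [|m IH] j jim pq.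
  by move: jim; rewrite leqn0 => /eqP jim; rewrite /kernel jim.
have [ji|ij] := leqP j i; first by rewrite /kernel (eqP ji).
rewrite !kernelE// !pq ?leqnn ?(ltnW ij)//; congr (_ - _).
apply: eq_big_nat => k /andP[ik kj]; rewrite pq ?(ltnW ik) ?(ltnW kj)//.
rewrite IH//; first by rewrite -ltnS (leq_trans _ jim)// ltn_sub2r// (leq_trans ik)// ltnW.
by move=> l /andP[il lk]; rewrite pq// il (leq_trans lk)// ltnW.
Qed.

Hypothesis G_ge1 : forall a b, a <= b -> 1 <= G a b.
Hypothesis G_aa : forall a, G a a = 1.
Hypothesis G_super : forall a b c e, a <= b -> b <= c -> c <= e ->
  G a c * G b e <= G a e * G b c.

Let G_gt0 a b : a <= b -> 0 < G a b.
Proof. by move=> /G_ge1; exact: lt_le_trans. Qed.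

Lemma weight_mono a b c e : a <= b -> b <= c -> c <= e -> G b c <= G a e.
Proof.
move=> ab bc ce; apply: (@le_trans _ _ (G b e)).
  have := G_super bc (lexx c) ce; rewrite G_aa mulr1; apply: le_trans.
  by rewrite ler_peMr ?G_ge1// ltW// G_gt0.
have := G_super ab (lexx b) (le_trans bc ce); rewrite G_aa mulr1; apply: le_trans.
by rewrite ler_peMl ?G_ge1// ltW// G_gt0// (le_trans bc).
Qed.

Lemma first_cut p i j : (i < j)%N ->
  G (p i) (p j) = \sum_(i.+1 <= k < j.+1) kernel p i k * G (p k) (p j).
Proof.
by move=> ij; rewrite big_nat_recr//= G_aa mulr1 (kernelE _ ij) addrC subrK.
Qed.

(** With weights and kernels as triangular matrices, [first_cut] says that identity minus kernel is
    a left inverse of the unitriangular weight matrix; this is the right inverse identity. The proof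
    expands each weight by its first cut and exchanges the sums. *)
Lemma last_cut p i j : (i < j)%N ->
  G (p i) (p j) = \sum_(i <= k < j) G (p i) (p k) * kernel p k j.
Proof.
move: {2}(j - i)%N (leqnn (j - i)) => m; elim: m i => [|m IH] i jim ij.
  by move: jim; rewrite leqn0 subn_eq0 leqNgt ij.
rewrite big_ltn// G_aa mul1r.
have -> : \sum_(i.+1 <= k < j) G (p i) (p k) * kernel p k j =
  \sum_(i.+1 <= k < j) \sum_(i.+1 <= l < j | (l <= k)%N)
     kernel p i l * (G (p l) (p k) * kernel p k j).
  apply: eq_big_nat => k /andP[ik kj]; rewrite first_cut// mulr_suml.
  rewrite (big_nat_widen _ _ _ _ _ kj); apply: eq_bigr => l _; exact/esym/mulrA.
rewrite (exchange_big_dep_nat predT)//=.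
rewrite (kernelE _ ij) -[LHS]addr0 -addrA; congr (_ + _).
rewrite addrC; apply/eqP; rewrite eq_sym subr_eq0; apply/eqP.
apply: eq_big_nat => l /andP[il lj].
rewrite -mulr_sumr; congr (_ * _); rewrite [RHS]IH//; last first.
  by rewrite -ltnS (leq_trans _ jim)// ltn_sub2l.
by rewrite [RHS](big_nat_widenl _ _ _ _ _ il).
Qed.

(* Kaluza's argument: supermodularity makes the ratios of successive weights
   monotone, which forces the first-cut kernel to be nonnegative. *)
Lemma kernel_ge0 p i j : {homo p : m n / (m <= n)%N >-> m <= n} -> (i < j)%N ->
  0 <= kernel p i j.
Proof.
move=> hp; move: {2}(j - i)%N (leqnn (j - i)) => m; elim: m j => [|m IH] j jim ij.
  by move: jim; rewrite leqn0 subn_eq0 leqNgt ij.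
case: j ij jim => // n; rewrite ltnS => ni nim.
rewrite kernelE//; move: ni; rewrite leq_eqVlt => /predU1P[->|ni].
  by rewrite big_geq// subr0 ltW// G_gt0// hp.
have gin := G_gt0 (hp _ _ (ltnW ni)).
(* After multiplying by the positive weight up to the previous point [n], expanding that weight by
   first cuts gives a term-by-term comparison of the two sums. *)
rewrite subr_ge0 -(ler_pM2l gin) mulr_sumr.
rewrite {2}(first_cut _ ni) mulr_suml; apply: ler_sum_nat => k /andP[ik kn].
rewrite mulrCA -mulrA; apply: ler_wpM2l.
  by apply: IH => //; lia.
by rewrite [X in _ <= X]mulrC; apply: G_super; apply: hp; lia.
Qed.

(** Decomposition by the last cut at or before [s] and the first cut after it. When [s] moves to
    [s.+1], the terms with first cut [s.+1] resum by [last_cut] and are split again by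
    [first_cut]. *)
Lemma straddling_cut p i s j : (i <= s)%N -> (s < j)%N ->
  G (p i) (p j) = \sum_(i <= k < s.+1) \sum_(s.+1 <= l < j.+1)
     G (p i) (p k) * kernel p k l * G (p l) (p j).
Proof.
elim: s => [|s IH].
  rewrite leqn0 => /eqP -> j0; rewrite big_nat1 first_cut//.
  by apply: eq_big_nat => l _; rewrite G_aa mul1r.
rewrite leq_eqVlt => /predU1P[->|]; last rewrite ltnS.
  move=> sj; rewrite big_nat1 first_cut//.
  by apply: eq_big_nat => l _; rewrite G_aa mul1r.
move=> is_ sj; rewrite [LHS]IH ?(ltnW sj)//.
rewrite [RHS]big_nat_recr ?(leq_trans is_)//=.
rewrite (eq_big_nat _ _ (F2 := fun k => G (p i) (p k) * kernel p k s.+1 * G (p s.+1) (p j) +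
   \sum_(s.+2 <= l < j.+1) G (p i) (p k) * kernel p k l * G (p l) (p j))); last first.
  by move=> k _; rewrite big_ltn// ltnW.
rewrite big_split/= addrC; congr (_ + _).
rewrite -mulr_suml -last_cut// (first_cut p sj) mulr_sumr.
by apply: eq_big_nat => l _; rewrite mulrA.
Qed.

(** In the last-cut formula the sum involves kernels that do not see the moved endpoint.
    Cross-multiplying by the weights of the two blocks leaves one instance of supermodularity per
    term. This is what controls cells clipped by the boundary. *)
Lemma kernel_extend_left p q i j : {homo p : m n / (m <= n)%N >-> m <= n} ->
  (i < j)%N -> (forall k, (i < k <= j)%N -> p k = q k) -> q i <= p i ->
  kernel p i j <= kernel q i j.
Proof.
move=> hp ij pq qpi.
have kE r : kernel r i j = G (r i) (r j) -
    \sum_(i.+1 <= k < j) G (r i) (r k) * kernel r k j.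
  by rewrite [X in X - _]last_cut// big_ltn// G_aa mul1r addrK.
rewrite !kE -(pq j) ?ij ?leqnn//.
have gij := G_gt0 (hp _ _ (ltnW ij)).
rewrite -(ler_pM2l gij).
apply: (@le_trans _ _ (G (q i) (p j) * (G (p i) (p j) -
    \sum_(i.+1 <= k < j) G (p i) (p k) * kernel p k j))).
  apply: ler_wpM2r; first by rewrite -kE kernel_ge0.
  by apply: weight_mono => //; exact/hp/ltnW.
rewrite !mulrBr mulrC lerD2l lerN2 !mulr_sumr.
apply: ler_sum_nat => k /andP[ik kj].
rewrite -(pq k) ?ik ?(ltnW kj)//.
rewrite -(@eq_kernel p q k j); last first.
  by move=> l /andP[kl lj]; rewrite pq// (leq_trans ik).
rewrite !mulrA; apply: ler_wpM2r; first exact: kernel_ge0.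
by rewrite mulrC; apply: G_super => //; apply: hp; exact: ltnW.
Qed.

Lemma kernel_extend_right p q i j : {homo p : m n / (m <= n)%N >-> m <= n} ->
  (i < j)%N -> (forall k, (i <= k < j)%N -> p k = q k) -> p j <= q j ->
  kernel p i j <= kernel q i j.
Proof.
move=> hp ij pq pqj; rewrite !kernelE// -(pq i) ?ij ?leqnn//.
have gij := G_gt0 (hp _ _ (ltnW ij)).
rewrite -(ler_pM2l gij).
apply: (@le_trans _ _ (G (p i) (q j) * (G (p i) (p j) -
    \sum_(i.+1 <= k < j) kernel p i k * G (p k) (p j)))).
  apply: ler_wpM2r; first by rewrite -kernelE// kernel_ge0.
  by apply: weight_mono => //; exact/hp/ltnW.
rewrite !mulrBr mulrC lerD2l lerN2 !mulr_sumr.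
apply: ler_sum_nat => k /andP[ik kj].
rewrite -(pq k) ?kj ?(ltnW ik)//.
rewrite -(@eq_kernel p q i k); last first.
  by move=> l /andP[il lk]; rewrite pq// il (leq_ltn_trans lk).
rewrite mulrCA [X in _ <= X]mulrCA; apply: ler_wpM2l; first exact: kernel_ge0.
by apply: G_super => //; apply: hp; exact: ltnW.
Qed.

Lemma kernel_extend p q i j :
  {homo p : m n / (m <= n)%N >-> m <= n} -> {homo q : m n / (m <= n)%N >-> m <= n} ->
  (i < j)%N -> (forall k, (i < k < j)%N -> p k = q k) -> q i <= p i -> p j <= q j ->
  kernel p i j <= kernel q i j.
Proof.
move=> hp hq ij pq qpi pqj.
pose q' k := if (k <= i)%N then p k else q k.
have hq' : {homo q' : m n / (m <= n)%N >-> m <= n}.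
  move=> m n mn; rewrite /q'; case: (leqP m i) => mi; case: (leqP n i) => ni.
  - exact: hp.
  - have [jn|nj] := leqP j n.
      by apply: (le_trans (hp m j _)); rewrite ?(le_trans pqj) ?hq// (leq_trans mi) // ltnW.
    by rewrite -pq ?ni// hp.
  - by move: mi; rewrite ltnNge (leq_trans mn ni).
  - exact: hq.
apply: (@le_trans _ _ (kernel q' i j)).
  apply: kernel_extend_right => //.
    move=> k /andP[ik kj]; rewrite /q'; case: leqP => // ik'.
    by rewrite pq// ik'.
  by rewrite /q' leqNgt ij.
apply: kernel_extend_left => //; last by rewrite /q' leqnn.
by move=> k /andP[ik _]; rewrite /q' leqNgt ik.
Qed.

End renewal_kernel.

(** * Exponential growth rate of the partition function *)

Section growth.
Variables (R : realType) (Z : R -> R).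
Hypothesis Z_ge1 : forall t, 0 <= t -> 1 <= Z t.
Hypothesis Z_super : forall s t, 0 <= s -> 0 <= t -> Z s * Z t <= Z (s + t).
Variables (C T0 : R).
Hypothesis Z_doubling : forall t, T0 <= t -> Z (2 * t) <= C * Z t ^+ 2.

Let phi t := ln (Z t).
Let kappa := ln (Num.max 1 C).

Let Z_gt0 t : 0 <= t -> 0 < Z t.
Proof. by move=> /Z_ge1; exact: lt_le_trans. Qed.

Let phi_ge0 t : 0 <= t -> 0 <= phi t.
Proof. by move=> /Z_ge1; exact: ln_ge0. Qed.

Let kappa_ge0 : 0 <= kappa.
Proof. by apply: ln_ge0; rewrite le_max lexx. Qed.

Let phiD s t : 0 <= s -> 0 <= t -> phi s + phi t <= phi (s + t).
Proof.
move=> s0 t0; rewrite /phi -lnM ?posrE ?Z_gt0// ler_ln ?posrE ?Z_super//.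
  by rewrite mulr_gt0 ?Z_gt0.
by rewrite Z_gt0// addr_ge0.
Qed.

Let phi_mono s t : 0 <= s -> s <= t -> phi s <= phi t.
Proof.
move=> s0 st; have ts : 0 <= t - s by rewrite subr_ge0.
have := phiD s0 ts; rewrite subrKC; apply: le_trans.
by rewrite lerDl phi_ge0.
Qed.

Let phi_mul n s : 0 <= s -> n%:R * phi s <= phi (n%:R * s).
Proof.
move=> s0; elim: n => [|n IH]; first by rewrite !mul0r phi_ge0.
rewrite -natr1 !mulrDl !mul1r (le_trans _ (phiD _ _))// ?mulr_ge0//.
by rewrite lerD2r.
Qed.

Let phi_double t : Num.max 1 T0 <= t -> phi (2 * t) <= 2 * phi t + kappa.
Proof.
rewrite ge_max => /andP[t1 Tt]; have t0 : 0 <= t by rewrite (le_trans ler01).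
have Zt := Z_gt0 t0.
have C0 : 0 < Num.max 1 C by rewrite lt_max ltr01.
have -> : 2 * phi t = ln (Z t ^+ 2) by rewrite lnXn// mulr_natl.
rewrite /phi /kappa addrC -lnM ?posrE ?exprn_gt0//.
rewrite ler_ln ?posrE ?mulr_gt0 ?exprn_gt0 ?Z_gt0 ?mulr_ge0//.
apply: (le_trans (Z_doubling Tt)); apply: ler_wpM2r; first by rewrite exprn_ge0// ltW.
by rewrite le_max lexx orbT.
Qed.

Let phi_pow k t : Num.max 1 T0 <= t -> phi (2 ^+ k * t) <= 2 ^+ k * (phi t + kappa) - kappa.
Proof.
move=> tT; elim: k => [|k IH]; first by rewrite expr0 !mul1r addrK.
have t0 : 0 <= t by move: tT; rewrite ge_max => /andP[t1 _]; rewrite (le_trans ler01).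
rewrite exprS -!mulrA (le_trans (phi_double _))//.
  by rewrite (le_trans tT)// ler_peMl// exprn_ege1// ler1n.
have := IH; lra.
Qed.

(** Fill an interval of length [2 ^ k * t] with copies of length [s]: superadditivity bounds its
    [phi] from below, the iterated doubling bound from above. Rounding costs at most one copy,
    negligible after division by [2 ^ k]. *)
Let phi_compare s t : 0 < s -> Num.max 1 T0 <= t -> phi s / s <= (phi t + kappa) / t.
Proof.
move=> s0 tT; have t1 : 1 <= t by move: tT; rewrite ge_max => /andP[].
have t0 : 0 < t by rewrite (lt_le_trans ltr01).
have ps := phi_ge0 (ltW s0).
rewrite ler_pdivrMr// mulrAC ler_pdivlMr//.
have key k : t * phi s - s * phi s / 2 ^+ k <= (phi t + kappa) * s.
  have k0 : 0 < 2 ^+ k :> R by rewrite exprn_gt0.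
  pose n := Num.truncn (2 ^+ k * t / s).
  have q0 : 0 <= 2 ^+ k * t / s by rewrite divr_ge0 ?mulr_ge0 ?ltW.
  have /andP[n1 n2] := truncn_itv q0.
  have h1 : n%:R * phi s <= 2 ^+ k * (phi t + kappa).
    apply: (le_trans (phi_mul n (ltW s0))).
    apply: (@le_trans _ _ (phi (2 ^+ k * t))).
      apply: phi_mono; first by rewrite mulr_ge0// ltW.
      by rewrite -ler_pdivlMr.
    by rewrite (le_trans (phi_pow k tT))// gerBl.
  have h2 : (2 ^+ k * t / s - 1) * phi s <= 2 ^+ k * (phi t + kappa).
    apply: le_trans h1; apply: ler_wpM2r => //.
    by rewrite lerBlDr natr1 ltW.
  rewrite -(ler_pM2l k0) mulrBr [X in _ - X](_ : _ = s * phi s); last first.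
    by rewrite mulrC divfK// gt_eqF.
  have -> : 2 ^+ k * (t * phi s) - s * phi s = (2 ^+ k * t / s - 1) * phi s * s.
    by field; rewrite gt_eqF.
  by rewrite mulrA ler_pM2r.
rewrite mulrC leNgt; apply/negP => gap.
have gap0 : 0 < t * phi s - (phi t + kappa) * s by rewrite subr_gt0.
pose k := Num.truncn (s * phi s / (t * phi s - (phi t + kappa) * s)).
have q0 : 0 <= s * phi s / (t * phi s - (phi t + kappa) * s).
  by apply: divr_ge0; [apply: mulr_ge0 => //; exact: ltW|exact: ltW].
have /andP[_ hk] := truncn_itv q0.
have k2 : (k.+1)%:R <= 2 ^+ k.+1 :> R by rewrite -natrX ler_nat ltnW// ltn_expl.
have := key k.+1; rewrite leNgt => /negP; apply.
rewrite ltrBrDl -ltrBrDr ltr_pdivrMr ?exprn_gt0//.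
have : s * phi s < k.+1%:R * (t * phi s - (phi t + kappa) * s).
  by rewrite -ltr_pdivrMr.
move=> /lt_le_trans; apply; rewrite [leRHS]mulrC; apply: ler_wpM2r => //.
exact: ltW.
Qed.

Lemma exponential_growth : exists lam delta : R, [/\ 0 <= lam, 0 < delta &
  forall t, 0 <= t -> delta <= Z t * expR (- (lam * t)) <= 1].
Proof.
pose T1 := Num.max 1 T0.
pose A := [set phi s / s | s in [set s : R | 0 < s]].
have T10 : 0 < T1 by rewrite lt_max ltr01.
have supA : has_sup A.
  split; first by exists (phi 1 / 1), 1 => //=.
  by exists ((phi T1 + kappa) / T1) => _ [s /= s0 <-]; exact: phi_compare.
pose lam := sup A.
have phile t : 0 <= t -> phi t <= lam * t.
  rewrite le_eqVlt => /predU1P[<-|t0].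
    rewrite mulr0; have := phiD (lexx 0) (lexx 0); rewrite addr0; lra.
  by rewrite -ler_pdivrMr//; apply: ub_le_sup; [case: supA|exists t].
have lam0 : 0 <= lam.
  have := phile 1 ler01; rewrite mulr1; apply: le_trans; exact: phi_ge0.
have phige t : T1 <= t -> lam * t - kappa <= phi t.
  move=> Tt; have t0 : 0 < t by rewrite (lt_le_trans T10).
  rewrite lerBlDr -ler_pdivlMr//; apply: ge_sup; first by case: supA.
  by move=> _ [s /= s0 <-]; exact: phi_compare.
exists lam, (expR (- (kappa + lam * T1))); split => //; first exact: expR_gt0.
move=> t t0; have -> : Z t = expR (phi t) by rewrite /phi lnK ?posrE ?Z_gt0.
rewrite -expRD -[X in _ && (_ <= X)]expR0 !ler_expR; apply/andP; split; last first.
  by rewrite subr_le0 phile.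
have [Tt|tT] := leP T1 t.
  by have := phige t Tt; have : 0 <= lam * T1 by [rewrite mulr_ge0// ltW]; lra.
have := phi_ge0 t0; have : lam * t <= lam * T1 by rewrite ler_wpM2l// ltW.
have := kappa_ge0; lra.
Qed.

End growth.

(** * Slow variation of solutions of a renewal equation *)

Section renewal.
Variables (R : realType) (F : nat -> R).
Hypothesis F_ge0 : forall j, 0 <= F j.
Hypothesis F_sum : forall n, \sum_(1 <= j < n) F j <= 1.

Lemma renewal_tail (eta : R) : 0 < eta ->
  exists2 J, (1 < J)%N & forall n, \sum_(J <= j < n) F j <= eta.
Proof.
move=> eta0; pose S n := \sum_(1 <= j < n) F j.
have SD m n : (0 < m)%N -> (m <= n)%N -> S n = S m + \sum_(m <= j < n) F j.
  by move=> m0 mn; rewrite /S (big_cat_nat (n := m)).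
have supS : has_sup (range S).
  by split; [exists (S 0%N), 0%N|exists 1 => _ [n _ <-]; exact: F_sum].
have [_ [J _ <-] SJ] := sup_adherent eta0 supS.
have Smono m n : (m <= n)%N -> S m <= S n.
  case: m => [|m] mn; first by rewrite /S big_geq// sumr_ge0.
  by rewrite (SD m.+1 n)// lerDl sumr_ge0.
exists (maxn J 2); first by rewrite leq_max ltnSn orbT.
move=> n; have [nJ|Jn] := leqP n (maxn J 2); first by rewrite big_geq// ltW.
have := SD (maxn J 2) n _ (ltnW Jn); rewrite leq_max orbT => /(_ isT) Sn.
have S1 : S n <= sup (range S) by apply: ub_le_sup; [case: supS|exists n].
have S2 : S J <= S (maxn J 2) by apply: Smono; exact: leq_maxl.
rewrite -(lerD2l (S (maxn J 2))) -Sn.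
have := ltW SJ; rewrite lerBlDr => /(le_trans S1); move/le_trans; apply.
by rewrite lerD2r.
Qed.

Hypothesis F1 : 0 < F 1.
Variables (h : R) (v : R -> R).
Hypothesis h0 : 0 < h.
Hypothesis v_bound : forall t, 0 <= t -> `|v t| <= 1.
Hypothesis v_sum : forall t n, n%:R * h <= t -> \sum_(k < n) v (t - k%:R * h) <= 1.
Hypothesis v_eq : forall eta, 0 < eta -> exists2 J, (1 < J)%N & exists t0,
  forall t, t0 <= t -> J%:R * h <= t /\
    v t <= \sum_(1 <= j < J) F j * v (t - j%:R * h) + eta.

(* At a time where [v] is close to its limsup, the renewal equation forces [v]
   to be close to its limsup at the preceding lattice times as well, because
   [F 1 > 0]; a positive limsup would then contradict [v_sum]. *)
Lemma renewal_limsup_le0 (eps : R) : 0 < eps -> exists t0, forall t, t0 <= t -> v t <= eps.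
Proof.
move=> eps0; apply: contrapT => noeps.
pose S := [set c | exists t0, forall t, t0 <= t -> v t <= c].
have S1 : S 1 by exists 0 => t t0; rewrite (le_trans (ler_norm _))// v_bound.
have lbS : lbound S eps.
  move=> c [t0 vc]; rewrite leNgt; apply/negP => ce; apply: noeps.
  by exists t0 => t /vc /le_trans; apply; exact: ltW.
have infS : has_inf S by split; [exists 1|exists eps].
pose gam := inf S.
have gam0 : 0 < gam by rewrite (lt_le_trans eps0)//; apply: lb_le_inf => //; exists 1.
pose f := F 1.
have f1 : f <= 1 by have := F_sum 2; rewrite big_nat1.
pose n := (Num.truncn (2 / gam)).+1.
have ngam : 2 < n%:R * gam.
  rewrite -ltr_pdivrMr//.
  have q0 : 0 <= 2 / gam by rewrite divr_ge0 ?ltW.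
  by have /andP[] := truncn_itv q0.
have f4 : 1 <= 4 / f by rewrite ler_pdivlMr// mul1r (le_trans f1)// ler1n.
have f40 : 0 < 4 / f by rewrite divr_gt0.
(* Each lattice step back multiplies the allowed defect below [gam] by [4 / f]. This choice leaves a
   defect [gam / 2] after [n] steps, so the [n] values sum to at least [n * gam / 2], which exceeds
   [1]. *)
pose eta := gam / 2 / (4 / f) ^+ n.
have eta0 : 0 < eta by rewrite divr_gt0 ?exprn_gt0// divr_gt0.
pose th k := (4 / f) ^+ k * eta.
have [J J1 [t0 Kt]] := v_eq eta0.
have [c [t1 vc] cgam] := inf_adherent eta0 infS.
have vup t : t1 <= t -> v t <= gam + eta.
  by move=> /vc /le_trans; apply; exact: ltW.
pose M := Num.max 0 (Num.max t0 t1).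
have M0 : 0 <= M by rewrite le_max lexx.
have Mt0 : t0 <= M by rewrite !le_max lexx orbT.
have Mt1 : t1 <= M by rewrite !le_max lexx !orbT.
have nat_h k : 0 <= k%:R * h by rewrite mulr_ge0 ?ler0n// ltW.
pose T := M + n%:R * h + J%:R * h.
have [t Tt vt] : exists2 t, T <= t & gam - eta < v t.
  apply/not_exists2P => no.
  have : gam <= gam - eta.
    apply: ge_inf; first by case: infS.
    exists T => t Tt; rewrite leNgt; apply/negP => vt.
    by case: (no t).
  by rewrite lerBrDl gerDr leNgt eta0.
have vk k : (k <= n)%N -> gam - th k <= v (t - k%:R * h).
  elim: k => [|k IH] kn; first by rewrite mul0r subr0 /th expr0 mul1r ltW.
  have {}IH := IH (ltnW kn).
  set s := t - k%:R * h in IH.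
  have kh : k%:R * h <= n%:R * h by rewrite ler_wpM2r ?ler_nat ?ltW// ltnW.
  have sT : M + J%:R * h <= s by rewrite /s; move: Tt; rewrite /T; lra.
  have s0 : t0 <= s by have := nat_h J; lra.
  have [_ Ks] := Kt _ s0.
  have etak : eta <= th k by rewrite /th ler_peMl ?exprn_ege1// ltW.
  have rest : \sum_(2 <= j < J) F j * v (s - j%:R * h) <= (1 - f) * (gam + eta).
    apply: (@le_trans _ _ (\sum_(2 <= j < J) F j * (gam + eta))).
      apply: ler_sum_nat => j /andP[_ jJ]; apply: ler_wpM2l => //; apply: vup.
      have : j%:R * h <= J%:R * h by rewrite ler_wpM2r ?ler_nat ?ltW// ltnW.
      lra.
    rewrite -mulr_suml; apply: ler_wpM2r; first by rewrite addr_ge0// ltW.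
    have := F_sum J; rewrite (big_ltn J1) -/f; lra.
  rewrite (big_ltn J1) -/f mul1r in Ks.
  have -> : t - k.+1%:R * h = s - h by rewrite /s -natr1 mulrDl mul1r opprD addrA.
  have thS : th k.+1 = 4 * th k / f by rewrite /th exprS; field; rewrite gt_eqF.
  rewrite thS -(ler_pM2l F1) -/f mulrBr [X in _ - X](_ : _ = 4 * th k); last first.
    by field; rewrite gt_eqF.
  have fe : 0 <= f * eta by rewrite mulr_ge0 ?ltW.
  have := rest; have := Ks; have := IH; have := etak; have := eta0; nra.
have thn : th n = gam / 2 by rewrite /th /eta mulrC divfK// gt_eqF// exprn_gt0.
have : \sum_(k < n) v (t - k%:R * h) <= 1.
  by apply: v_sum; have := nat_h J; move: Tt; rewrite /T; lra.
apply/negP; rewrite -ltNge.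
have : \sum_(k < n) (gam / 2) <= \sum_(k < n) v (t - k%:R * h).
  apply: ler_sum => k _; apply: le_trans (vk k (ltnW (ltn_ord k))).
  have : th k <= th n by rewrite /th ler_pM2r// ler_weXn2l// ltnW.
  by rewrite thn; lra.
apply: lt_le_trans; rewrite sumr_const card_ord -mulr_natl.
have := ngam; lra.
Qed.

End renewal.

(** * Mass and increments of a bounded renewal sequence *)

Section renewal_profile.
Variables (R : realType) (h delta C : R) (U : R -> R) (F : nat -> R).
Hypothesis h0 : 0 < h.
Hypothesis delta0 : 0 < delta.
Hypothesis U_bd : forall t, 0 <= t -> delta <= U t <= 1.
Hypothesis F_ge0 : forall j, 0 <= F j.
Hypothesis F1 : 0 < F 1.
Hypothesis C0 : 0 <= C.
Hypothesis U_renewal : forall t r, 0 <= t -> t < r%:R * h -> r%:R * h <= t + h ->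
  exists2 dd, 0 <= dd <= C * F r & U t = \sum_(1 <= j < r) F j * U (t - j%:R * h) + dd.

Let nat_h k : 0 <= k%:R * h. Proof. by rewrite mulr_ge0 ?ler0n// ltW. Qed.

Let U_ge0 t : 0 <= t -> 0 <= U t.
Proof. by move=> /U_bd/andP[+ _]; apply: le_trans; exact: ltW. Qed.

Let U_le1 t : 0 <= t -> U t <= 1.
Proof. by move=> /U_bd/andP[]. Qed.

(** If finitely many [F j] summed to [q > 1], iterating the renewal equation would give
    [U >= q ^ k * delta] at large lattice times, contradicting [U <= 1]. Bernoulli's inequality
    makes the growth explicit. *)
Lemma renewal_mass_le1 n : \sum_(1 <= j < n) F j <= 1.
Proof.
case: n => [|J]; first by rewrite big_geq.
rewrite leNgt; apply/negP => F1lt.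
pose q := \sum_(1 <= j < J.+1) F j.
have J0 : (0 < J)%N.
  by case: J F1lt {q} => // ; rewrite big_geq// ltr10.
have Uq k n : (k * J <= n)%N -> q ^+ k * delta <= U (n%:R * h).
  elim: k n => [|k IH] n kn; first by rewrite expr0 mul1r; have /andP[] := U_bd (nat_h n).
  have Jn : (J <= n)%N by rewrite (leq_trans _ kn)// mulSn leq_addr.
  have [dd /andP[dd0 _] ->] := @U_renewal (n%:R * h) n.+1 (nat_h n)
    (ltac:(by rewrite ltr_pM2r// ltr_nat)) (ltac:(by rewrite -natr1 mulrDl mul1r)).
  apply: (@le_trans _ _ (\sum_(1 <= j < J.+1) F j * U (n%:R * h - j%:R * h))).
    rewrite exprS -mulrA mulr_suml; apply: ler_sum_nat => j /andP[j0 jJ].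
    apply: ler_wpM2l => //.
    rewrite -mulrBl -natrB; last by rewrite (leq_trans _ Jn).
    by apply: IH; move: kn jJ; rewrite mulSn; move: (k * J)%N => ?; lia.
  rewrite [X in _ <= X + _](big_cat_nat (n := J.+1))//= -addrA lerDl addr_ge0//.
  rewrite big_nat_cond sumr_ge0// => j /andP[/andP[_ jn] _].
  rewrite mulr_ge0// U_ge0// subr_ge0; apply: ler_wpM2r; first exact: ltW.
  by rewrite ler_nat -ltnS.
have bern k : 1 + k%:R * (q - 1) <= q ^+ k.
  elim: k => [|k IH]; first by rewrite mul0r addr0 expr0.
  rewrite exprS -natr1; have q1 : 0 < q - 1 by rewrite subr_gt0.
  have := ler_wpM2l (ltW (lt_trans ltr01 F1lt)) IH; rewrite -/q => /(le_trans _); apply.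
  by have : 0 <= k%:R * (q - 1) ^+ 2 by [rewrite mulr_ge0// sqr_ge0]; rewrite expr2; lra.
have q1 : 0 < q - 1 by rewrite subr_gt0.
have qd : 0 < (q - 1) * delta by rewrite mulr_gt0.
have r0 : 0 <= 1 / ((q - 1) * delta) by rewrite divr_ge0 ?ltW.
pose k := (Num.truncn (1 / ((q - 1) * delta))).+1.
have /andP[_ hk] := truncn_itv r0.
have k1 : 1 < k%:R * ((q - 1) * delta) by rewrite -ltr_pdivrMr.
have /andP[_ U1] := U_bd (nat_h (k * J)).
have := le_trans (Uq k (k * J)%N (leqnn _)) U1.
have := ler_wpM2r (ltW delta0) (bern k); move=> /le_trans /[apply].
rewrite mulrDl mul1r -mulrA; have := delta0; lra.
Qed.

Let v t := U (t + h) - U t.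

Let sum_shift m t :
  \sum_(1 <= j < m) F j * U (t + h - j%:R * h) - \sum_(1 <= j < m) F j * U (t - j%:R * h) =
  \sum_(1 <= j < m) F j * v (t - j%:R * h).
Proof.
rewrite -sumrB; apply: eq_bigr => j _.
by rewrite -mulrBr /v addrAC.
Qed.

Let v_approx eta : 0 < eta -> exists2 J, (1 < J)%N & exists t0, forall t, t0 <= t ->
  J%:R * h <= t /\ `|v t - \sum_(1 <= j < J) F j * v (t - j%:R * h)| <= eta.
Proof.
(* Four errors must fit into [eta]: the tail beyond [J], the extra term of index [r] in the equation
   at [t + h], and two boundary defects of at most [C * e] each. *)
move=> eta0; pose e := eta / (2 + 2 * C).
have C2 : 0 < 2 + 2 * C by have := C0; lra.
have e0 : 0 < e by rewrite divr_gt0.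
have [J J1 FJ] := renewal_tail F_ge0 renewal_mass_le1 e0.
exists J => //; exists (J%:R * h) => t tJ; split => //.
have t0 : 0 <= t by rewrite (le_trans (nat_h J)).
pose r := (Num.truncn (t / h)).+1.
have th0 : 0 <= t / h by rewrite divr_ge0// ltW.
have /andP[r1 r2] := truncn_itv th0.
have tr : t < r%:R * h by rewrite -ltr_pdivrMr.
have rt : r%:R * h <= t + h.
  by rewrite /r -natr1 mulrDl mul1r lerD2r -ler_pdivlMr.
have Jr : (J <= r)%N.
  by rewrite -(ler_nat R) -(ler_pM2r h0) (le_trans tJ)// ltW.
have [d1 d1b E1] := U_renewal t0 tr rt.
have [d2 d2b E2] := @U_renewal (t + h) r.+1
  (ltac:(by rewrite addr_ge0// ltW)) (ltac:(by rewrite -natr1 mulrDl mul1r ltrD2r))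
  (ltac:(by rewrite -natr1 mulrDl mul1r lerD2r)).
have FrJ j : (J <= j)%N -> F j <= e.
  move=> Jj; apply: le_trans (FJ j.+1).
  by rewrite big_nat_recr//= lerDr sumr_ge0.
have Fr := FrJ _ Jr; have FrS := FrJ _ (leqW Jr).
rewrite big_nat_recr//= in E2.
have -> : v t - \sum_(1 <= j < J) F j * v (t - j%:R * h) =
    \sum_(J <= j < r) F j * v (t - j%:R * h) + (F r * U (t + h - r%:R * h) + d2 - d1).
  have J0 : (0 < J)%N by rewrite ltnW.
  have vE : v t = U (t + h) - U t by [].
  have cat : \sum_(1 <= j < r) F j * v (t - j%:R * h) =
      \sum_(1 <= j < J) F j * v (t - j%:R * h) + \sum_(J <= j < r) F j * v (t - j%:R * h).
    by rewrite (big_cat_nat (n := J)).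
  have ab := sum_shift r t; rewrite cat in ab.
  by rewrite vE E2 E1; lra.
have Ur : 0 <= U (t + h - r%:R * h) <= 1.
  by rewrite U_ge0 ?U_le1 ?subr_ge0.
have tail : `|\sum_(J <= j < r) F j * v (t - j%:R * h)| <= e.
  apply: (le_trans (ler_norm_sum _ _ _)); apply: le_trans (FJ r).
  apply: ler_sum_nat => j /andP[_ jr]; rewrite normrM ger0_norm// ler_piMr//.
  have tj : 0 <= t - j%:R * h.
    rewrite subr_ge0 -ler_pdivlMr// (le_trans _ r1)// ler_nat.
    by rewrite -ltnS.
  have /andP[a1 a2] := U_bd tj.
  have /andP[b1 b2] : delta <= U (t - j%:R * h + h) <= 1 by apply: U_bd; rewrite addr_ge0// ltW.
  by rewrite /v ler_norml; have := delta0; lra.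
have FU : 0 <= F r * U (t + h - r%:R * h) <= e.
  case/andP: Ur => u0 u1; rewrite mulr_ge0//= (le_trans _ Fr)// ler_piMr//.
have d1e : d1 <= C * e by case/andP: d1b => _ /le_trans; apply; rewrite ler_wpM2l.
have d2e : d2 <= C * e by case/andP: d2b => _ /le_trans; apply; rewrite ler_wpM2l.
have -> : eta = e + e + C * e + C * e by rewrite /e; field; rewrite gt_eqF.
case/andP: d1b => d10 _; case/andP: d2b => d20 _; case/andP: FU => FU0 FU1.
have -> : e + e + C * e + C * e = e + (e + C * e + C * e) by ring.
apply: (le_trans (ler_normD _ _)); rewrite lerD//.
rewrite ler_norml; have Ce : 0 <= C * e by rewrite mulr_ge0// ltW.
by apply/andP; split; lra.
Qed.

Let v_bound t : 0 <= t -> `|v t| <= 1.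
Proof.
move=> t0; have /andP[a1 a2] := U_bd t0.
have /andP[b1 b2] : delta <= U (t + h) <= 1 by apply: U_bd; rewrite addr_ge0// ltW.
by rewrite /v ler_norml; have := delta0; lra.
Qed.

Let v_tel t n : \sum_(k < n.+1) v (t - k%:R * h) = U (t + h) - U (t - n%:R * h).
Proof.
elim: n => [|n IH]; first by rewrite big_ord1 /v mul0r subr0.
rewrite big_ord_recr/= IH /v (_ : n.+1%:R = n%:R + 1); last by rewrite natr1.
rewrite mulrDl mul1r.
have -> : t - (n%:R * h + h) + h = t - n%:R * h by ring.
ring.
Qed.

Let v_tel_bound t n : n%:R * h <= t -> `|\sum_(k < n) v (t - k%:R * h)| <= 1.
Proof.
case: n => [|n] nt; first by rewrite big_ord0 normr0.
have t0 : 0 <= t by rewrite (le_trans (nat_h n.+1)).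
rewrite v_tel; have /andP[a1 a2] : delta <= U (t + h) <= 1 by apply: U_bd; rewrite addr_ge0// ltW.
have /andP[b1 b2] : delta <= U (t - n%:R * h) <= 1.
  apply: U_bd; rewrite subr_ge0 (le_trans _ nt)//; apply: ler_wpM2r; first exact: ltW.
  by rewrite ler_nat.
by rewrite ler_norml; have := delta0; lra.
Qed.

(** The approximate equation, the bound and the telescoping sums are all symmetric in sign, so the
    one-sided limsup statement applies to the increment and to its negative. *)
Lemma renewal_increment_cvg0 eps : 0 < eps ->
  exists t0, forall t, t0 <= t -> `|U (t + h) - U t| <= eps.
Proof.
move=> eps0.
have [ta Pa] : exists t0, forall t, t0 <= t -> v t <= eps.
  apply: (renewal_limsup_le0 F_ge0 renewal_mass_le1 F1 h0 _ _ _ eps0).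
  - exact: v_bound.
  - by move=> t n /v_tel_bound; apply: le_trans; exact: ler_norm.
  - move=> eta /v_approx[J J1 [t0 P]]; exists J => //; exists t0 => t /P[Jt].
    by rewrite ler_norml => /andP[_]; rewrite lerBlDl; split.
have [tb Pb] : exists t0, forall t, t0 <= t -> - v t <= eps.
  apply: (@renewal_limsup_le0 _ F F_ge0 renewal_mass_le1 F1 h (fun t => - v t) h0 _ _ _ _ eps0).
  - by move=> t /v_bound; rewrite normrN.
  - move=> t n /v_tel_bound; rewrite sumrN; apply: le_trans; rewrite -normrN; exact: ler_norm.
  - move=> eta /v_approx[J J1 [t0 P]]; exists J => //; exists t0 => t /P[Jt].
    rewrite ler_norml => /andP[+ _]; split => //.
    under eq_bigr do rewrite mulrN.
    by rewrite sumrN; lra.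
exists (Num.max ta tb) => t; rewrite ge_max => /andP[tta ttb].
by rewrite -/(v t) ler_norml; have := Pa _ tta; have := Pb _ ttb; lra.
Qed.

End renewal_profile.

(** * Gibbs weights *)

Lemma measurable_expeR (R : realType) : measurable_fun setT (@expeR R).
Proof.
apply: (measurability (@ErealGenInftyO.G R)); first exact: ErealGenInftyO.measurableE.
move=> _ [_ [r ->] <-]; rewrite setTI.
have [r0|r0] := leP r 0.
  have -> : @expeR R @^-1` `]-oo, r%:E[%classic = set0; last exact: measurable0.
  apply/seteqP; split => // x /=; rewrite in_itv/= => /lt_le_trans.
  by move=> /(_ 0%E); rewrite lee_fin r0 => /(_ isT); rewrite ltNge expeR_ge0.
have -> : @expeR R @^-1` `]-oo, r%:E[%classic = `]-oo, (ln r)%:E[%classic.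
  have rE : expeR (ln r)%:E = r%:E by rewrite /= lnK.
  by apply/seteqP; split => x; rewrite /preimage/= !in_itv/= -rE lte_expeR.
exact: emeasurable_itv.
Qed.

Lemma measurable_fun_seq_sum (disp : measure_display) (T : measurableType disp)
    (R : realType) (s : seq nat) (f : nat -> T -> R) :
  (forall k, measurable_fun setT (f k)) ->
  measurable_fun setT (fun x => \sum_(k <- s) f k x).
Proof.
move=> mf; elim: s => [|k s IH].
  by under eq_fun do rewrite big_nil; exact: measurable_cst.
by under eq_fun do rewrite big_cons; exact: measurable_funD.
Qed.

Section kernel_shift.
Variable R : realFieldType.

Lemma kernel_reindex (G : R -> R -> R) (p : nat -> R) i j :
  kernel G p i (i + j) = kernel G (fun k => p (i + k)%N) 0 j.
Proof.
rewrite /kernel addKn subn0.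
suff : forall n j, kernel_rec G n p i (i + j) = kernel_rec G n (fun k => p (i + k)%N) 0 j by [].
elim => //= n IH {}j; rewrite addn0; congr (_ - _).
rewrite -(add1n i) big_addn addKn; apply: eq_big_nat => k _.
by rewrite (addnC k) IH.
Qed.

Lemma kernel_translate (G : R -> R -> R) (p : nat -> R) c i j :
  kernel (fun a b => G (a + c) (b + c)) p i j = kernel G (fun k => p k + c) i j.
Proof.
rewrite /kernel; move: (j - i)%N => m; elim: m j => //= n IH l; congr (_ - _).
by apply: eq_bigr => k _; rewrite IH.
Qed.

Lemma eq_kernel_weight (G G' : R -> R -> R) (p : nat -> R) i j :
  (forall k l, (i <= k)%N -> (l <= j)%N -> G (p k) (p l) = G' (p k) (p l)) ->
  kernel G p i j = kernel G' p i j.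
Proof.
move=> GG; rewrite /kernel.
suff : forall n l, (l <= j)%N -> kernel_rec G n p i l = kernel_rec G' n p i l by apply.
elim=> // n IH l lj; rewrite /= (GG i l (leqnn i) lj); congr (_ - _).
apply: eq_big_nat => k /andP[ik kl].
by rewrite (GG k l (ltnW ik) lj) IH// ltnW// (leq_trans kl).
Qed.

End kernel_shift.

Section gibbs_paths.
Variables (R : realType) (d : nat) (W : probability (cpath R d) R).
Hypothesis hW : brownian_increments_law W.
Variable alpha : R.
Hypothesis alpha0 : 0 < alpha.
Variable w : R -> 'rV[R]_d -> \bar R.
Hypothesis w_meas : measurable_fun [set p : R * 'rV[R]_d | 0 <= p.1]
  (fun p : R * 'rV[R]_d => w p.1 p.2).
Hypothesis w_pos : forall (t : R) (x : 'rV[R]_d), 0 <= t -> (0 < w t x)%E.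
Hypothesis Z_fin : forall T : R, 0 <= T -> (partition_function W w alpha T < +oo)%E.
Local Open Scope ereal_scope.

Local Notation gw := (gibbs_weight w alpha).
Local Notation Z := (partition_function W w alpha).

Lemma gibbs_weightE a b x : gw a b x = expeR ((alpha / 2)%:E * energy w a b x).
Proof. by rewrite energyE. Qed.

Lemma gibbs_weight_ge0 a b x : 0 <= gw a b x.
Proof. exact: expeR_ge0. Qed.

Local Opaque gibbs_weight integral.

Lemma measurable_gibbs_weight a b : measurable_fun setT (gw a b).
Proof.
have -> : gw a b = fun x => expeR ((alpha / 2)%:E * energy w a b x).
  by apply/funext => x; rewrite gibbs_weightE.
apply: (measurableT_comp (@measurable_expeR R)).
by apply: measurable_funeM; exact: measurable_energy.
Qed.

Lemma local_gibbs_weight a b : local `[a, b] (gw a b).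
Proof. by move=> x y xy; rewrite !gibbs_weightE (local_energy w_meas w_pos xy). Qed.

Lemma gibbs_weight_shift a b c x :
  gw a b (path_shift c x) = gw (a + c)%R (b + c)%R x.
Proof. by rewrite !gibbs_weightE energy_shift. Qed.

Lemma gibbs_weight_aa a x : gw a a x = 1.
Proof. by rewrite gibbs_weightE energy_aa// mule0 expeR0. Qed.

Lemma integral_gibbs_weight a b : \int[W]_x gw a b x = Z (b - a).
Proof.
transitivity (\int[W]_x gw 0%R (b - a)%R (path_shift a x)); last first.
  exact: (integral_path_shift hW a (measurable_gibbs_weight _ _) (gibbs_weight_ge0 _ _)).
by apply: eq_integral => x _; rewrite gibbs_weight_shift add0r subrK.
Qed.

(** Where [w] takes the value [+oo] the weight can be infinite. Countably many intervals suffice,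
    since the energy is monotone in the interval. *)
Definition finite_energy (x : cpath R d) := forall n : nat, energy w (- n%:R)%R n%:R x < +oo.

(** Finite partition functions make the weights integrable, hence finite almost everywhere; as
    [alpha > 0], infinite energy would make the weight infinite. *)
Lemma ae_finite_energy : {ae W, forall x, finite_energy x}.
Proof.
apply: ae_foralln => n.
have i : W.-integrable setT (gw (- n%:R)%R n%:R).
  apply/integrableP; split; first exact: measurable_gibbs_weight.
  under eq_integral do rewrite gee0_abs ?gibbs_weight_ge0//.
  by rewrite integral_gibbs_weight Z_fin// opprK addr_ge0.
apply: filterS (integrable_ae measurableT i) => x /(_ I).
rewrite gibbs_weightE ge0_fin_numE ?expeR_ge0// ltey expeR_eqy ltey.
apply: contra => /eqP ->; rewrite gt0_muley// lte_fin; exact: divr_gt0.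
Qed.

Lemma energy_mono a b a' b' x : (a' <= a)%R -> (b <= b')%R ->
  energy w a b x <= energy w a' b' x.
Proof.
move=> aa bb; rewrite /energy /energy_on; apply: ge0_subset_integral.
- by apply: measurableX; exact: measurable_itv.
- by apply: measurableX; exact: measurable_itv.
- exact: measurable_funTS (measurable_interaction w_meas x).
- by move=> p _; exact: interaction_ge0.
- by move=> p [] /=; rewrite !in_itv/= => /andP[p1 p2] /andP[p3 p4]; split;
    apply/andP; split; [exact: le_trans p1|exact: le_trans bb|
      exact: le_trans p3|exact: le_trans bb].
Qed.

(** On paths of infinite weight [fine] returns [0], so the lower bound [1] and supermodularity are
    claimed on finite-energy paths only. With the path as first argument, [gibbs_real x] is a weight
    to which [kernel] applies. *)
Definition gibbs_real (x : cpath R d) a b : R := fine (gw a b x).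

Lemma finite_energy_lty x a b : finite_energy x -> energy w a b x < +oo.
Proof.
move=> fx; pose n := (Num.truncn `|a| + Num.truncn `|b|).+1.
have an : (`|a| <= n%:R)%R.
  by have /andP[_ /ltW/le_trans] := truncn_itv (normr_ge0 a); apply; rewrite ler_nat ltnS leq_addr.
have bn : (`|b| <= n%:R)%R.
  by have /andP[_ /ltW/le_trans] := truncn_itv (normr_ge0 b); apply; rewrite ler_nat ltnS leq_addl.
apply: le_lt_trans (fx n); apply: energy_mono.
  by move: an; rewrite ler_norml => /andP[].
by move: bn; rewrite ler_norml => /andP[].
Qed.

Lemma gibbs_realE x a b : finite_energy x ->
  gibbs_real x a b = expR (alpha / 2 * fine (energy w a b x)).
Proof.
move=> /(finite_energy_lty a b) e; rewrite /gibbs_real gibbs_weightE.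
by rewrite -{1}(@fineK _ (energy w a b x))// ge0_fin_numE// energy_ge0.
Qed.

Lemma gibbs_real_fin x a b : finite_energy x -> gw a b x = (gibbs_real x a b)%:E.
Proof.
move=> /(finite_energy_lty a b) e; rewrite /gibbs_real fineK// gibbs_weightE.
rewrite ge0_fin_numE ?expeR_ge0// ltey expeR_eqy.
by rewrite -(@fineK _ (energy w a b x))// ge0_fin_numE// energy_ge0.
Qed.

Let fine_energy_ge0 a b x : (0 <= fine (energy w a b x))%R.
Proof. by apply: fine_ge0; exact: energy_ge0. Qed.

Let a2 : (0 <= alpha / 2)%R. Proof. by rewrite divr_ge0// ltW. Qed.

Lemma gibbs_real_ge1 x : finite_energy x -> forall a b, (a <= b)%R -> (1 <= gibbs_real x a b)%R.
Proof.
move=> fx a b _; rewrite gibbs_realE// -[X in (X <= _)%R]expR0 ler_expR.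
exact: mulr_ge0.
Qed.

Lemma gibbs_real_aa x a : gibbs_real x a a = 1%R.
Proof. by rewrite /gibbs_real gibbs_weight_aa. Qed.

Let expR_mul_le (u v u' v' : R) : (u + v <= u' + v')%R ->
  (expR u * expR v <= expR u' * expR v')%R.
Proof. by move=> uv; rewrite -!expRD ler_expR. Qed.

Lemma gibbs_real_super x : finite_energy x -> forall a b c e,
  (a <= b)%R -> (b <= c)%R -> (c <= e)%R ->
  (gibbs_real x a c * gibbs_real x b e <= gibbs_real x a e * gibbs_real x b c)%R.
Proof.
move=> fx a b c e ab bc ce; rewrite (gibbs_realE a c fx) (gibbs_realE b e fx).
rewrite (gibbs_realE a e fx) (gibbs_realE b c fx).
move: (alpha / 2)%R a2 => k k0.
apply: expR_mul_le; rewrite -2!mulrDr; apply: (ler_wpM2l k0).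
have := energy_supermodular w_meas w_pos x ab bc ce.
have f u v : energy w u v x \is a fin_num.
  by rewrite ge0_fin_numE ?energy_ge0// finite_energy_lty.
by rewrite -lee_fin !EFinD !fineK.
Qed.

Lemma local_gibbs_real x y a b : agree_on `[a, b] x y ->
  gibbs_real x a b = gibbs_real y a b.
Proof. by move=> xy; rewrite /gibbs_real (local_gibbs_weight xy). Qed.

Lemma measurable_gibbs_real a b : measurable_fun setT (fun x => gibbs_real x a b).
Proof. exact: measurableT_comp (measurable_gibbs_weight a b). Qed.

Lemma gibbs_real_ge0 x a b : (0 <= gibbs_real x a b)%R.
Proof. by apply: fine_ge0; exact: gibbs_weight_ge0. Qed.

Lemma gibbs_real_shift x a b c :
  gibbs_real (path_shift c x) a b = gibbs_real x (a + c)%R (b + c)%R.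
Proof. by rewrite /gibbs_real gibbs_weight_shift. Qed.

Lemma integral_gibbs_weight_real (A : set (cpath R d)) a b : measurable A ->
  \int[W]_(x in A) gw a b x = \int[W]_(x in A) (gibbs_real x a b)%:E.
Proof.
move=> mA; apply: ge0_ae_eq_integral => //.
- by apply: measurable_funTS; exact: measurable_gibbs_weight.
- by apply: measurable_funTS; apply/measurable_EFinP; exact: measurable_gibbs_real.
- by move=> x _; exact: gibbs_weight_ge0.
- by move=> x _; rewrite lee_fin gibbs_real_ge0.
by apply: filterS ae_finite_energy => x fx _; exact: gibbs_real_fin.
Qed.

Lemma integral_gibbs_real a b : (a <= b)%R ->
  \int[W]_x (gibbs_real x a b)%:E = (fine (Z (b - a)))%:E.
Proof.
move=> ab; rewrite -integral_gibbs_weight_real// integral_gibbs_weight fineK//.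
rewrite ge0_fin_numE ?Z_fin ?subr_ge0//.
by apply: integral_ge0 => x _; exact: gibbs_weight_ge0.
Qed.

End gibbs_paths.

(** * Two-sided renewal sums *)

Section renewal_window.
Variables (R : realType) (X : Type) (h delta C : R) (U : R -> R) (F : nat -> R).
Variables (N : nat -> nat -> X -> R) (top : X) (P : R -> X -> R).
Hypothesis h0 : 0 < h.
Hypothesis delta0 : 0 < delta.
Hypothesis U_bd : forall t, 0 <= t -> delta <= U t <= 1.
Hypothesis U_inc : forall eps, 0 < eps ->
  exists t0, forall t, t0 <= t -> `|U (t + h) - U t| <= eps.
Hypothesis F_ge0 : forall j, 0 <= F j.
Hypothesis F_sum : forall n, \sum_(1 <= j < n) F j <= 1.
Hypothesis F1 : 0 < F 1.
Hypothesis C0 : 0 <= C.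
Hypothesis N_ge0 : forall a b A, 0 <= N a b A.
Hypothesis N_le : forall a b A, N a b A <= F (a + b).+1.
Hypothesis N_top : forall a b, N a b top = F (a + b).+1.
Hypothesis P_top : forall T, 0 <= T -> P T top = 1.
Hypothesis P_expansion : forall T r A, (0 < r)%N ->
  r%:R * h <= T + h / 2 -> T + h / 2 < r.+1%:R * h ->
  exists2 D, 0 <= D <= C * \sum_(r.+1 <= m < r.*2.+2) F m &
    U (2 * T) * P T A = \sum_(0 <= a < r) \sum_(0 <= b < r)
      U (T - a%:R * h - h / 2) * U (T - b%:R * h - h / 2) * N a b A + D.

Definition square_sum L (f : nat -> nat -> R) := \sum_(0 <= a < L) \sum_(0 <= b < L) f a b.

Lemma le_square_sum L f g : (forall a b, (a < L)%N -> (b < L)%N -> f a b <= g a b) ->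
  square_sum L f <= square_sum L g.
Proof.
by move=> fg; apply: ler_sum_nat => a /andP[_ aL]; apply: ler_sum_nat => b /andP[_ bL]; exact: fg.
Qed.

Lemma square_sum_ge0 L f : (forall a b, (a < L)%N -> (b < L)%N -> 0 <= f a b) -> 0 <= square_sum L f.
Proof.
move=> f0; have <- : square_sum L (fun _ _ => 0) = 0.
  by rewrite /square_sum big1// => a _; rewrite big1.
exact: le_square_sum.
Qed.

Lemma square_sum_mono L r f : (L <= r)%N -> (forall a b, (a < r)%N -> (b < r)%N -> 0 <= f a b) ->
  square_sum L f <= square_sum r f.
Proof.
move=> Lr f0.
have s a (m n : nat) : (a < r)%N -> (n <= r)%N -> 0 <= \sum_(m <= b < n) f a b.
  move=> ar nr; rewrite big_nat_cond sumr_ge0// => b /andP[/andP[_ bn] _].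
  by rewrite f0// (leq_trans bn).
apply: (@le_trans _ _ (\sum_(0 <= a < L) \sum_(0 <= b < r) f a b)).
  apply: ler_sum_nat => a /andP[_ aL].
  by rewrite [leRHS](big_cat_nat (n := L))//= lerDl s// (leq_trans aL).
rewrite [leRHS](big_cat_nat (n := L))//= lerDl big_nat_cond sumr_ge0// => a /andP[/andP[_ ar] _].
exact: s.
Qed.

Lemma square_sumB L f g : square_sum L (fun a b => f a b - g a b) = square_sum L f - square_sum L g.
Proof. by rewrite /square_sum -sumrB; apply: eq_bigr => a _; rewrite sumrB. Qed.

Lemma square_sumZ L c f : square_sum L (fun a b => c * f a b) = c * square_sum L f.
Proof. by rewrite /square_sum mulr_sumr; apply: eq_bigr => a _; rewrite mulr_sumr. Qed.

Let S L := square_sum L (fun a b => F (a + b).+1).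

(** Grouping the pairs by [m = a + b + 1] shows that this is the sum of [m * F m]: the mean block
    length, in cells, when the [F m] sum to one. *)
Definition window_total := sup (range S).
Local Notation kappa := window_total.

Let S_mono L r : (L <= r)%N -> S L <= S r.
Proof. by move=> Lr; apply: square_sum_mono. Qed.

Let arg_ge0 T r a : r%:R * h <= T + h / 2 -> (a < r)%N -> 0 <= T - a%:R * h - h / 2.
Proof.
move=> rT ar; have : a.+1%:R * h <= r%:R * h by rewrite ler_wpM2r ?ler_nat// ltW.
rewrite -natr1 mulrDl; lra.
Qed.

Let U_ge0 t : 0 <= t -> 0 <= U t.
Proof. by move=> /U_bd/andP[+ _]; apply: le_trans; exact: ltW. Qed.

(** Finiteness of the mean block length. Expanding the full event at the half-length
    [L * h + h / 2], which is exactly aligned with the grid, bounds [delta ^ 2] times the sum by a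
    value of [U], hence by [1]. *)
Let S_bound L : S L <= delta ^- 2.
Proof.
apply: (@le_trans _ _ (S L.+1)); first exact: S_mono.
have L1 : L.+1%:R * h <= (L%:R * h + h / 2) + h / 2 by rewrite -natr1; lra.
have L2 : (L%:R * h + h / 2) + h / 2 < L.+2%:R * h 
  by have e2 : L.+2%:R = L%:R + 1 + 1 :> R by [rewrite !natr1]; rewrite e2; have := h0; lra.
have T0 : 0 <= L%:R * h + h / 2.
  by have : 0 <= L%:R * h by [rewrite mulr_ge0// ltW]; have := h0; lra.
have [D /andP[D0 _]] := P_expansion top (ltn0Sn L) L1 L2.
rewrite P_top// mulr1 => E.
have U1 : U (2 * (L%:R * h + h / 2)) <= 1 by have /andP[] := U_bd (mulr_ge0 (ler0n _ 2) T0).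
rewrite -[leRHS]mul1r ler_pdivlMr ?exprn_gt0// mulrC -square_sumZ.
apply: le_trans U1; rewrite E -[leLHS]addr0 lerD//; apply: le_square_sum => a b aL bL.
rewrite N_top ler_wpM2r// expr2.
have /andP[ua _] := U_bd (arg_ge0 L1 aL); have /andP[ub _] := U_bd (arg_ge0 L1 bL).
by apply: ler_pM; rewrite ?(ltW delta0).
Qed.

Let has_supS : has_sup (range S).
Proof. by split; [exists (S 0), 0%N|exists (delta ^- 2) => _ [L _ <-]]. Qed.

Lemma square_sum_le_total L : S L <= kappa.
Proof. by apply: ub_le_sup; [case: has_supS|exists L]. Qed.

Lemma window_total_gt0 : 0 < kappa.
Proof. by apply: lt_le_trans (square_sum_le_total 1); rewrite /S /square_sum !big_nat1. Qed.

Lemma square_sum_cvg : S L @[L --> \oo] --> kappa.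
Proof.
apply: nondecreasing_cvgn; first exact: S_mono.
by case: has_supS.
Qed.

(** For [a < L] the factors [U] are nearly one value [v]. The full event bounds [U (2 T)] by about
    [v ^ 2 * kappa]; for [A], keeping only the first [L] rows and columns gives at least about
    [v ^ 2] times the truncated sum. Eliminating [v] leaves a bound uniform in [A]. *)
Lemma window_lower_bound eps : 0 < eps -> exists T1 L, kappa - S L <= eps /\
  forall T A, T1 <= T -> square_sum L (fun a b => N a b A) / kappa - eps <= P T A.
Proof.
move=> eps0; have k0 := window_total_gt0.
(* Replacing products of [U] by [v ^ 2] costs [2 * e1 * kappa] in each of the two bounds; the mass
   outside the square costs [e1], the boundary terms [C * e1]. *)
pose K := 4 * kappa + 1 + C; have K0 : 0 < K by rewrite /K; have := C0; lra.
pose e1 := Num.min eps (eps * delta / K).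
have e10 : 0 < e1 by rewrite lt_min eps0 divr_gt0// mulr_gt0.
have e1eps : e1 <= eps by rewrite ge_min lexx.
have e1K : K * e1 <= eps * delta by rewrite mulrC -ler_pdivlMr// ge_min lexx orbT.
have [_ [L _ <-] SL] := sup_adherent e10 has_supS.
have [J _ tailJ] := renewal_tail F_ge0 F_sum e10.
have e2 : 0 < e1 / L.+1%:R by rewrite divr_gt0.
have [t0 inc] := U_inc e2.
(* From this time on, the increments of [U] between the first [L] rows are already small, and
   [r > L + J] puts the boundary blocks into the tail beyond [J]. *)
exists (`|t0| + (L + J).+1%:R * h + h), L; split.
  by apply: ltW; apply: lt_le_trans e1eps; move: SL; rewrite -/kappa; lra.
move=> T A TT.
pose r := Num.truncn ((T + h / 2) / h).
have n0 n : 0 <= n%:R * h by rewrite mulr_ge0// ltW.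
have Th0 : 0 <= (T + h / 2) / h.
  by rewrite divr_ge0 ?ltW//; have := normr_ge0 t0; have := n0 (L + J).+1; have := h0; lra.
have /andP[] := truncn_itv Th0; rewrite -/r ler_pdivlMr// ltr_pdivrMr// => rT Tr.
have rLJ : (L + J < r)%N.
  have : (L + J).+1%:R * h < r.+1%:R * h.
    by apply: le_lt_trans Tr; have := normr_ge0 t0; have := h0; lra.
  by rewrite ltr_pM2r// ltr_nat ltnS.

pose u a := U (T - a%:R * h - h / 2); pose v := u 0%N.
have ur a : (a < r)%N -> delta <= u a <= 1 by move=> ar; exact/U_bd/(arg_ge0 rT).
have r0 : (0 < r)%N by exact: leq_ltn_trans rLJ.
have uv a : (a <= L)%N -> `|u a - v| <= a%:R * (e1 / L.+1%:R).
  elim: a => [|a IH] aL; first by rewrite subrr normr0 mul0r.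
  have aS : a.+1%:R = a%:R + 1 :> R by rewrite natr1.
  have := IH (ltnW aL); rewrite aS mulrDl mul1r.
  have tt : t0 <= T - a.+1%:R * h - h / 2.
    have : a.+1%:R * h <= L%:R * h by rewrite ler_wpM2r ?ler_nat// ltW.
    have : L%:R * h <= (L + J).+1%:R * h by rewrite ler_wpM2r ?ler_nat ?leqW ?leq_addr// ltW.
    have := ler_norm t0; have := h0; lra.
  have := inc _ tt; have -> : T - a.+1%:R * h - h / 2 + h = T - a%:R * h - h / 2 by rewrite aS; ring.
  rewrite -/(u a.+1) -/(u a); move: (e1 / _) (a%:R * (e1 / _)) (u a) (u a.+1) => z t x y.
  rewrite !ler_norml; lra.
have uve a : (a < L)%N -> `|u a - v| <= e1.
  move=> aL; apply: le_trans (uv a (ltnW aL)) _; rewrite mulrCA ger_pMr//.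
  by rewrite ler_pdivrMr ?ltr0n// mul1r ler_nat ltnW// ltnW.
have Lr : (L <= r)%N by rewrite ltnW// (leq_ltn_trans _ rLJ)// leq_addr.
have /andP[v0 v1] : delta <= v <= 1 by exact: ur.
have mul_le x y : `|x| <= e1 -> delta <= y <= 1 -> `|x * y| <= e1.
  move=> xe /andP[y0 y1]; rewrite normrM -[leRHS]mulr1 ler_pM//.
  by rewrite ger0_norm// (le_trans (ltW delta0)).
have uu a b : (a < L)%N -> (b < L)%N -> `|u a * u b - v ^+ 2| <= 2 * e1.
  move=> aL bL.
  have -> : u a * u b - v ^+ 2 = (u a - v) * u b + (u b - v) * v by ring.
  apply: le_trans (ler_normD _ _) _; rewrite mulr_natl mulr2n; apply: lerD.
    exact: mul_le (uve _ aL) (ur b (leq_trans bL Lr)).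
  exact: mul_le (uve _ bL) (ur 0%N r0).
have T0 : 0 <= T by have := n0 (L + J).+1; have := normr_ge0 t0; have := h0; lra.
have /andP[U2d _] := U_bd (mulr_ge0 (ler0n _ 2) T0).
have uu0 a b : (a < r)%N -> (b < r)%N -> 0 <= u a * u b <= 1.
  move=> /ur/andP[a0 a1] /ur/andP[b0 b1].
  have a2 := le_trans (ltW delta0) a0; have b2 := le_trans (ltW delta0) b0.
  by rewrite mulr_ge0// mulr_ile1.
have tail : \sum_(r.+1 <= m < r.*2.+2) F m <= e1.
  apply: le_trans (tailJ r.*2.+2).
  rewrite [leRHS](big_cat_nat (n := r.+1))//=; last 2 first.
  - by rewrite leqW// ltnW// (leq_ltn_trans _ rLJ)// leq_addl.
  - by rewrite !ltnS -addnn leqW// leq_addr.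
  by rewrite lerDr sumr_ge0.
have upper : U (2 * T) <= (v ^+ 2 + 2 * e1) * kappa + e1 + C * e1.
  have [D /andP[_ DC]] := P_expansion top r0 rT Tr; rewrite P_top// mulr1 => ->.
  apply: lerD; last by apply: le_trans DC _; exact: ler_wpM2l.
  apply: (@le_trans _ _ (square_sum r (fun a b => u a * u b * F (a + b).+1))).
    by apply: le_square_sum => a b _ _; rewrite N_top.
  have : square_sum L (fun a b => F (a + b).+1 - u a * u b * F (a + b).+1) <=
         square_sum r (fun a b => F (a + b).+1 - u a * u b * F (a + b).+1).
    apply: square_sum_mono => // a b ar br; rewrite -{1}[F _]mul1r -mulrBl.
    by rewrite mulr_ge0// subr_ge0; have /andP[] := uu0 a b ar br.
  rewrite !square_sumB -/(S L) -/(S r).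
  have : square_sum L (fun a b => u a * u b * F (a + b).+1) <= (v ^+ 2 + 2 * e1) * S L.
    rewrite -square_sumZ; apply: le_square_sum => a b aL bL; apply: ler_wpM2r => //.
    by have := uu a b aL bL; rewrite ler_norml; lra.
  have : (v ^+ 2 + 2 * e1) * S L <= (v ^+ 2 + 2 * e1) * kappa.
    by apply: ler_wpM2l; rewrite ?square_sum_le_total// addr_ge0 ?sqr_ge0// mulr_ge0// ltW.
  by have := square_sum_le_total r; move: SL; rewrite -/kappa; lra.
pose M := square_sum L (fun a b => N a b A).
have M0 : 0 <= M by apply: square_sum_ge0.
have Mk : M <= kappa.
  by apply: le_trans (square_sum_le_total L); apply: le_square_sum.
have lower : (v ^+ 2 - 2 * e1) * M <= U (2 * T) * P T A.
  have [D /andP[D0 _] ->] := P_expansion A r0 rT Tr.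
  rewrite -[leLHS]addr0; apply: lerD => //.
  apply: (@le_trans _ _ (square_sum L (fun a b => u a * u b * N a b A))).
    rewrite -square_sumZ; apply: le_square_sum => a b aL bL; apply: ler_wpM2r => //.
    by have := uu a b aL bL; rewrite ler_norml; lra.
  apply: square_sum_mono => // a b ar br; rewrite mulr_ge0//.
  by have /andP[] := uu0 a b ar br.
have U20 : 0 < U (2 * T) by exact: lt_le_trans U2d.
rewrite -/M -(ler_pM2l U20) mulrBr.
have v2 : (U (2 * T) - (2 * kappa + 1 + C) * e1) / kappa <= v ^+ 2.
  by rewrite ler_pdivrMr//; move: upper; lra.
have : ((U (2 * T) - (2 * kappa + 1 + C) * e1) / kappa - 2 * e1) * M <= (v ^+ 2 - 2 * e1) * M.
  by apply: ler_wpM2r => //; lra.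
move=> /le_trans/(_ lower); apply: le_trans.
have -> : ((U (2 * T) - (2 * kappa + 1 + C) * e1) / kappa - 2 * e1) * M =
   U (2 * T) * (M / kappa) - ((2 * kappa + 1 + C) * e1 + 2 * e1 * kappa) * (M / kappa).
  by field; rewrite gt_eqF.
rewrite lerD2l lerN2.
have q1 : 0 <= M / kappa <= 1 by rewrite divr_ge0 ?(ltW k0)// ler_pdivrMr// mul1r.
apply: (@le_trans _ _ (K * e1)).
  have -> : (2 * kappa + 1 + C) * e1 + 2 * e1 * kappa = K * e1 by rewrite /K; ring.
  by rewrite ler_piMr ?mulr_ge0 ?(ltW K0) ?(ltW e10)//; case/andP: q1.
by apply: le_trans e1K _; rewrite mulrC ler_wpM2r// ltW.
Qed.

End renewal_window.

(** * Infinite-volume limit *)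

Lemma fine_integral_setC (disp : measure_display) (T : measurableType disp) (R : realType)
    (mu : {measure set T -> \bar R}) (f : T -> \bar R) (A : set T) :
  measurable A -> measurable_fun setT f -> (forall x, (0 <= f x)%E) ->
  (\int[mu]_x f x < +oo)%E ->
  fine (\int[mu]_(x in A) f x) + fine (\int[mu]_(x in ~` A) f x) = fine (\int[mu]_x f x).
Proof.
move=> mA mf f0 fin; have mC := measurableC mA.
have fA B : measurable B -> (\int[mu]_(x in B) f x)%E \is a fin_num.
  move=> mB; rewrite ge0_fin_numE; last exact: integral_ge0.
  by apply: le_lt_trans fin; exact: ge0_subset_integral.
rewrite -fineD ?fA//; congr fine; rewrite -ge0_integral_setU ?setUCr//.
by rewrite disj_set2E setICr.
Qed.

Lemma local_glue (R : realType) (d : nat) (J : set R) (U : Type) (f : cpath R d -> U) b c x y :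
  local J f -> J `<=` `[b, c]%classic -> f (glue b c x y) = f x.
Proof.
by move=> lf Jbc; apply: lf => s t /Jbc Js /Jbc Jt; apply: incr_glue_in;
  [move: Js|move: Jt]; rewrite /= in_itv.
Qed.

Lemma local_glue_left (R : realType) (d : nat) (J : set R) (U : Type) (f : cpath R d -> U) b c x y : (b <= c)%R ->
  local J f -> (forall s, J s -> (s <= b)%R) -> f (glue b c x y) = f y.
Proof. by move=> bc lf Jb; apply: lf => s t Js Jt; apply: incr_glue_left => //; exact: Jb. Qed.

Lemma local_glue_right (R : realType) (d : nat) (J : set R) (U : Type) (f : cpath R d -> U) b c x y : (b <= c)%R ->
  local J f -> (forall s, J s -> (c <= s)%R) -> f (glue b c x y) = f y.
Proof. by move=> bc lf Jc; apply: lf => s t Js Jt; apply: incr_glue_right => //; exact: Jc. Qed.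

(** * Cut expansions integrated against [W], for an abstract weight *)

Section multiplicative_weight.
Variables (R : realType) (d : nat) (W : probability (cpath R d) R).
Hypothesis hW : brownian_increments_law W.
Variable good : set (cpath R d).
Hypothesis ae_good : {ae W, forall x, good x}.
Variable G : cpath R d -> R -> R -> R.
Hypothesis mG : forall a b, measurable_fun setT (fun x => G x a b).
Hypothesis G_ge0 : forall x a b, 0 <= G x a b.
Hypothesis G_aa : forall x a, G x a a = 1.
Hypothesis G_local : forall x y a b, agree_on `[a, b] x y -> G x a b = G y a b.
Hypothesis G_shift : forall x a b c, G (path_shift c x) a b = G x (a + c) (b + c).
Hypothesis G_ge1 : forall x, good x -> forall a b, a <= b -> 1 <= G x a b.
Hypothesis G_super : forall x, good x -> forall a b c e, a <= b -> b <= c -> c <= e ->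
  G x a c * G x b e <= G x a e * G x b c.
Variable part : R -> R.
Hypothesis int_G : forall a b, a <= b -> (\int[W]_x (G x a b)%:E = (part (b - a))%:E)%E.
Local Open Scope ereal_scope.
Local Opaque integral.

(* Nonnegative without truncation on good paths only. *)
Definition cut_weight (p : nat -> R) i j (x : cpath R d) : R :=
  Num.max 0%R (kernel (G x) p i j).

Lemma cut_weightE p i j x : {homo p : m n / (m <= n)%N >-> (m <= n)%R} -> (i < j)%N ->
  good x -> cut_weight p i j x = kernel (G x) p i j.
Proof.
move=> hp ij fx; rewrite /cut_weight max_r//.
exact: (kernel_ge0 (G_ge1 fx) (G_aa x) (G_super fx) hp ij).
Qed.

Lemma cut_weight_ge0 p i j x : (0 <= cut_weight p i j x)%R.
Proof. by rewrite /cut_weight le_max lexx. Qed.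

Lemma measurable_cut_weight p i j : measurable_fun setT (cut_weight p i j).
Proof.
apply: (@measurable_maxr _ _ _ _ (cst 0%R) (fun x => kernel (G x) p i j)).
  exact: measurable_cst.
rewrite /kernel; move: (j - i)%N => m; elim: m j => [|n IH] l; first exact: measurable_cst.
apply: measurable_funB => //; apply: measurable_fun_seq_sum => k.
exact: measurable_funM.
Qed.

Lemma local_cut_weight p i j : {homo p : m n / (m <= n)%N >-> (m <= n)%R} ->
  (i < j)%N -> local `[p i, p j] (cut_weight p i j).
Proof.
move=> hp ij x y xy; rewrite /cut_weight.
apply: (congr1 (Num.max 0%R)); apply: eq_kernel_weight => k l ik lj.
apply: G_local; apply: agree_on_sub xy => s /=.
rewrite !in_itv/= => /andP[s1 s2].
by rewrite (le_trans (hp _ _ ik))// (le_trans s2)// hp.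
Qed.

Let itv_le (a b s : R) : s \in `[a, b] -> (s <= b)%R.
Proof. by rewrite in_itv/= => /andP[]. Qed.

Let itv_ge (a b s : R) : s \in `[a, b] -> (a <= s)%R.
Proof. by rewrite in_itv/= => /andP[]. Qed.

Let GE x a b := (G x a b)%:E.
Let mGE a b : measurable_fun setT (fun x => GE x a b).
Proof. by apply/measurable_EFinP; exact: mG. Qed.
Let GE_ge0 x a b : 0 <= GE x a b. Proof. by rewrite lee_fin. Qed.
Let GE_local a b : local `[a, b] (fun x => GE x a b).
Proof. by move=> x y xy; rewrite /GE (G_local xy). Qed.

(** Independence applied twice: first the increments in [[b, c]] against those outside, then those
    in [[a, b]] against those after [c]. *)
Lemma integral_gibbs_product a b c e (phi : cpath R d -> \bar R) :
  (a <= b)%R -> (b <= c)%R -> (c <= e)%R ->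
  measurable_fun setT phi -> (forall x, 0 <= phi x) -> local `[b, c] phi ->
  \int[W]_x ((G x a b)%:E * phi x * (G x c e)%:E) =
  (part (b - a))%:E * \int[W]_x phi x * (part (e - c))%:E.
Proof.
move=> ab bc ce mphi phi0 lphi.
transitivity (\int[W]_x (phi x * (GE x a b * GE x c e))).
  by apply: eq_integral => x _; rewrite (muleC (G x a b)%:E) muleA.
have mH : measurable_fun setT (fun x => GE x a b * GE x c e).
  by apply: emeasurable_funM; exact: mGE.
have H0 x : 0 <= GE x a b * GE x c e by apply: mule_ge0; exact: GE_ge0.
have phiE x y : phi (glue b c x y) = phi x by apply: local_glue lphi _.
have HE x y : GE (glue b c x y) a b * GE (glue b c x y) c e = GE y a b * GE y c e.
  rewrite (local_glue_left _ _ bc (@GE_local a b)); last by move=> s; exact: itv_le.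
  by rewrite (local_glue_right _ _ bc (@GE_local c e)); last by move=> s; exact: itv_ge.
have abE x y : GE (glue a b x y) a b = GE x a b by apply: (local_glue _ _ (@GE_local a b)).
have ceE x y : GE (glue a b x y) c e = GE y c e.
  by apply: (local_glue_right _ _ ab (@GE_local c e)) => s /itv_ge; exact: le_trans.
rewrite (integral_indep hW bc mphi phi0 mH H0 phiE HE).
rewrite (integral_indep hW ab (mGE _ _) (fun x => GE_ge0 x _ _) (mGE _ _) (fun x => GE_ge0 x _ _) abE ceE).
by rewrite (int_G ab) (int_G ce) muleA (muleC (\int[W]_x phi x)).
Qed.

Lemma ae_le_integral (f g : cpath R d -> R) :
  measurable_fun setT f -> measurable_fun setT g ->
  (forall x, (0 <= f x)%R) -> (forall x, (0 <= g x)%R) ->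
  (forall x, good x -> (f x <= g x)%R) -> \int[W]_x (f x)%:E <= \int[W]_x (g x)%:E.
Proof.
move=> mf mg f0 g0 fg; apply: ae_ge0_le_integral => //.
- by move=> x _; rewrite lee_fin.
- exact/measurable_EFinP.
- by move=> x _; rewrite lee_fin.
- exact/measurable_EFinP.
by apply: filterS ae_good => x gx _; rewrite lee_fin fg.
Qed.

Lemma part_ge1 T : (0 <= T)%R -> (1 <= part T)%R.
Proof.
move=> T0; rewrite -lee_fin -(subr0 T) -int_G//.
have -> : 1 = \int[W]_x 1%R%:E by rewrite integral_cst//= probability_setT mule1.
apply: ae_le_integral; [exact: measurable_cst|exact: mG|by []|by []|].
by move=> x gx; exact: G_ge1.
Qed.

Lemma part0 : part 0 = 1%R.
Proof.
apply: EFin_inj; rewrite -(subrr 0%R) -int_G//.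
under eq_integral do rewrite G_aa.
by rewrite integral_cst//= probability_setT mule1.
Qed.

Lemma part_super s t : (0 <= s)%R -> (0 <= t)%R -> (part s * part t <= part (s + t))%R.
Proof.
move=> s0 t0; have st : (s <= s + t)%R by rewrite lerDl.
have := integral_gibbs_product (lexx 0%R) s0 st (mGE 0%R s) (fun x => GE_ge0 x _ _)
   (@GE_local 0%R s).
rewrite /GE (int_G s0) subrr part0 mul1e subr0 (addrC s) addrK -EFinM => h.
rewrite -lee_fin -h -[in leRHS](subr0 (t + s)%R) -int_G ?addr_ge0//.
apply: (@ae_le_integral (fun x => G x 0 0 * G x 0 s * G x s (t + s)))%R.
- by apply: measurable_funM; [apply: measurable_funM|]; exact: mG.
- exact: mG.
- by move=> x; rewrite !mulr_ge0.
- by move=> x.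
move=> x gx; rewrite G_aa mul1r (addrC t).
by have := G_super gx s0 (lexx s) st; rewrite G_aa mulr1.
Qed.

Definition kmass (p : nat -> R) i j (A : set (cpath R d)) : R :=
  fine (\int[W]_(x in A) (cut_weight p i j x)%:E).

Lemma kmass_ge0 p i j (A : set (cpath R d)) : (0 <= kmass p i j A)%R.
Proof. by apply/fine_ge0/integral_ge0 => x _; rewrite lee_fin cut_weight_ge0. Qed.

Section chain.
Variable p : nat -> R.
Hypothesis hp : {homo p : m n / (m <= n)%N >-> (m <= n)%R}.

Lemma cut_weight_le i j x : (i < j)%N -> good x -> (cut_weight p i j x <= G x (p i) (p j))%R.
Proof.
move=> ij fx; rewrite cut_weightE// kernelE// gerBl big_nat_cond.
apply: sumr_ge0 => k /andP[/andP[ik kj] _]; apply: mulr_ge0; last exact: G_ge0.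
exact: (kernel_ge0 (G_ge1 fx) (G_aa x) (G_super fx) hp ik).
Qed.

Lemma measurable_EFin_cut_weight i j (D : set (cpath R d)) :
  measurable_fun D (fun x => (cut_weight p i j x)%:E).
Proof. by apply: measurable_funTS; apply/measurable_EFinP; exact: measurable_cut_weight. Qed.

Lemma integral_cut_weight_lty i j (A : set (cpath R d)) : (i < j)%N -> measurable A ->
  \int[W]_(x in A) (cut_weight p i j x)%:E < +oo.
Proof.
move=> ij mA; apply: (@le_lt_trans _ _ (\int[W]_x (cut_weight p i j x)%:E)).
  apply: ge0_subset_integral => //; first exact: measurable_EFin_cut_weight.
  by move=> x _; rewrite lee_fin cut_weight_ge0.
apply: (@le_lt_trans _ _ (\int[W]_x (G x (p i) (p j))%:E)); last first.
  by rewrite int_G ?ltry// hp// ltnW.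
apply: ae_le_integral => //; first exact: measurable_cut_weight.
  by move=> x; exact: cut_weight_ge0.
by move=> x; exact: cut_weight_le.
Qed.

Lemma kmassE i j (A : set (cpath R d)) : (i < j)%N -> measurable A ->
  \int[W]_(x in A) (cut_weight p i j x)%:E = (kmass p i j A)%:E.
Proof.
move=> ij mA; rewrite /kmass fineK// ge0_fin_numE ?integral_cut_weight_lty//.
by apply: integral_ge0 => x _; rewrite lee_fin cut_weight_ge0.
Qed.

Lemma kmass_le i j (A B : set (cpath R d)) : (i < j)%N -> measurable A -> measurable B ->
  A `<=` B -> (kmass p i j A <= kmass p i j B)%R.
Proof.
move=> ij mA mB AB; rewrite -lee_fin -!kmassE//.
apply: ge0_subset_integral => //; first exact: measurable_EFin_cut_weight.
by move=> x _; rewrite lee_fin cut_weight_ge0.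
Qed.

(** The event lives in the cell from [p s] to [p s.+1], which the block from [p k] to [p l]
    contains; it can be absorbed into the local factor of [integral_gibbs_product]. *)
Lemma integral_term i s j k l (A : set (cpath R d)) :
  (i <= k <= s)%N -> (s < l <= j)%N -> measurable A -> local `[p s, p s.+1] A ->
  \int[W]_(x in A) ((G x (p i) (p k))%:E * (cut_weight p k l x)%:E * (G x (p l) (p j))%:E) =
  (part (p k - p i) * kmass p k l A * part (p j - p l))%:E.
Proof.
move=> /andP[ik ks] /andP[sl lj] mA lA.
have kl : (k < l)%N by apply: leq_ltn_trans sl.
pose phi := (fun x => (cut_weight p k l x)%:E) \_ A.
have mphi : measurable_fun setT phi.
  by apply/(measurable_restrictT _ mA); exact: measurable_EFin_cut_weight.
have phi0 x : 0 <= phi x by rewrite /phi/patch; case: ifP => // _; rewrite lee_fin cut_weight_ge0.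
have lphi : local `[p k, p l] phi.
  move=> x y xy; rewrite /phi /patch.
  have -> : (x \in A) = (y \in A).
    apply/idP/idP => /set_mem h; apply/mem_set; move: h; rewrite (lA x y)//;
    by apply: agree_on_sub xy => u /=; rewrite !in_itv/= => /andP[u1 u2];
      rewrite (le_trans (hp ks))// (le_trans u2)// hp.
  by rewrite (local_cut_weight hp kl xy).
have := @integral_gibbs_product (p i) (p k) (p l) (p j) phi (hp ik) (hp (ltnW kl)) (hp lj)
  mphi phi0 lphi.
have -> : \int[W]_x phi x = (kmass p k l A)%:E by rewrite -kmassE// -integral_mkcond.
rewrite 2!EFinM => <-.
rewrite integral_mkcond; apply: eq_integral => x _; rewrite /phi /patch.
by case: ifP => // _; rewrite mule0 mul0e.
Qed.

Lemma integral_straddle i s j (A : set (cpath R d)) : (i <= s)%N -> (s < j)%N ->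
  measurable A -> local `[p s, p s.+1] A ->
  \int[W]_(x in A) (G x (p i) (p j))%:E =
  (\sum_(i <= k < s.+1) \sum_(s.+1 <= l < j.+1)
     part (p k - p i) * kmass p k l A * part (p j - p l))%:E.
Proof.
move=> is_ sj mA lA.
pose term k l x := (G x (p i) (p k))%:E * (cut_weight p k l x)%:E * (G x (p l) (p j))%:E.
have t0 k l x : 0 <= term k l x.
  by rewrite !mule_ge0 ?lee_fin ?G_ge0 ?cut_weight_ge0.
have mt k l : measurable_fun setT (term k l).
  apply: emeasurable_funM; last exact/measurable_EFinP.
  by apply: emeasurable_funM; [exact/measurable_EFinP|exact: measurable_EFin_cut_weight].
rewrite (ge0_ae_eq_integral (g := fun x => \sum_(i <= k < s.+1) \sum_(s.+1 <= l < j.+1) term k l x))//; last 5 first.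
- by apply: measurable_funTS; exact/measurable_EFinP.
- apply: measurable_funTS; apply: emeasurable_sum => k; apply: emeasurable_sum => l; exact: mt.
- by move=> x _; rewrite lee_fin.
- by move=> x _; apply: sume_ge0 => k _; apply: sume_ge0 => l _.
- apply: filterS ae_good => x gx _ /=.
  rewrite (straddling_cut (G_aa x) p is_ sj) -sumEFin.
  apply: eq_big_nat => k /andP[ik ks]; rewrite -sumEFin; apply: eq_big_nat => l /andP[sl lj].
  by rewrite /term 2!EFinM cut_weightE// (leq_trans ks).
rewrite ge0_integral_sum//; last 2 first.
- by move=> k; apply: measurable_funTS; apply: emeasurable_sum => l; exact: mt.
- by move=> k x _; apply: sume_ge0 => l _.
rewrite -sumEFin; apply: eq_big_nat => k /andP[ik ks].
rewrite ge0_integral_sum//; last by move=> l; apply: measurable_funTS; exact: mt.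
rewrite -sumEFin; apply: eq_big_nat => l /andP[sl lj].
by rewrite (@integral_term i s j)// ?ik ?sl.
Qed.

End chain.

Lemma kmass_extend (p q : nat -> R) i j : {homo p : m n / (m <= n)%N >-> (m <= n)%R} ->
  {homo q : m n / (m <= n)%N >-> (m <= n)%R} ->
  (i < j)%N -> (forall k, (i < k < j)%N -> p k = q k) -> (q i <= p i)%R -> (p j <= q j)%R ->
  (kmass p i j setT <= kmass q i j setT)%R.
Proof.
move=> hp hq ij pq qi pj; rewrite -lee_fin -!kmassE//.
apply: ae_le_integral; try exact: measurable_cut_weight; try exact: cut_weight_ge0.
move=> x gx; rewrite !cut_weightE//.
exact: (kernel_extend (G_ge1 gx) (G_aa x) (G_super gx) hp hq ij).
Qed.

Lemma kmass_eq p q i l (A : set (cpath R d)) :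
  (forall k, (k <= l)%N -> p (i + k)%N = q k) -> kmass p i (i + l) A = kmass q 0 l A.
Proof.
move=> pq; rewrite /kmass; congr fine; apply: eq_integral => x _.
rewrite /cut_weight kernel_reindex; congr (Num.max 0 _)%:E.
by apply: eq_kernel => k /andP[_ kl]; exact: pq.
Qed.

Lemma kmass_translate q c l : kmass (fun k => q k + c)%R 0 l setT = kmass q 0 l setT.
Proof.
rewrite /kmass; congr fine.
rewrite -(integral_path_shift hW c (f := fun x => (cut_weight q 0 l x)%:E)); last 2 first.
- by apply/measurable_EFinP; exact: measurable_cut_weight.
- by move=> x; rewrite lee_fin cut_weight_ge0.
apply: eq_integral => x _; rewrite /cut_weight -kernel_translate.
congr (Num.max 0 _)%:E; apply: eq_kernel_weight => k m _ _.
by rewrite G_shift.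
Qed.

(** The straddling expansion of the full space at the last cell: the only possible first cut after
    it is the endpoint. *)
Lemma part_last_cut p i j : {homo p : m n / (m <= n)%N >-> (m <= n)%R} -> (i < j)%N ->
  (part (p j - p i) = \sum_(i <= k < j) part (p k - p i) * kmass p k j setT)%R.
Proof.
case: j => // j hp; rewrite ltnS => ij; apply: EFin_inj.
rewrite -int_G; last by apply: hp; exact: leqW.
rewrite (@integral_straddle p hp i j j.+1)//; congr EFin; apply: eq_bigr => k _.
by rewrite big_nat1 subrr part0 mulr1.
Qed.

(** * The grid of step [h] and the limit in its central cell *)

Section grid.
Variables (lam delta h : R).
Hypothesis lam0 : (0 <= lam)%R.
Hypothesis delta0 : (0 < delta)%R.
Hypothesis h0 : (0 < h)%R.
Hypothesis part_bd : forall t, (0 <= t -> delta <= part t * expR (- (lam * t)) <= 1)%R.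
Local Open Scope ring_scope.

Definition norm_part t := part t * expR (- (lam * t)).
Definition step_mass j := kmass (fun k => k%:R * h) 0 j setT * expR (- (lam * (j%:R * h))).

Lemma step_mass_ge0 j : 0 <= step_mass j.
Proof. by rewrite mulr_ge0 ?expR_ge0 ?kmass_ge0. Qed.

Lemma grid_homo c : {homo (fun k => k%:R * h + c) : m n / (m <= n)%N >-> m <= n}.
Proof. by move=> m n mn; rewrite lerD2r ler_wpM2r ?ler_nat ?ltW. Qed.

Lemma grid_homo0 : {homo (fun k => k%:R * h) : m n / (m <= n)%N >-> m <= n}.
Proof. by move=> m n mn; rewrite ler_wpM2r ?ler_nat ?ltW. Qed.

Lemma step_mass1 : 0 < step_mass 1.
Proof.
rewrite mulr_gt0 ?expR_gt0//.
have := part_last_cut grid_homo0 (ltnSn 0).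
rewrite big_nat1 subrr part0 mul1r => <-.
by rewrite (lt_le_trans ltr01)// part_ge1// subr_ge0 grid_homo0.
Qed.

(** The grid is aligned with the right end [t], so only the leftmost cell is shortened. Blocks
    avoiding that cell are translates of standard ones. The defect is the block covering all of
    [[0, t]], dominated by a full block of [r] cells; the length difference of at most [h] gives the
    factor [expR (lam * h)]. *)
Lemma norm_part_renewal t r : 0 <= t -> t < r%:R * h -> r%:R * h <= t + h ->
  exists2 dd, 0 <= dd <= expR (lam * h) * step_mass r &
    norm_part t = \sum_(1 <= j < r) step_mass j * norm_part (t - j%:R * h) + dd.
Proof.
move=> t0; case: r => [|r]; first by rewrite mul0r ltNge t0.
move=> tr rt.
pose q k := k%:R * h + (t - r.+1%:R * h); pose p k := Num.max 0 (q k).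
have hq : {homo q : m n / (m <= n)%N >-> m <= n} by exact: grid_homo.
have hp : {homo p : m n / (m <= n)%N >-> m <= n}.
  by move=> m n mn; rewrite /p ge_max !le_max lexx/= hq// orbT.
have p0 : p 0%N = 0 by rewrite /p /q mul0r add0r max_l// subr_le0 ltW.
have pS k : p k.+1 = q k.+1.
  rewrite /p max_r// (le_trans _ (hq 1%N k.+1 _))// /q mul1r; lra.
have pr : p r.+1 = t by rewrite pS /q addrC subrK.
have pj j : (j <= r)%N -> p (r.+1 - j)%N = t - j%:R * h.
  by move=> jr; rewrite subSn// pS /q -subSn// natrB ?leqW//; ring.
have km j : (0 < j)%N -> (j <= r)%N ->
    kmass p (r.+1 - j) r.+1 setT = kmass (fun k => k%:R * h) 0 j setT.
  move=> j0 jr; rewrite -(kmass_translate _ (t - j%:R * h)).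
  rewrite -[X in kmass p _ X](@subnK j r.+1) ?leqW//; apply: kmass_eq => k kj.
  rewrite subSn// addSn pS /q -addSn -subSn// natrD natrB ?leqW//; ring.
exists (kmass p 0 r.+1 setT * expR (- (lam * t))).
  rewrite mulr_ge0 ?kmass_ge0 ?expR_ge0//= /step_mass mulrCA -expRD.
  apply: ler_pM; rewrite ?kmass_ge0 ?expR_ge0//.
    rewrite -(kmass_translate (fun k => k%:R * h) (t - r.+1%:R * h)).
    apply: kmass_extend => //; rewrite ?p0 ?pr.
    - by case.
    - by rewrite mul0r add0r subr_le0 ltW.
    - by rewrite addrC subrK.
  by rewrite ler_expR -mulrBr -mulrN ler_wpM2l//; lra.
have := part_last_cut hp (ltn0Sn r); rewrite pr p0 subr0.
rewrite big_ltn// p0 subrr part0 mul1r /norm_part => ->.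
rewrite mulrDl addrC; congr (_ + _); rewrite mulr_suml big_nat_rev/=.
apply: eq_big_nat => j /andP[j0 jr].
rewrite add1n subSS pj// km// /step_mass.
have -> : - (lam * t) = - (lam * (j%:R * h)) - lam * (t - j%:R * h) by ring.
rewrite expRD subr0; ring.
Qed.

Lemma step_mass_sum_le1 n : \sum_(1 <= j < n) step_mass j <= 1.
Proof.
exact: (renewal_mass_le1 h0 delta0 part_bd step_mass_ge0 step_mass1 (expR_ge0 _) norm_part_renewal).
Qed.

Lemma norm_part_increment eps : 0 < eps ->
  exists t0, forall t, t0 <= t -> `|norm_part (t + h) - norm_part t| <= eps.
Proof.
exact: (renewal_increment_cvg0 h0 delta0 part_bd step_mass_ge0 step_mass1 (expR_ge0 _) norm_part_renewal).
Qed.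

(* Its point of index [a] is [- (h / 2)], so that a block from index [0] to
   [(a + b).+1] straddles the cell [[- (h / 2), h / 2]]. *)
Definition window_chain a k := k%:R * h + (- (a%:R * h) - h / 2).
Definition window_mass a b A :=
  kmass (window_chain a) 0 (a + b).+1 A * expR (- (lam * ((a + b).+1%:R * h))).

Lemma window_mass_ge0 a b A : 0 <= window_mass a b A.
Proof. by rewrite mulr_ge0 ?expR_ge0 ?kmass_ge0. Qed.

Lemma window_massT a b : window_mass a b setT = step_mass (a + b).+1.
Proof. by rewrite /window_mass kmass_translate. Qed.

Lemma window_mass_le a b A : measurable A -> window_mass a b A <= step_mass (a + b).+1.
Proof.
move=> mA; rewrite -window_massT ler_wpM2r ?expR_ge0//.
by apply: (kmass_le (grid_homo _)) => //; exact: subsetT.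
Qed.

Lemma sum_straddle r (f : nat -> nat -> R) :
  \sum_(0 <= k < r.+1) \sum_(r.+1 <= l < (r.*2.+1).+1) f k l =
  \sum_(0 <= a < r.+1) \sum_(0 <= b < r.+1) f (r - a)%N (r + b).+1.
Proof.
rewrite big_nat_rev/=; apply: eq_big_nat => a /andP[_ ar].
rewrite add0n subSS -{1}[r.+1]add0n big_addn -addnn.
have -> : ((r + r).+2 - r.+1 = r.+1)%N by lia.
by apply: eq_big_nat => b _; congr (f _ _); lia.
Qed.

(** The centred grid is clipped to [[-T, T]]. Blocks that touch neither end are translates of
    [window_mass] blocks, with exact coefficients. The others make up [D]: they have between [r.+1]
    and [r.*2.+1] cells, and the left and right boundary families account for the factor [2]. *)
Lemma window_expansion T r A : (0 < r)%N -> r%:R * h <= T + h / 2 -> T + h / 2 < r.+1%:R * h ->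
  measurable A -> local `[- (h / 2), h / 2] A ->
  exists2 D, 0 <= D <= expR (lam * (2 * h)) * (2 * \sum_(r.+1 <= m < r.*2.+2) step_mass m) &
  (\int[W]_(x in A) (G x (- T) T)%:E)%E =
  (expR (lam * (2 * T)) * (\sum_(0 <= a < r) \sum_(0 <= b < r)
     norm_part (T - a%:R * h - h / 2) * norm_part (T - b%:R * h - h / 2) * window_mass a b A + D))%:E.
Proof.
move=> r0 rT Tr mA lA; have h2 : 0 < h / 2 by rewrite divr_gt0.
have rr : (r <= r.*2)%N by rewrite -addnn leq_addr.
have rr1 : (r < r.*2)%N by rewrite -addnn -{1}[r]addn0 ltn_add2l.
have rr2 : (r.*2.+2 - r.+1 = r.+1)%N by rewrite subSS -addnn subSn ?leq_addr// addnK.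
pose q k := k%:R * h + (- (r%:R * h) - h / 2).
pose p k := Num.max (- T) (Num.min T (q k)).
have T0 : 0 <= T.
  have : 1%:R * h <= r%:R * h by rewrite ler_wpM2r ?ler_nat ?ltW.
  by rewrite mul1r => /le_trans/(_ rT); lra.
have TT : - T <= T by lra.
have hq : {homo q : m n / (m <= n)%N >-> m <= n} by exact: grid_homo.
have hp : {homo p : m n / (m <= n)%N >-> m <= n}.
  move=> m n mn; rewrite /p ge_max !le_max lexx/=; apply/orP; right.
  by rewrite le_min !ge_min lexx hq ?orbT.
have rS : r.+1%:R * h = r%:R * h + h by rewrite -natr1 mulrDl mul1r.
rewrite rS in Tr.
have q0 : q 0%N < - T by rewrite /q mul0r; lra.
have q2r : T < q (r.*2.+1).
  rewrite /q -addnn -natr1 natrD !mulrDl mul1r; lra.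
have q1 : - T <= q 1%N by rewrite /q mul1r; lra.
have qr2 : q r.*2 <= T.
  by rewrite /q -addnn natrD !mulrDl; lra.
have pq k : (0 < k)%N -> (k <= r.*2)%N -> p k = q k.
  move=> k0 kr; have h1 := hq _ _ k0; have h3 := hq _ _ kr.
  by rewrite /p min_r ?max_r//; [exact: le_trans h1|exact: le_trans qr2].
have p0 : p 0%N = - T by rewrite /p min_r ?max_l// ltW// (lt_le_trans q0).
have p2 : p r.*2.+1 = T by rewrite /p min_l ?max_r// ltW.
have pr : p r = - (h / 2).
  by rewrite pq// /q; lra.
have prS : p r.+1 = h / 2.
  by rewrite pq// /q rS; lra.
have qp k : (k <= r)%N -> q k <= p k.
  case: k => [_|k kr]; first by rewrite p0 ltW.
  by rewrite pq// (leq_trans kr).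
have pql l : (r < l)%N -> (l <= r.*2.+1)%N -> p l <= q l.
  move=> rl; rewrite leq_eqVlt => /predU1P[->|]; first by rewrite p2 ltW.
  by rewrite ltnS => l2; rewrite pq// (leq_trans _ rl).
have pT m : - T <= p m <= T by rewrite /p le_max lexx/= ge_max TT ge_min lexx.
clearbody p.
pose F k l := part (p k + T) * kmass p k l A * part (T - p l) * expR (- (lam * (2 * T))).
have F0 k l : 0 <= F k l.
  rewrite !mulr_ge0 ?expR_ge0 ?kmass_ge0// (le_trans ler01)// part_ge1//.
    by have /andP[] := pT k; lra.
  by have /andP[] := pT l; lra.
(* Extending a clipped block to full cells only increases its mass, and changes its length by at
   most [h] at each end, whence the factor [expR (lam * (2 * h))]. *)
have F_le k l : (k <= r)%N -> (r < l)%N -> (l <= r.*2.+1)%N ->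
    F k l <= expR (lam * (2 * h)) * step_mass (l - k).
  move=> kr rl lr; have kl : (k < l)%N by exact: leq_ltn_trans rl.
  have km : kmass p k l A <= kmass (fun k => k%:R * h) 0 (l - k) setT.
    apply: (@le_trans _ _ (kmass p k l setT)); first by apply: kmass_le.
    apply: (@le_trans _ _ (kmass q k l setT)).
      apply: kmass_extend => //; [|exact: qp|exact: pql].
      by move=> m /andP[km ml]; apply: pq; [exact: leq_ltn_trans km|rewrite -ltnS (leq_trans ml)].
    rewrite -(kmass_translate _ (q k)) -{1}(subnKC (ltnW kl)) (@kmass_eq q (fun m => m%:R * h + q k))//.
    by move=> m _; rewrite /q natrD; ring.
  have pk : 0 <= p k + T by rewrite -[T]opprK -p0 subr_ge0 hp.
  have pl : 0 <= T - p l by rewrite -p2 subr_ge0 hp.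
  have -> : F k l = norm_part (p k + T) * norm_part (T - p l) *
      (kmass p k l A * expR (- (lam * (p l - p k)))).
    rewrite /F /norm_part.
    have -> : - (lam * (2 * T)) = - (lam * (p k + T)) - lam * (T - p l) - lam * (p l - p k) by ring.
    by rewrite !expRD; ring.
  have /andP[u1 u2] := part_bd pk; have /andP[v1 v2] := part_bd pl.
  have uv : norm_part (p k + T) * norm_part (T - p l) <= 1.
    by rewrite mulr_ile1//; apply: le_trans (ltW delta0) _.
  apply: (@le_trans _ _ (kmass p k l A * expR (- (lam * (p l - p k))))).
    by rewrite ler_piMl// mulr_ge0 ?kmass_ge0 ?expR_ge0.
  rewrite /step_mass mulrCA -expRD; apply: ler_pM; rewrite ?kmass_ge0 ?expR_ge0//.
  rewrite ler_expR -mulrBr -mulrN; apply: (ler_wpM2l lam0); rewrite natrB 1?ltnW//.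
  have : q l - h <= p l.
    case: (ltnP r.*2 l) => l2; last by rewrite pq ?(leq_trans _ rl)//; lra.
    have -> : l = r.*2.+1 by apply/eqP; rewrite eqn_leq lr l2.
    rewrite p2; apply: le_trans qr2; rewrite /q -natr1 mulrDl; lra.
  have : p k <= q k + h.
    case: (posnP k) => [->|k0]; last by rewrite pq ?(leq_trans kr)//; lra.
    by rewrite p0 (le_trans q1)// /q mul0r mul1r; lra.
  rewrite /q mulrBl; lra.
(* Blocks starting at the left end, including the one that spans everything, then blocks that reach
   the right end only. *)
exists (\sum_(0 <= b < r.+1) F 0%N (r + b).+1 + \sum_(0 <= a < r) F (r - a)%N r.*2.+1).
  apply/andP; split; first by rewrite addr_ge0// sumr_ge0.
  rewrite mulrCA mulr2n mulrDl mul1r -[r.+1 in X in _ <= X]add0n big_addn rr2 mulr_sumr.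
  apply: lerD.
    apply: ler_sum_nat => b /andP[_ br].
    have := F_le 0%N (r + b).+1 (leq0n r); rewrite subn0 addnC -addnS.
    by apply; rewrite ?ltnS ?leq_addl// addnS ltnS -addnn leq_add2r.
  apply: (@le_trans _ _ (\sum_(0 <= a < r.+1) F (r - a)%N r.*2.+1)).
    by rewrite [leRHS]big_nat_recr//= lerDl.
  apply: ler_sum_nat => b /andP[_ br].
  have := F_le (r - b)%N r.*2.+1 (leq_subr _ _).
  have -> : (r.*2.+1 - (r - b) = b + r.+1)%N.
    by rewrite -addnn -addSn -addnBA ?leq_subr// subKn// addnC.
  by apply; rewrite ?ltnS.
rewrite -{1}p0 -{1}p2 (integral_straddle hp (leq0n r))//; last by rewrite pr prS.
have FE k l : part (p k - - T) * kmass p k l A * part (T - p l) = expR (lam * (2 * T)) * F k l.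
  by rewrite /F opprK [RHS]mulrCA -expRD subrr expR0 mulr1.
rewrite p0 p2; congr EFin; rewrite sum_straddle.
under eq_bigr => a _ do under eq_bigr => b _ do rewrite FE.
under eq_bigr => a _ do rewrite -mulr_sumr.
rewrite -mulr_sumr; congr (_ * _).
rewrite big_nat_recr//= subnn addrA [LHS]addrC [RHS]addrAC [RHS]addrC; congr (_ + _).
rewrite -big_split/=; apply: eq_big_nat => a /andP[_ ar].
rewrite big_nat_recr//= addnn; congr (_ + _); apply: eq_big_nat => b /andP[_ br].
have pra : p (r - a)%N = - (a%:R * h) - h / 2.
  rewrite pq ?subn_gt0//; last by rewrite (leq_trans (leq_subr _ _)).
  by rewrite /q natrB 1?ltnW//; ring.
have prb : p (r + b).+1 = b%:R * h + h / 2.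
  rewrite pq//; last by rewrite -addnS -addnn leq_add2l.
  by rewrite /q -natr1 natrD; field.
rewrite /F /norm_part /window_mass pra prb.
have -> : kmass p (r - a) (r + b).+1 A = kmass (window_chain a) 0 (a + b).+1 A.
  have -> : (r + b).+1 = (r - a + (a + b).+1)%N by rewrite addnS addnA subnK// ltnW.
  apply: kmass_eq => k kab.
  have rk : (r - a + k <= r.*2)%N.
    apply: (@leq_trans (r - a + (a + b).+1)%N); first by rewrite leq_add2l.
    by rewrite addnS addnA (subnK (ltnW ar)) -addnS -addnn leq_add2l.
  rewrite pq// ?addn_gt0 ?subn_gt0 ?ar//.
  by rewrite /q /window_chain natrD natrB 1?ltnW//; ring.
have -> : - (a%:R * h) - h / 2 + T = T - a%:R * h - h / 2 by ring.
have -> : T - (b%:R * h + h / 2) = T - b%:R * h - h / 2 by ring.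
have abE : (a + b).+1%:R = a%:R + b%:R + 1 :> R by rewrite -natrD natr1.
have -> : - (lam * (2 * T)) = - (lam * (T - a%:R * h - h / 2)) - lam * (T - b%:R * h - h / 2)
    - lam * ((a + b).+1%:R * h) by rewrite abE; field.
by rewrite !expRD; ring.
Qed.

(** Truncation of the limiting density before division by [window_total]: the indices count the
    cells by which the no-cut block extends to the left and to the right of the window. *)
Definition window_density L x := square_sum L (fun a b =>
  cut_weight (window_chain a) 0 (a + b).+1 x * expR (- (lam * ((a + b).+1%:R * h)))).

Lemma window_density_ge0 L x : 0 <= window_density L x.
Proof. by apply: square_sum_ge0 => a b _ _; rewrite mulr_ge0 ?expR_ge0 ?cut_weight_ge0. Qed.

Lemma measurable_window_density L : measurable_fun setT (window_density L).
Proof.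
do 2!(apply: measurable_fun_seq_sum => ?); apply: measurable_funM => //.
exact: measurable_cut_weight.
Qed.

Lemma integral_window_density L A : measurable A ->
  (\int[W]_(x in A) (window_density L x)%:E = (square_sum L (fun a b => window_mass a b A))%:E)%E.
Proof.
move=> mA; pose term a b x :=
  cut_weight (window_chain a) 0 (a + b).+1 x * expR (- (lam * ((a + b).+1%:R * h))).
have t0 a b x : 0 <= term a b x by rewrite mulr_ge0 ?expR_ge0 ?cut_weight_ge0.
have mt a b : measurable_fun setT (term a b).
  by apply: measurable_funM => //; exact: measurable_cut_weight.
under eq_integral do rewrite /window_density /square_sum -sumEFin.
rewrite ge0_integral_sum//; last 2 first.
- move=> a; apply: measurable_funTS; apply/measurable_EFinP.
  by apply: measurable_fun_seq_sum => b; exact: mt.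
- by move=> a x _; rewrite lee_fin sumr_ge0// => b _; exact: t0.
rewrite /square_sum -sumEFin; apply: eq_bigr => a _.
under eq_integral do rewrite -sumEFin.
rewrite ge0_integral_sum//; last 2 first.
- by move=> b; apply: measurable_funTS; apply/measurable_EFinP; exact: mt.
- by move=> b x _; rewrite lee_fin; exact: t0.
rewrite -sumEFin; apply: eq_bigr => b _.
under eq_integral do rewrite EFinM muleC.
rewrite ge0_integralZl//; last 2 first.
- by apply: measurable_EFin_cut_weight; exact: grid_homo.
- by move=> x _; rewrite lee_fin cut_weight_ge0.
by rewrite (@kmassE (window_chain a) (grid_homo _) 0 (a + b).+1 A)// -EFinM mulrC.
Qed.

Lemma window_density_mono x : {homo window_density^~ x : m n / (m <= n)%N >-> m <= n}.
Proof.
by move=> m n mn; apply: square_sum_mono => // a b _ _; rewrite mulr_ge0 ?expR_ge0 ?cut_weight_ge0.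
Qed.

Let gibbs_prob T A := fine (\int[W]_(x in A) (G x (- T) T)%:E) / part (2 * T).

Let gibbs_prob_fin T A : 0 <= T -> measurable A ->
  (\int[W]_(x in A) (G x (- T) T)%:E < +oo)%E.
Proof.
move=> T0 mA; apply: (@le_lt_trans _ _ (\int[W]_x (G x (- T) T)%:E)%E).
  by apply: ge0_subset_integral => //; [exact/measurable_EFinP|move=> x _; rewrite lee_fin].
by rewrite int_G ?ltry//; lra.
Qed.

(** The abstract two-sided renewal estimate is uniform over a type of events; this subtype supplies
    measurability and locality to it. *)
Let event := {A : set (cpath R d) | measurable A /\ local `[- (h / 2), h / 2] A}.
Let top : event := exist _ setT (conj measurableT (fun _ _ _ => erefl)).

Let kappa := window_total step_mass.

Let step_bound : (forall A : event, forall a b, 0 <= window_mass a b (sval A)) /\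
  (forall a b (A : event), window_mass a b (sval A) <= step_mass (a + b).+1) /\
  (forall T, 0 <= T -> gibbs_prob T (sval top) = 1) /\
  (forall T r (A : event), (0 < r)%N -> r%:R * h <= T + h / 2 -> T + h / 2 < r.+1%:R * h ->
  exists2 D, 0 <= D <= (expR (lam * (2 * h)) * 2) * \sum_(r.+1 <= m < r.*2.+2) step_mass m &
    norm_part (2 * T) * gibbs_prob T (sval A) = \sum_(0 <= a < r) \sum_(0 <= b < r)
      norm_part (T - a%:R * h - h / 2) * norm_part (T - b%:R * h - h / 2) *
      window_mass a b (sval A) + D).
Proof.
split; first by move=> A a b; exact: window_mass_ge0.
split; first by move=> a b [A [mA ?]]; exact: window_mass_le.
have part_neq0 t : 0 <= t -> part t != 0.
  by move=> t0; rewrite gt_eqF// (lt_le_trans ltr01)// part_ge1.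
split=> [T T0|T r [A [mA lA]] r0 rT Tr].
  rewrite /gibbs_prob int_G/=; last by lra.
  by rewrite (_ : T - - T = 2 * T) ?divff ?part_neq0 ?mulr_ge0//; ring.
have [D Db E] := window_expansion r0 rT Tr mA lA.
exists D; first by rewrite -mulrA.
rewrite /gibbs_prob/= E/=.
have T0 : 0 <= T.
  have : 1%:R * h <= r%:R * h by rewrite ler_wpM2r ?ler_nat// ltW.
  by have := h0; lra.
rewrite [LHS](_ : _ = expR (- (lam * (2 * T))) * expR (lam * (2 * T)) *
  (part (2 * T) / part (2 * T)) * (\sum_(0 <= a < r) \sum_(0 <= b < r)
      norm_part (T - a%:R * h - h / 2) * norm_part (T - b%:R * h - h / 2) *
      window_mass a b A + D)); last by rewrite {1}/norm_part; ring.
by rewrite -expRD addNr expR0 divff ?mul1r// part_neq0// mulr_ge0.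
Qed.

(** The density is the increasing limit of the normalized truncations and has mass one by monotone
    convergence. The uniform lower bound, applied to an event and to its complement, gives a
    two-sided estimate because both laws have total mass one. *)
Lemma window_limit : exists f : cpath R d -> \bar R,
  [/\ measurable_fun setT f, (forall x, (0 <= f x)%E), (\int[W]_x f x = 1)%E &
    forall eps, 0 < eps -> exists T1, forall T A, T1 <= T ->
      measurable A -> local `[- (h / 2), h / 2] A ->
      `|fine (\int[W]_(x in A) (G x (- T) T)%:E) / part (2 * T) -
        fine (\int[W]_(x in A) f x)| <= eps].
Proof.
have [N0 [Nle [Ptop Pexp]]] := step_bound.
have C0 : 0 <= expR (lam * (2 * h)) * 2 by rewrite mulr_ge0 ?expR_ge0.
have Ntop a b : window_mass a b (sval top) = step_mass (a + b).+1 by exact: window_massT.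
have k0 : 0 < kappa.
  exact: (@window_total_gt0 R event h delta _ norm_part step_mass
    (fun a b A => window_mass a b (sval A)) top (fun T A => gibbs_prob T (sval A))
    h0 delta0 part_bd step_mass_ge0 step_mass1 Ntop Ptop Pexp).
have Scvg : square_sum L (fun a b => step_mass (a + b).+1) @[L --> \oo] --> kappa.
  exact: (@square_sum_cvg R event h delta _ norm_part step_mass
    (fun a b A => window_mass a b (sval A)) top (fun T A => gibbs_prob T (sval A))
    h0 delta0 part_bd step_mass_ge0 Ntop Ptop Pexp).
have lower := @window_lower_bound R event h delta _ norm_part step_mass
    (fun a b A => window_mass a b (sval A)) top (fun T A => gibbs_prob T (sval A))
    h0 delta0 part_bd norm_part_increment step_mass_ge0
    step_mass_sum_le1 step_mass1 C0 (fun a b A => N0 A a b) Nle Ntop Ptop Pexp.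
pose g L x : \bar R := (kappa^-1 * window_density L x)%:E.
have k1 : 0 <= kappa^-1 by rewrite invr_ge0 ltW.
have mg L : measurable_fun setT (g L).
  by apply/measurable_EFinP; apply: measurable_funM => //; exact: measurable_window_density.
have g0 L x : setT x -> (0 <= g L x)%E by rewrite lee_fin mulr_ge0 ?window_density_ge0.
have gmono x : setT x -> {homo g^~ x : m n / (m <= n)%N >-> (m <= n)%E}.
  by move=> _ m n mn; rewrite lee_fin ler_wpM2l// window_density_mono.
have intg L A : measurable A -> (\int[W]_(x in A) g L x =
    (kappa^-1 * square_sum L (fun a b => window_mass a b A))%:E)%E.
  move=> mA; under eq_integral do rewrite /g EFinM.
  rewrite ge0_integralZl ?integral_window_density//.
  - by apply: measurable_funTS; apply/measurable_EFinP; exact: measurable_window_density.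
  - by move=> x _; rewrite lee_fin window_density_ge0.
pose f x := limn (g^~ x).
have gf x : g^~ x @ \oo --> f x by exact: ereal_nondecreasing_is_cvgn (gmono x I).
have g_le L x : (g L x <= f x)%E.
  apply: lime_ge (gf x) _; near=> n; apply: gmono => //; near: n; exact: nbhs_infty_ge.
have mf : measurable_fun setT f by apply: (emeasurable_fun_cvg g) => // x _; exact: gf.
have f0 x : (0 <= f x)%E by apply: le_trans (g_le 0%N x); exact: g0.
have f1 : (\int[W]_x f x = 1)%E.
  rewrite (@monotone_convergence _ _ R W setT measurableT g mg g0 gmono).
  have cv : (kappa^-1 * square_sum L (fun a b => step_mass (a + b).+1)) @[L --> \oo] --> kappa^-1 * kappa.
    by apply: cvgM Scvg; exact: cvg_cst.
  rewrite mulVf ?gt_eqF// in cv.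
  apply: cvg_lim => //; have -> : (fun n => \int[W]_x g n x)%E =
      EFin \o (fun L => kappa^-1 * square_sum L (fun a b => step_mass (a + b).+1)).
    apply/funext => L /=; rewrite intg//; congr (_ * _)%:E.
    by apply: eq_bigr => a _; apply: eq_bigr => b _; exact: window_massT.
  by apply: cvg_EFin cv; exact: nearW.
have fA A : measurable A -> (\int[W]_(x in A) f x)%E \is a fin_num.
  move=> mA; rewrite ge0_fin_numE; last exact: integral_ge0.
  apply: (@le_lt_trans _ _ (\int[W]_x f x)%E); last by rewrite f1 ltry.
  exact: ge0_subset_integral.
have fC A : measurable A -> fine (\int[W]_(x in A) f x)%E + fine (\int[W]_(x in ~` A) f x)%E = 1.
  by move=> mA; rewrite fine_integral_setC// f1// ltry.
have fg L A : measurable A ->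
    square_sum L (fun a b => window_mass a b A) / kappa <= fine (\int[W]_(x in A) f x)%E.
  move=> mA; rewrite mulrC -lee_fin -intg// fineK ?fA//; apply: ge0_le_integral => //.
  - by move=> x _; exact: g0.
  - exact: measurable_funTS.
  - exact: measurable_funTS.
have massC L A : measurable A ->
    square_sum L (fun a b => window_mass a b A) + square_sum L (fun a b => window_mass a b (~` A)) =
    square_sum L (fun a b => step_mass (a + b).+1).
  move=> mA; have mC := measurableC mA.
  rewrite /square_sum -big_split/=; apply: eq_bigr => a _; rewrite -big_split/=; apply: eq_bigr => b _.
  rewrite -window_massT /window_mass -mulrDl; congr (_ * _).
  rewrite /kmass fine_integral_setC//.
  - by apply: measurable_EFin_cut_weight; exact: grid_homo.
  - by move=> x; rewrite lee_fin cut_weight_ge0.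
  - by apply: integral_cut_weight_lty => //; exact: grid_homo.
exists f; split=> // eps eps0.
(* One [e1] comes from the lower bound on the finite-volume probability, and [e1 / kappa] from the
   mass lost by truncating at [L]. *)
pose e1 := eps / (1 + kappa^-1).
have kk : 0 < 1 + kappa^-1 by rewrite ltr_pwDl.
have e10 : 0 < e1 by rewrite divr_gt0.
have [T1 [L [SL low]]] := lower e1 e10.
have main T A : Num.max 0 T1 <= T -> measurable A -> local `[- (h / 2), h / 2] A ->
    fine (\int[W]_(x in A) f x)%E - eps <= gibbs_prob T A.
  rewrite ge_max => /andP[T0 TT] mA lA.
  have := low T (exist _ A (conj mA lA)) TT; rewrite /=; apply: le_trans.
  have := fg L _ (measurableC mA); have := fC _ mA.
  have := massC L _ mA; set M := square_sum L _; set M' := square_sum L _; set SS := square_sum L _ => MM.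
  have -> : M = SS - M' by rewrite -MM addrK.
  move=> fE; rewrite mulrBl => fM.
  have : SS / kappa >= 1 - e1 / kappa.
    by rewrite -(@divff _ kappa) ?gt_eqF// -mulrBl ler_wpM2r//; move: SL; rewrite -/kappa -/SS; lra.
  have : e1 + e1 / kappa = eps by rewrite -{1}[e1]mulr1 -mulrDr divfK// gt_eqF.
  move: fM fE; lra.
exists (Num.max 0 T1) => T A TT mA lA.
have lC : local `[- (h / 2), h / 2] (~` A) by move=> x y xy; rewrite /setC/= (lA x y xy).
have h1 := main T A TT mA lA; have h2 := main T _ TT (measurableC mA) lC.
have h3 := fC A mA.
have : gibbs_prob T A + gibbs_prob T (~` A) = 1.
  move: TT; rewrite ge_max => /andP[T0 _]; rewrite -[RHS](Ptop T T0) /gibbs_prob -mulrDl; congr (_ / _).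
  rewrite fine_integral_setC//.
  - exact/measurable_EFinP.
  - by move=> x; rewrite lee_fin.
  - exact: gibbs_prob_fin.
move: h1 h2 h3; rewrite -/(gibbs_prob T A) ler_norml; lra.
Unshelve. all: by end_near. Qed.

End grid.

(** Densities for different windows come from different grids and need not be related pointwise.
    They agree on common cylinders because their integrals are limits of the same finite-volume
    probabilities. *)
Lemma infinite_volume_exists (C T0 : R) :
  (forall t, (T0 <= t)%R -> (part (2 * t) <= C * part t ^+ 2)%R) ->
  exists Q : probability (cpath R d) R, forall n eps, (0 < eps)%R ->
    exists T1, forall T A, (T1 <= T)%R -> cylinder n A ->
    (`|fine (\int[W]_(x in A) (G x (- T)%R T)%:E) / part (2 * T) - fine (Q A)| <= eps)%R.
Proof.
move=> doubling.
have [lam [delta [lam0 delta0 bd]]] := exponential_growth part_ge1 part_super doubling.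
(* The step is [2 * n.+1] rather than [2 * n], so that it is positive at [n = 0]; the central cell
   [[-(n+1), n+1]] contains the window of radius [n]. *)
have h0 n : (0 < n.+1%:R * 2 :> R)%R by rewrite mulr_gt0.
have [f hf] := choice (fun n => window_limit lam0 delta0 (h0 n) bd).
have cyl (n : nat) (A : set (cpath R d)) : cylinder n A -> measurable A /\ local `[(- (n.+1%:R * 2 / 2))%R, (n.+1%:R * 2 / 2)%R] A.
  move=> [mA lA]; split => //; apply: local_sub lA => s.
  rewrite mulfK// /sym_itv/= !in_itv/= => /andP[s1 s2].
  by rewrite (le_trans _ s1) ?(le_trans s2) ?lerN2 ?ler_nat.
have fin n A : measurable A -> \int[W]_(x in A) f n x \is a fin_num.
  move=> mA; have [mf f0 f1 _] := hf n.
  rewrite ge0_fin_numE; last by apply: integral_ge0.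
  by apply: (@le_lt_trans _ _ (\int[W]_x f n x)); [exact: ge0_subset_integral|rewrite f1 ltry].
have lim n m A : cylinder n A -> cylinder m A ->
    \int[W]_(x in A) f n x = \int[W]_(x in A) f m x.
  move=> nA mA; have [Am ln] := cyl _ _ nA; have [_ lm] := cyl _ _ mA.
  rewrite -(fineK (fin n A Am)) -(fineK (fin m A Am)); congr EFin.
  apply/eqP; rewrite -subr_eq0 -normr_le0; apply/ler_addgt0Pl => eps eps0; rewrite addr0.
  have e2 : (0 < eps / 2)%R by rewrite divr_gt0.
  have [_ _ _ /(_ _ e2)[T1 h1]] := hf n; have [_ _ _ /(_ _ e2)[T2 h2]] := hf m.
  pose T := Num.max T1 T2.
  have := h1 T A (ltac:(by rewrite le_max lexx)) Am ln.
  have := h2 T A (ltac:(by rewrite le_max lexx orbT)) Am lm.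
  move: (fine _) (fine (integral _ _ (f m))) (_ / _)%R => u v p; rewrite !ler_norml; lra.
have [Q hQ] := @extension_exists R d W hW f (fun n => let: And4 mf _ _ _ := hf n in mf)
  (fun n => let: And4 _ f0 _ _ := hf n in f0) (fun n => let: And4 _ _ f1 _ := hf n in f1)
  (fun n B cB => lim n n.+1 B cB (cylinder_le (leqnSn n) cB)).
exists Q => n eps eps0; have [_ _ _ /(_ _ eps0)[T1 h1]] := hf n.
exists T1 => T A TT cA; have [mA lA] := cyl _ _ cA.
by rewrite (hQ _ _ cA); exact: h1.
Qed.

End multiplicative_weight.

Theorem theorem2p2 (R : realType) (d : nat) (hd : (0 < d)%N)
    (W : probability (cpath R d) R) (hW : brownian_increments_law W)
    (alpha : R) (halpha : 0 < alpha)
    (w : R -> 'rV[R]_d -> \bar R)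
    (w_meas : measurable_fun [set p : R * 'rV[R]_d | 0 <= p.1]
                (fun p : R * 'rV[R]_d => w p.1 p.2))
    (w_pos : forall (t : R) (x : 'rV[R]_d), 0 <= t -> (0 < w t x)%E)
    (w_even : forall (t : R) (x : 'rV[R]_d), 0 < t -> w t (- x) = w t x)
    (Z_fin : forall T : R, 0 <= T -> (partition_function W w alpha T < +oo)%E)
    (Z_limsup :
      (limf_esup (fun T : R =>
         (fine (partition_function W w alpha (2 * T)) /
          fine (partition_function W w alpha T) ^+ 2)%:E) (+oo_R)%R < +oo)%E) :
  exists Pinf : probability (cpath R d) R,
    cvg_locally_total_variation (gibbs_measure W w alpha) Pinf.
Proof.
pose part T := fine (partition_function W w alpha T).
have ge1 := gibbs_real_ge1 halpha w_meas w_pos.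
have aeg := ae_finite_energy hW halpha w_meas w_pos Z_fin.
have mG := measurable_gibbs_real alpha w_meas w_pos.
have G0 := gibbs_real_ge0 alpha w.
have int_G : forall a b, a <= b -> (\int[W]_x (gibbs_real alpha w x a b)%:E = (part (b - a))%:E)%E.
  exact: (integral_gibbs_real hW halpha w_meas w_pos Z_fin).
have part1 : forall t, 0 <= t -> 1 <= part t.
  by apply: (part_ge1 aeg mG) => //.
have [C [T0 doubling]] : exists C T0, forall t, T0 <= t -> part (2 * t) <= C * part t ^+ 2.
  move: Z_limsup; rewrite limf_esupE => /ereal_inf_lt[_ [V [M [_ MV]] <-]].
  move=> supV; pose S := ereal_sup [set (part (2 * T) / part T ^+ 2)%:E | T in V].
  (* A finite limsup bounds the ratio on some neighbourhood of infinity, which contains all times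
     strictly above [M], hence the shift by one. [S] is not [-oo] because it bounds an actual
     ratio. *)
  exists (fine S), (Num.max 0 (M + 1)) => t; rewrite ge_max => /andP[t0 Mt].
  have Vt : V t by apply: MV; lra.
  have p0 : 0 < part t ^+ 2 by rewrite exprn_gt0// (lt_le_trans ltr01)// part1.
  rewrite -ler_pdivrMr// -lee_fin fineK.
    by apply: ereal_sup_ubound; exists t.
  rewrite fin_numElt supV andbT (@lt_le_trans _ _ (part (2 * t) / part t ^+ 2)%:E) ?ltNyr//.
  by apply: ereal_sup_ubound; exists t.
have [Q QP] := infinite_volume_exists hW aeg mG G0 (gibbs_real_aa alpha w_meas w_pos)
   (local_gibbs_real alpha w_meas w_pos) (gibbs_real_shift alpha w_meas w_pos) ge1
   (gibbs_real_super halpha w_meas w_pos) int_G doubling.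
exists Q => a b ab.
pose n := (Num.truncn `|a| + Num.truncn `|b|).+1.
have abn : `[a, b] `<=` sym_itv n.
  have an : `|a| <= n%:R.
    by have /andP[_ /ltW/le_trans] := truncn_itv (normr_ge0 a); apply; rewrite ler_nat ltnS leq_addr.
  have bn : `|b| <= n%:R.
    by have /andP[_ /ltW/le_trans] := truncn_itv (normr_ge0 b); apply; rewrite ler_nat ltnS leq_addl.
  move: an bn; rewrite !ler_norml => /andP[an _] /andP[_ bn] s.
  rewrite /sym_itv/= !in_itv/= => /andP[sa sb].
  by rewrite (le_trans an)// (le_trans sb).
have cyl A : incr_sigma `[a, b] A -> cylinder n A.
  move=> sA; split; first exact: incr_sigma_measurable sA.
  exact: local_sub abn (local_incr_sigma sA).
(* A supremum of absolute values could still be [-oo] over an empty family; the empty event excludes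
   this. *)
have tv_ge0 T : (0 <= total_variation_on (incr_sigma `[a, b]) (gibbs_measure W w alpha T) Q)%E.
  apply: (@le_trans _ _ `|gibbs_measure W w alpha T set0 - Q set0|%E) => //.
  apply: ereal_sup_ubound; exists set0 => //; exact: sigma_algebra0.
have tv_le eps : 0 < eps -> exists T1, forall T, T1 <= T ->
    (total_variation_on (incr_sigma `[a, b]) (gibbs_measure W w alpha T) Q <= eps%:E)%E.
  move=> eps0; have [T1 h1] := QP n eps eps0.
  exists (Num.max 0 T1) => T; rewrite ge_max => /andP[T00 T1T].
  apply: ge_ereal_sup => _ [A /cyl cA <-]; have [mA _] := cA.
  have := h1 T A T1T cA; rewrite /gibbs_measure -/(part _).
  rewrite (integral_gibbs_weight_real hW halpha w_meas w_pos Z_fin)//.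
  have fG : (\int[W]_(x in A) (gibbs_real alpha w x (- T) T)%:E)%E \is a fin_num.
    rewrite ge0_fin_numE; last by apply: integral_ge0 => x _; rewrite lee_fin.
    apply: (@le_lt_trans _ _ (\int[W]_x (gibbs_real alpha w x (- T) T)%:E)%E).
      by apply: ge0_subset_integral => //; [exact/measurable_EFinP|move=> x _; rewrite lee_fin].
    by rewrite int_G ?ltry//; lra.
  rewrite -[in X in _ -> X](fineK fG) -[in X in _ -> X](fineK (fin_num_measure Q _ mA)).
  by rewrite -EFinM -EFinB abse_EFin lee_fin mulrC.
apply/fine_cvgP; split.
  have [T1 h1] := tv_le 1 ltr01; near=> T.
  rewrite ge0_fin_numE//; apply: le_lt_trans (h1 T _) (ltry _).
  by near: T; apply: nbhs_pinfty_ge; rewrite num_real.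
apply/cvgrPdist_le => eps eps0; have [T1 h1] := tv_le eps eps0; near=> T.
have TT : T1 <= T by near: T; apply: nbhs_pinfty_ge; rewrite num_real.
rewrite /= sub0r normrN ger0_norm ?fine_ge0// -lee_fin fineK ?h1//.
by rewrite ge0_fin_numE//; apply: le_lt_trans (h1 T TT) (ltry _).
Unshelve. all: by end_near. Qed.
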